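(* Let $(E,\langle\cdot,\cdot\rangle,\rho,\diamond)$ be a holomorphic Courant algebroid over a complex manifold $X$, with sheaf of holomorphic sections $\mathcal E$ and corresponding flat $T_X^{0,1}$-connection $\nabla$ on $E$. Then the two complex Courant algebroids $C_X^{0,1}=T_X^{0,1}\oplus(T_X^{0,1})^*$ and $E^{1,0}$, together with the flat connections $$\overrightarrow\nabla_{Y\oplus\eta}e=\nabla_Ye,\qquad \overleftarrow\nabla_e(Y\oplus\eta)=\mathrm{pr}^{0,1}\big([\rho^{1,0}(e),Y]\oplus\mathcal L_{\rho^{1,0}(e)}\eta\big)$$ ($e\in\Gamma(E)$, $Y\oplus\eta\in\Gamma(C_X^{0,1})$), constitute a matched pair of complex Courant algebroids.
   Context: A complex Courant algebroid is a complex vector bundle $E\to M$ over a smooth manifold with a fibrewise symmetric nondegenerate $\mathbb C$-bilinear form $\langle\cdot,\cdot\rangle$, a $\mathbb C$-bilinear operation $\diamond$ on $\Gamma(E)$ and an anchor $\rho:E\to TM\otimes\mathbb C$ such that for all $\phi,\psi,\psi_1,\psi_2\in\Gamma(E)$, $f\in C^\infty(M;\mathbb C)$: (i) $\phi\diamond(\psi_1\diamond\psi_2)=(\phi\diamond\psi_1)\diamond\psi_2+\psi_1\diamond(\phi\diamond\psi_2)$; (ii) $\phi\diamond(f\psi)=\rho(\phi)[f]\psi+f(\phi\diamond\psi)$; (iii) $\phi\diamond\phi=\frac12\mathcal D\langle\phi,\phi\rangle$; (iv) $\rho(\phi)\langle\psi,\psi\rangle=2\langle\phi\diamond\psi,\psi\rangle$,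 where $\mathcal D=\rho^*\circ d$, i.e. $\langle\mathcal Df,\phi\rangle=\rho(\phi)[f]$. A holomorphic Courant algebroid over $X$ is a holomorphic vector bundle $E\to X$ with sheaf of holomorphic sections $\mathcal E$, a $\mathbb C$-valued nondegenerate (symmetric $\mathbb C$-bilinear) inner product on fibres inducing an $\mathcal O_X$-module map $\mathcal E\otimes_{\mathcal O_X}\mathcal E\to\mathcal O_X$, a bundle map $\rho:E\to T_X$ inducing an $\mathcal O_X$-module map from $\mathcal E$ to the sheaf of holomorphic sections of $T_X$, and a map of sheaves of $\mathbb C$-modules $\diamond:\mathcal E\otimes_{\mathbb C}\mathcal E\to\mathcal E$ satisfying (i)–(iv) for local sections of $\mathcal E$ and $f\in\mathcal O_X$, with $\mathcal D=\rho^*\circ\partial:\mathcal O_X\to\mathcal E$. The flat $T_X^{0,1}$-connection $\nabla$ is the one with $\mathcal E(U)=\{\sigma\in\Gamma(U;E):\nabla_Y\sigma=0\ \forall Y\in\mathfrak X^{0,1}\}$. With $j$ the complex structure of $T_X$, put $\rho^{1,0}=\frac12(\mathrm{id}-\sqrt{-1}\,j)\circ\rho:E\to T_X^{1,0}\subset T_X\otimes\mathbb C$. $E^{1,0}$ denotes the unique complex Courant algebroid structure on the smooth complex vector bundle $E$ with inner product $\langle\cdot,\cdot\rangle$, anchor $\rho^{1,0}$, and Dorfman bracket restricting to $\diamond$ on $\mathcal E$. $C_X^{0,1}$ is the standard (untwisted) complex Courant algebroid of the Lie algebroid $T_X^{0,1}$: inner product $\langle Y\oplus\eta,Y'\oplus\eta'\rangle=\eta(Y')+\eta'(Y)$,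 anchor $Y\oplus\eta\mapsto Y$, bracket $(Y\oplus\eta)\diamond(Y'\oplus\eta')=[Y,Y']\oplus(\iota_Y\bar\partial\eta'+\bar\partial\iota_Y\eta'-\iota_{Y'}\bar\partial\eta)$. $\mathrm{pr}^{0,1}$ is the projection of $(T_X\oplus T_X^* )\otimes\mathbb C$ onto $T_X^{0,1}\oplus(T_X^{0,1})^*$. Matched pairs. For an anchored bundle $(E,\rho)$ an $E$-connection on $V$ is a bilinear $\nabla:\Gamma(E)\otimes\Gamma(V)\to\Gamma(V)$ with $\nabla_{f\psi}v=f\nabla_\psi v$, $\nabla_\psi(fv)=(\rho(\psi)[f])v+f\nabla_\psi v$. Two Courant algebroids $E_1,E_2$ over the same base with an $E_1$-connection $\overrightarrow\nabla$ on $E_2$ and an $E_2$-connection $\overleftarrow\nabla$ on $E_1$ form a matched pair if the connections preserve the fibre metrics, satisfy $\overrightarrow\nabla_{\mathcal D_1f}\beta=0$, $\overleftarrow\nabla_{\mathcal D_2f}b=0$ for all functions $f$ and sections $b$ of $E_1$, $\beta$ of $E_2$, and satisfy, for all sections $a,a_i$ of $E_1$ and $\alpha,\alpha_i$ of $E_2$: (1) $\overleftarrow\nabla_\alpha(a_1\diamond_1a_2)-(\overleftarrow\nabla_\alpha a_1)\diamond_1a_2-a_1\diamond_1(\overleftarrow\nabla_\alpha a_2)-\overleftarrow\nabla_{\overrightarrow\nabla_{a_2}\alpha}a_1+\overleftarrow\nabla_{\overrightarrow\nabla_{a_1}\alpha}a_2=-\mho(\alpha,\omega_{12})-\frac12\mathcal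 D_1\langle\alpha,\omega_{12}\rangle_2$ with $\omega_{12}=\Omega(a_1,a_2)+\frac12\mathcal D_2\langle a_1,a_2\rangle_1$; (2) the same with the roles of $(E_1,\overrightarrow\nabla,\Omega)$ and $(E_2,\overleftarrow\nabla,\mho)$ exchanged; (3) $\langle\overrightarrow R(a_1,a_2)\alpha_1,\alpha_2\rangle_2+\langle\overleftarrow R(\alpha_1,\alpha_2)a_1,a_2\rangle_1=0$, where $\overrightarrow R(a,b)=[\overrightarrow\nabla_a,\overrightarrow\nabla_b]-\overrightarrow\nabla_{a\diamond_1b}$, $\overleftarrow R(\alpha,\beta)=[\overleftarrow\nabla_\alpha,\overleftarrow\nabla_\beta]-\overleftarrow\nabla_{\alpha\diamond_2\beta}$ (a connection is flat if its curvature vanishes); (4) $\overleftarrow\nabla_{\Omega(a_1,a_2)}a_3+$ cyclic permutations $=0$; (5) $\overrightarrow\nabla_{\mho(\alpha_1,\alpha_2)}\alpha_3+$ cyclic permutations $=0$. Here $\Omega,\mho$ are the skew maps with $\langle\gamma,\Omega(a,b)\rangle_2=\frac12(\langle\overleftarrow\nabla_\gamma a,b\rangle_1-\langle a,\overleftarrow\nabla_\gamma b\rangle_1)$ and $\langle c,\mho(\alpha,\beta)\rangle_1=\frac12(\langle\overrightarrow\nabla_c\alpha,\beta\rangle_2-\langle\alpha,\overrightarrow\nabla_c\beta\rangle_2)$. In the claim $E_1=C_X^{0,1}$ and $E_2=E^{1,0}$. *)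

(* Defs.v *)
From HB Require Import structures.
From mathcomp Require Import all_boot all_order all_algebra.
From mathcomp Require Import complex.
From mathcomp Require Import all_classical all_reals all_analysis.

(* MathComp-Analysis.  Complex numbers are R[i] for R : realType.

   Conventions.
   - C^n is identified with R^(n+n): the coordinates are x_1..x_n, y_1..y_n,
     with z_k = x_k + i y_k.
   - Functions X -> R[i] and sections of bundles are total; those defined on an
     open set U only are represented by total ones, considered on U.
   - Vectors and covectors at p are given by their components in a preferred
     chart chart_at p containing p. *)

Set Implicit Arguments.
Unset Strict Implicit.
Unset Printing Implicit Defensive.

Import Order.TTheory GRing.Theory Num.Theory.
Import numFieldNormedType.Exports.

Local Open Scope classical_set_scope.
Local Open Scope ring_scope.
Local Open Scope complex_scope.

Definition eq_on (X : Type) (F : X -> Type) (U : set X) (s t : forall x, F x) :=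
  forall x, U x -> s x = t x.

Section ComplexManifolds.
Context (R : realType).

Fixpoint Ck_on (m k : nat) (W : set 'rV[R]_m) (f : 'rV[R]_m -> R) : Prop :=
  (forall x, W x -> {for x, continuous f}) /\
  match k with
  | 0%N => True
  | k'.+1 => forall i : 'I_m,
      (forall x, W x -> derivable f x (delta_mx 0 i)) /\
      Ck_on k' W (fun x => 'D_(delta_mx 0 i) f x)
  end.

Definition Coo_on (m : nat) (W : set 'rV[R]_m) (f : 'rV[R]_m -> R) : Prop :=
  forall k, Ck_on k W f.

Record charts (X : topologicalType) (n : nat) := Charts {
  chart_idx : Type;
  chart_dom : chart_idx -> set X;
  chart : chart_idx -> X -> 'rV[R]_(n + n);
  chart_inv : chart_idx -> 'rV[R]_(n + n) -> X;
  chart_at : X -> chart_idx }.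

Context (X : topologicalType) (n : nat) (M : charts X n).

Definition xycoord (a : chart_idx M) (k : 'I_(n + n)) (p : X) : R[i] :=
  (chart a p 0 k)%:C.

Definition zcoord (a : chart_idx M) (k : 'I_n) (p : X) : R[i] :=
  chart a p 0 (lshift n k) +i* chart a p 0 (rshift n k).

Definition zbcoord (a : chart_idx M) (k : 'I_n) (p : X) : R[i] :=
  (zcoord a k p)^*.

Definition smooth (U : set X) (f : X -> R[i]) : Prop :=
  forall a : chart_idx M,
    Coo_on (chart a @` (chart_dom a `&` U))
           (fun w => complex.Re (f (chart_inv a w))) /\
    Coo_on (chart a @` (chart_dom a `&` U))
           (fun w => complex.Im (f (chart_inv a w))).

(* the derivative of f at p along the k-th real coordinate of the chart a *)
Definition dxy (a : chart_idx M) (k : 'I_(n + n)) (f : X -> R[i]) (p : X)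
    : R[i] :=
  ('D_(delta_mx 0 k) (fun w => complex.Re (f (chart_inv a w))) (chart a p))
  +i* ('D_(delta_mx 0 k) (fun w => complex.Im (f (chart_inv a w))) (chart a p)).

(* the Wirtinger derivative d/dzbar_k *)
Definition dzb (a : chart_idx M) (k : 'I_n) (f : X -> R[i]) (p : X) : R[i] :=
  2^-1 * (dxy a (lshift n k) f p + 'i * dxy a (rshift n k) f p).

Definition holomorphic (U : set X) (f : X -> R[i]) : Prop :=
  smooth U f /\
  forall (a : chart_idx M) k p, U p -> chart_dom a p -> dzb a k f p = 0.

(* chart_transition says that the transition maps are holomorphic: the
   coordinates of a are holomorphic functions in every chart meeting dom a. *)
Record complex_manifold : Prop := ComplexManifold {
  chart_dom_open : forall a : chart_idx M, open (chart_dom a);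
  chart_at_dom : forall p, chart_dom (chart_at M p) p;
  chart_img_open : forall a : chart_idx M, open (chart a @` chart_dom a);
  chart_invK : forall (a : chart_idx M) p,
    chart_dom a p -> chart_inv a (chart a p) = p;
  chart_continuous : forall (a : chart_idx M) p,
    chart_dom a p -> {for p, continuous (chart a)};
  chart_inv_continuous : forall (a : chart_idx M) p,
    chart_dom a p -> {for chart a p, continuous (chart_inv a)};
  chart_transition : forall (a : chart_idx M) k,
    holomorphic (chart_dom a) (zcoord a k);
  manifold_hausdorff : hausdorff_space X;
  manifold_second_countable : @second_countable X }.

(* A row vector v : 'rV[R]_(n + n) at p stands for the real tangent vector
   sum_k v_k d/d(xy)_k of the chart chart_at p; v : 'rV[R[i]]_(n + n) stands in
   the same way for an element of T_pX (x) C, or of T*_pX (x) C (with respect to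
   the dual basis d(xy)_k). *)

Definition tact (p : X) (v : 'rV[R[i]]_(n + n)) (f : X -> R[i]) : R[i] :=
  \sum_k v 0 k * dxy (chart_at M p) k f p.

Notation vfield := (X -> 'rV[R[i]]_(n + n)).

Definition vact (V : vfield) (f : X -> R[i]) (p : X) : R[i] := tact p (V p) f.

(* the components V[xy_k] of V in each chart are smooth *)
Definition vsmooth (U : set X) (V : vfield) : Prop :=
  forall (a : chart_idx M) k,
    smooth (U `&` chart_dom a) (vact V (xycoord a k)).

(* [V, W]: its components in chart_at p are V[W[xy_k]] - W[V[xy_k]] *)
Definition lie (V W : vfield) : vfield := fun p =>
  \row_k (vact V (vact W (xycoord (chart_at M p) k)) p
          - vact W (vact V (xycoord (chart_at M p) k)) p).

(* the coordinate vector field d/d(xy)_k of the chart a *)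
Definition coord_vf (a : chart_idx M) (k : 'I_(n + n)) : vfield := fun q =>
  \row_l dxy a k (xycoord (chart_at M q) l) q.

Definition pair (m : nat) (xi v : 'rV[R[i]]_m) : R[i] :=
  \sum_k xi 0 k * v 0 k.

(* (L_V xi)(W) = V[xi(W)] - xi([V, W]), on the coordinate fields W *)
Definition lie_form (V : vfield) (xi : X -> 'rV[R[i]]_(n + n))
    : X -> 'rV[R[i]]_(n + n) := fun p =>
  \row_k (let W := coord_vf (chart_at M p) k in
          vact V (fun q => pair (xi q) (W q)) p - pair (xi p) (lie V W p)).

(* the complex structure: j d/dx_k = d/dy_k, j d/dy_k = - d/dx_k *)
Definition jstr (K : pzRingType) (v : 'rV[K]_(n + n)) : 'rV[K]_(n + n) :=
  row_mx (- rsubmx v) (lsubmx v).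

Definition cplx (v : 'rV[R]_(n + n)) : 'rV[R[i]]_(n + n) :=
  map_mx (real_complex R) v.

(* A real vector field is a holomorphic section of (T_X, j) iff its complex
   components V[z_k] are holomorphic. *)
Definition holomorphic_vf (U : set X) (V : X -> 'rV[R]_(n + n)) : Prop :=
  forall (a : chart_idx M) k,
    holomorphic (U `&` chart_dom a) (vact (fun p => cplx (V p)) (zcoord a k)).

(* T^{0,1} and its dual have bases d/dzbar_k and dzbar_k.  emb01 and emb01d are
   the inclusions in T (x) C and T* (x) C; pr01 and pr01d are the projections
   along T^{1,0} and its dual. *)
Definition emb01 (w : 'rV[R[i]]_n) : 'rV[R[i]]_(n + n) :=
  2^-1 *: row_mx w ('i *: w).
Definition pr01 (v : 'rV[R[i]]_(n + n)) : 'rV[R[i]]_n :=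
  lsubmx v - 'i *: rsubmx v.
Definition emb01d (eta : 'rV[R[i]]_n) : 'rV[R[i]]_(n + n) :=
  row_mx eta (- 'i *: eta).
Definition pr01d (xi : 'rV[R[i]]_(n + n)) : 'rV[R[i]]_n :=
  2^-1 *: (lsubmx xi + 'i *: rsubmx xi).

Lemma pr01K : cancel emb01 pr01.
Proof.
move=> w; rewrite /pr01 /emb01 scale_row_mx row_mxKl row_mxKr !scalerA.
rewrite mulrAC -expr2 sqr_i mulN1r scaleNr opprK -scalerDl.
by rewrite -mulr2n -[_ *+ 2]mulr_natl mulfV ?scale1r ?pnatr_eq0.
Qed.

Lemma T01P (v : 'rV[R[i]]_(n + n)) :
  jstr v = - 'i *: v <-> exists w, v = emb01 w.
Proof.
have ii : 'i * 'i = -1 :> R[i] by rewrite -expr2 sqr_i.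
split=> [|[w ->]].
  rewrite -[v in RHS]hsubmxK scale_row_mx => /eq_row_mx [vr _].
  exists (2 *: lsubmx v); rewrite -[v in LHS]hsubmxK /emb01 scale_row_mx.
  rewrite !scalerA mulrAC mulVf ?pnatr_eq0 // mul1r scale1r.
  by congr row_mx; rewrite -[RHS]opprK -scaleNr -vr opprK.
rewrite /jstr /emb01 !scale_row_mx row_mxKl row_mxKr !scalerA -scaleNr.
congr row_mx; congr (_ *: _); first by rewrite mulrC mulNr.
by rewrite mulrCA mulNr ii opprK mulr1.
Qed.

End ComplexManifolds.

Section Bundles.
Context (R : realType) (X : topologicalType).

(* complex vector bundles, as families of fibres with local trivialisations *)
Record bundle := Bundle {
  fibre :> X -> lmodType R[i];
  tidx : Type;
  tdom : tidx -> set X;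
  trank : tidx -> nat;
  triv : forall j x, fibre x -> 'rV[R[i]]_(trank j);
  trivV : forall j x, 'rV[R[i]]_(trank j) -> fibre x }.

Definition section (E : bundle) := forall x, E x.

(* vector bundles with transition functions in the class F of functions *)
Record vector_bundle (F : set X -> (X -> R[i]) -> Prop) (E : bundle) : Prop :=
  VectorBundle {
  tdom_open : forall j : tidx E, open (tdom j);
  tdom_cover : forall x, exists j : tidx E, tdom j x;
  triv_linear : forall (j : tidx E) x (c : R[i]) (u v : E x), tdom j x ->
    triv j (c *: u + v) = c *: triv j u + triv j v;
  trivK : forall (j : tidx E) x (u : E x), tdom j x ->
    trivV x (triv j u) = u;
  trivVK : forall (j : tidx E) x w, tdom j x ->
    triv j (trivV (b := E) x w) = w;
  triv_transition : forall (j j' : tidx E) w k,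
    F (tdom j `&` tdom j') (fun x => triv j' (trivV (j := j) x w) 0 k) }.

(* sections whose components are in the class F of functions *)
Definition section_on (F : set X -> (X -> R[i]) -> Prop) (E : bundle)
    (U : set X) (s : section E) : Prop :=
  forall (j : tidx E) k, F (U `&` tdom j) (fun x => triv j (s x) 0 k).

Definition dsum_bundle (E1 E2 : bundle) : bundle :=
  {| fibre := fun x => (E1 x * E2 x)%type : lmodType R[i];
     tidx := (tidx E1 * tidx E2)%type;
     tdom := fun j => tdom j.1 `&` tdom j.2;
     trank := fun j => (trank j.1 + trank j.2)%N;
     triv := fun j x u => row_mx (triv j.1 u.1) (triv j.2 u.2);
     trivV := fun j x w => (trivV x (lsubmx w), trivV x (rsubmx w)) |}.

End Bundles.

Section CourantAlgebroids.
Context (R : realType) (X : topologicalType) (n : nat) (M : charts R X n).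

Notation vfield := (X -> 'rV[R[i]]_(n + n)).
Notation Gamma E := (section_on (smooth M) (E := E) [set: X]).
Notation smooth_fun f := (smooth M [set: X] f).

(* bundle maps E -> T_X (x) C (linearity is in courant_algebroid) *)
Definition anchor_map (E : bundle R X) := forall x, E x -> 'rV[R[i]]_(n + n).

Definition fibre_form (E : bundle R X) := forall x, E x -> E x -> R[i].

Definition fibre_metric (E : bundle R X) (inner : fibre_form E) : Prop :=
  forall x,
  [/\ forall c (u v w : E x),
        inner x (c *: u + v) w = c * inner x u w + inner x v w,
      forall u v : E x, inner x u v = inner x v u
    & forall u : E x, (forall v, inner x u v = 0) -> u = 0].

(* D f = rho^* d f : <D f, v> = rho(v)[f] *)
Definition calD (E : bundle R X) (inner : fibre_form E) (rho : anchor_map E)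
    (f : X -> R[i]) : section E := fun x =>
  xget 0 [set u : E x | forall v : E x, inner x u v = tact M x (rho x v) f].

(* for sections in S and functions in F, with equalities holding on U *)
Record dorfman_axioms (E : bundle R X) (inner : fibre_form E)
    (rho : anchor_map E) (dorf : section E -> section E -> section E)
    (U : set X) (F : (X -> R[i]) -> Prop) (S : section E -> Prop) : Prop :=
  DorfmanAxioms {
  dorf_linearl : forall c phi phi' psi, S phi -> S phi' -> S psi ->
    eq_on U (dorf (fun x => c *: phi x + phi' x) psi)
            (fun x => c *: dorf phi psi x + dorf phi' psi x);
  dorf_linearr : forall c phi psi psi', S phi -> S psi -> S psi' ->
    eq_on U (dorf phi (fun x => c *: psi x + psi' x))
            (fun x => c *: dorf phi psi x + dorf phi psi' x);
  dorf_jacobi : forall phi psi1 psi2, S phi -> S psi1 -> S psi2 ->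
    eq_on U (dorf phi (dorf psi1 psi2))
            (fun x => dorf (dorf phi psi1) psi2 x + dorf psi1 (dorf phi psi2) x);
  dorf_leibniz : forall f phi psi, F f -> S phi -> S psi ->
    eq_on U (dorf phi (fun x => f x *: psi x))
            (fun x => vact M (fun q => rho q (phi q)) f x *: psi x
                      + f x *: dorf phi psi x);
  dorf_diag : forall phi, S phi ->
    eq_on U (dorf phi phi)
            (fun x => 2^-1 *:
               calD inner rho (fun q => inner q (phi q) (phi q)) x);
  dorf_metric : forall phi psi, S phi -> S psi ->
    eq_on U (vact M (fun q => rho q (phi q))
                    (fun q => inner q (psi q) (psi q)))
            (fun x => 2 * inner x (dorf phi psi x) (psi x)) }.

Record courant := Courant {
  cbundle :> bundle R X;
  cinner : fibre_form cbundle;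
  canchor : anchor_map cbundle;
  cdorf : section cbundle -> section cbundle -> section cbundle }.

Record courant_algebroid (A : courant) : Prop := CourantAlgebroid {
  courant_bundle : vector_bundle (smooth M) A;
  courant_metric : fibre_metric (@cinner A);
  courant_inner_smooth : forall U phi psi, open U ->
    section_on (smooth M) U phi -> section_on (smooth M) U psi ->
    smooth M U (fun x => @cinner A x (phi x) (psi x));
  courant_anchor_linear : forall x c (u v : A x),
    canchor (c *: u + v) = c *: canchor u + canchor v;
  courant_anchor_smooth : forall U phi, open U ->
    section_on (smooth M) U phi ->
    vsmooth M U (fun x => @canchor A x (phi x));
  courant_dorf_smooth : forall phi psi, Gamma A phi -> Gamma A psi ->
    Gamma A (@cdorf A phi psi);
  courant_dorfman : dorfman_axioms (@cinner A) (@canchor A) (@cdorf A)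
    [set: X] (smooth M [set: X]) (section_on (smooth M) [set: X]) }.

Record connection (E : bundle R X) (rho : anchor_map E) (V : bundle R X)
    (nab : section E -> section V -> section V) : Prop := Connection {
  nab_smooth : forall e v, Gamma E e -> Gamma V v -> Gamma V (nab e v);
  nab_addl : forall e e' v, Gamma E e -> Gamma E e' -> Gamma V v ->
    nab (fun x => e x + e' x) v = (fun x => nab e v x + nab e' v x);
  nab_addr : forall e v v', Gamma E e -> Gamma V v -> Gamma V v' ->
    nab e (fun x => v x + v' x) = (fun x => nab e v x + nab e v' x);
  nab_scalel : forall f e v, smooth_fun f -> Gamma E e -> Gamma V v ->
    nab (fun x => f x *: e x) v = (fun x => f x *: nab e v x);
  nab_leibniz : forall f e v, smooth_fun f -> Gamma E e -> Gamma V v ->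
    nab e (fun x => f x *: v x)
    = (fun x => vact M (fun q => rho q (e q)) f x *: v x + f x *: nab e v x) }.

Definition curvature (E V : bundle R X)
    (br : section E -> section E -> section E)
    (nab : section E -> section V -> section V) (a b : section E)
    (v : section V) : section V := fun x =>
  nab a (nab b v) x - nab b (nab a v) x - nab (br a b) v x.

Definition flat (E V : bundle R X)
    (br : section E -> section E -> section E)
    (nab : section E -> section V -> section V) : Prop :=
  forall a b v, Gamma E a -> Gamma E b -> Gamma V v ->
    curvature br nab a b v = (fun=> 0).

Section MatchedPairs.

(* for nab a B-connection on A, the section Omega(a, b) of B determined by
   <g, Omega(a, b)>_B = 1/2 (<nab_g a, b>_A - <a, nab_g b>_A) *)
Definition skew_map (A B : courant) (nab : section B -> section A -> section A)
    (a b : section A) : section B := fun x =>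
  xget 0 [set u : B x | forall g : section B, Gamma B g ->
    cinner (g x) u
    = 2^-1 * (cinner (nab g a x) (b x) - cinner (a x) (nab g b x))].

Definition preserves_metric (A B : courant)
    (nab : section A -> section B -> section B) : Prop :=
  forall a (u v : section B), Gamma A a -> Gamma B u -> Gamma B v ->
    vact M (fun q => canchor (a q)) (fun q => cinner (u q) (v q))
    = (fun x => cinner (nab a u x) (v x) + cinner (u x) (nab a v x)).

Definition kills_exact (A B : courant)
    (nab : section A -> section B -> section B) : Prop :=
  forall f (v : section B), smooth_fun f -> Gamma B v ->
    nab (calD (@cinner A) (@canchor A) f) v = (fun=> 0).

(* right is an A1-connection on A2, and left an A2-connection on A1 *)
Definition bracket_compat (A1 A2 : courant)
    (right : section A1 -> section A2 -> section A2)
    (left : section A2 -> section A1 -> section A1) : Prop :=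
  forall (a1 a2 : section A1) (al : section A2),
    Gamma A1 a1 -> Gamma A1 a2 -> Gamma A2 al ->
    let Omega := skew_map left in
    let Mho := skew_map right in
    let D1 := calD (@cinner A1) (@canchor A1) in
    let D2 := calD (@cinner A2) (@canchor A2) in
    let omega := fun x =>
      Omega a1 a2 x + 2^-1 *: D2 (fun q => cinner (a1 q) (a2 q)) x in
    forall x,
      left al (cdorf a1 a2) x - cdorf (left al a1) a2 x
      - cdorf a1 (left al a2) x
      - left (right a2 al) a1 x + left (right a1 al) a2 x
      = - Mho al omega x - 2^-1 *: D1 (fun q => cinner (al q) (omega q)) x.

Definition curvature_compat (A1 A2 : courant)
    (right : section A1 -> section A2 -> section A2)
    (left : section A2 -> section A1 -> section A1) : Prop :=
  forall (a1 a2 : section A1) (al1 al2 : section A2),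
    Gamma A1 a1 -> Gamma A1 a2 -> Gamma A2 al1 -> Gamma A2 al2 ->
    forall x,
      cinner (curvature (@cdorf A1) right a1 a2 al1 x) (al2 x)
      + cinner (curvature (@cdorf A2) left al1 al2 a1 x) (a2 x) = 0.

Definition cyclic_compat (A1 A2 : courant)
    (left : section A2 -> section A1 -> section A1) : Prop :=
  forall a1 a2 a3 : section A1, Gamma A1 a1 -> Gamma A1 a2 -> Gamma A1 a3 ->
    let Omega := skew_map left in
    forall x,
      left (Omega a1 a2) a3 x + left (Omega a2 a3) a1 x
      + left (Omega a3 a1) a2 x = 0.

Record matched_pair (A1 A2 : courant)
    (right : section A1 -> section A2 -> section A2)
    (left : section A2 -> section A1 -> section A1) : Prop := MatchedPair {
  mp_courant1 : courant_algebroid A1;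
  mp_courant2 : courant_algebroid A2;
  mp_right : connection (@canchor A1) right;
  mp_left : connection (@canchor A2) left;
  mp_right_metric : preserves_metric right;
  mp_left_metric : preserves_metric left;
  mp_right_exact : kills_exact right;
  mp_left_exact : kills_exact left;
  mp_bracket1 : bracket_compat right left;
  mp_bracket2 : bracket_compat left right;
  mp_curvature : curvature_compat right left;
  mp_cyclic1 : cyclic_compat left;
  mp_cyclic2 : cyclic_compat right }.

End MatchedPairs.

Section T01.

Notation dzb_at x := (dzb (chart_at M x)).

(* the components of Y in the chart a are Y[zbar_k] *)
Definition T01 : bundle R X :=
  {| fibre := fun=> 'rV[R[i]]_n : lmodType R[i];
     tidx := chart_idx M;
     tdom := @chart_dom R X n M;
     trank := fun=> n;
     triv := fun a x Y => \row_k tact M x (emb01 Y) (zbcoord a k);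
     trivV := fun a x w =>
       \row_k \sum_l w 0 l * dzb a l (zbcoord (chart_at M x) k) x |}.

(* the components of eta in the chart a are eta(d/dzbar_k) *)
Definition T01dual : bundle R X :=
  {| fibre := fun=> 'rV[R[i]]_n : lmodType R[i];
     tidx := chart_idx M;
     tdom := @chart_dom R X n M;
     trank := fun=> n;
     triv := fun a x eta => \row_k pair eta (trivV (b := T01) (j := a) x (delta_mx 0 k));
     trivV := fun a x w =>
       \row_k \sum_l w 0 l * dzb (chart_at M x) k (zbcoord a l) x |}.

Definition anchor01 : anchor_map T01 := fun _ => @emb01 R n.

(* T^{0,1} is involutive, so that pr01 only changes the type *)
Definition lie01 (Y Y' : section T01) : section T01 := fun x =>
  pr01 (lie M (fun q => emb01 (Y q)) (fun q => emb01 (Y' q)) x).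

Definition act01 (Y : section T01) : (X -> R[i]) -> X -> R[i] :=
  vact M (fun q => emb01 (Y q)).

Definition coord_vf01 (a : chart_idx M) (k : 'I_n) : section T01 := fun x =>
  trivV (b := T01) (j := a) x (delta_mx 0 k).

(* dbar on functions and on sections of (T^{0,1})^*, where
   (dbar eta)(Y, Y') = Y[eta(Y')] - Y'[eta(Y)] - eta([Y, Y']);
   iota_dbar Y eta is iota_Y dbar eta *)
Definition dbar0 (f : X -> R[i]) : section T01dual := fun x =>
  \row_k act01 (coord_vf01 (chart_at M x) k) f x.

Definition dbar1 (eta : section T01dual) (Y Y' : section T01) (x : X) : R[i] :=
  act01 Y (fun q => pair (eta q) (Y' q)) x
  - act01 Y' (fun q => pair (eta q) (Y q)) x
  - pair (eta x) (lie01 Y Y' x).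

Definition iota_dbar (Y : section T01) (eta : section T01dual)
    : section T01dual := fun x =>
  \row_k dbar1 eta Y (coord_vf01 (chart_at M x) k) x.

Definition C01 : courant :=
  {| cbundle := dsum_bundle T01 T01dual;
     cinner := fun x u v => pair u.2 v.1 + pair v.2 u.1;
     canchor := fun x u => emb01 u.1;
     cdorf := fun b b' =>
       let Y : section T01 := fun q => (b q).1 in
       let eta : section T01dual := fun q => (b q).2 in
       let Y' : section T01 := fun q => (b' q).1 in
       let eta' : section T01dual := fun q => (b' q).2 in
       fun x => (lie01 Y Y' x,
                 iota_dbar Y eta' x + dbar0 (fun q => pair (eta' q) (Y q)) x
                 - iota_dbar Y' eta x) |}.

End T01.

Section Holomorphic.

(* hdorf U is the bracket E(U) x E(U) -> E(U); hrho has values in the real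
   tangent bundle, which is a complex bundle through jstr. *)
Record hcourant := HCourant {
  hbundle :> bundle R X;
  hinner : fibre_form hbundle;
  hrho : forall x, hbundle x -> 'rV[R]_(n + n);
  hdorf : set X -> section hbundle -> section hbundle -> section hbundle }.

Notation hsection U s := (section_on (holomorphic M) U s).

Record holomorphic_courant_algebroid (H : hcourant) : Prop :=
  HolomorphicCourantAlgebroid {
  hcourant_bundle : vector_bundle (holomorphic M) H;
  hcourant_metric : fibre_metric (@hinner H);
  hcourant_inner_holomorphic : forall U (phi psi : section H), open U ->
    hsection U phi -> hsection U psi ->
    holomorphic M U (fun x => hinner (phi x) (psi x));
  hcourant_rho_add : forall x (u v : H x), hrho (u + v) = hrho u + hrho v;
  hcourant_rho_scale : forall x c (u : H x),
    hrho (c *: u)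
    = complex.Re c *: hrho u + complex.Im c *: jstr (hrho u);
  hcourant_rho_holomorphic : forall U (phi : section H), open U ->
    hsection U phi -> holomorphic_vf M U (fun x => hrho (phi x));
  hcourant_dorf_holomorphic : forall U (phi psi : section H), open U ->
    hsection U phi -> hsection U psi -> hsection U (hdorf U phi psi);
  hcourant_dorf_local : forall U (phi phi' psi psi' : section H), open U ->
    hsection U phi -> hsection U psi -> eq_on U phi phi' -> eq_on U psi psi' ->
    eq_on U (hdorf U phi psi) (hdorf U phi' psi');
  hcourant_dorf_restr : forall U V (phi psi : section H), open U -> open V ->
    V `<=` U -> hsection U phi -> hsection U psi ->
    eq_on V (hdorf U phi psi) (hdorf V phi psi);
  hcourant_dorfman : forall U, open U ->
    dorfman_axioms (@hinner H) (fun x u => cplx (@hrho H x u)) (@hdorf H U)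
      U (holomorphic M U) (section_on (holomorphic M) U) }.

Variable H : hcourant.

(* rho^{1,0} = 1/2 (id - i j) o rho *)
Definition rho10 : anchor_map H := fun x u =>
  2^-1 *: (cplx (hrho u) - 'i *: jstr (cplx (hrho u))).

(* E with its inner product, the anchor rho^{1,0} and a Dorfman bracket *)
Definition E10 (dorf : section H -> section H -> section H) : courant :=
  {| cbundle := H; cinner := @hinner H; canchor := rho10; cdorf := dorf |}.

Definition restricts_to_hdorf (dorf : section H -> section H -> section H)
    : Prop :=
  forall U (phi psi : section H), open U -> Gamma H phi -> Gamma H psi ->
    hsection U phi -> hsection U psi ->
    eq_on U (dorf phi psi) (hdorf U phi psi).

(* nab is the flat T^{0,1}-connection on E whose parallel sections over open
   sets are the holomorphic ones *)
Definition holomorphic_connection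
    (nab : section T01 -> section H -> section H) : Prop :=
  [/\ connection anchor01 nab,
      flat lie01 nab
    & forall U (s : section H), open U -> Gamma H s ->
        (hsection U s <->
         forall Y, Gamma T01 Y -> eq_on U (nab Y s) (fun=> 0))].

Definition nabla_right (nab : section T01 -> section H -> section H)
    (b : section C01) (e : section H) : section H :=
  nab (fun x => (b x).1) e.

Definition nabla_left (e : section H) (b : section C01) : section C01 :=
  fun x =>
  let V := fun q => rho10 (e q) in
  (pr01 (lie M V (fun q => emb01 (b q).1) x),
   pr01d (lie_form M V (fun q => emb01d (b q).2) x)).

End Holomorphic.

End CourantAlgebroids.

(* Main.v *)
Require Import Defs.
From HB Require Import structures.
From mathcomp Require Import all_boot all_order all_algebra.
From mathcomp Require Import complex.
From mathcomp Require Import all_classical all_reals all_analysis.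
From mathcomp Require Import ring lra ssrAC.

(** The idea of the proof. Write V_e for the (1,0)-field rho10(e), L_V for the
    Lie derivative along V followed by the projection to T^{0,1} and its dual,
    and nabla for the connection along T^{0,1}. Everything rests on the formula
      [V_e, Y] = L_(V_e) Y - V_(nabla_Y e)
    for a field Y of type (0,1) (lie_rho10). Both sides change by the same
    amount when e is multiplied by a function, so the formula may be checked on
    local holomorphic sections e, for which nabla_Y e = 0 and V_e is a
    holomorphic field (tensorial_holomorphic is this reduction).

    The left connection. In a chart V_e kills the antiholomorphic coordinates,
    so that L_(V_e) differentiates components along V_e (lieT_triv). Hence it is
    tensorial in e, preserves the metric, and is flat because the anchor of a
    Courant algebroid is compatible with brackets (dorf_act). It kills exact
    sections because rho(D f) = 0 (calD_anchor).

    The right connection is flat by assumption. It preserves the metric since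
    inner products of holomorphic sections are holomorphic (nab_metric).

    The bracket conditions. For a metric connection the map
      Omega(a, b) + 1/2 D<a, b>
    is characterised by <g, Omega(a, b) + 1/2 D<a, b>> = <nabla_g a, b>
    (polar_mapP). Pairing the conditions with a section g therefore removes the
    tensors Omega and Mho (bracket_compat_pairing).
    In the first condition the terms on T^{0,1} reduce to the Jacobi identity
    of vector fields and the formula above (lieT_lie01); the terms on the dual
    are a computation in the Cartan calculus of T^{0,1}, which is carried out
    for abstract derivations and one-forms (form_bracket_transport).
    In the second condition the difference of both sides is a tensor in the two
    sections of E: it is tensorial in the second one (defect_tensorial) and
    antisymmetric (defect_anti), by the formula above in both cases. For
    holomorphic sections all its terms vanish, since the bracket of holomorphic
    sections is holomorphic.

    The remaining conditions. The curvature condition holds as both connections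
    are flat. For the cyclic conditions, Omega has values in the kernel of the
    anchor, because <D f, Omega(a, b)> = 0, and the part of Mho in T^{0,1} is
    zero; so both act trivially.

    That the bundle T^{0,1} + dual is a Courant algebroid (C01_courant) is
    another computation in the Cartan calculus. The passage between points,
    germs and global sections uses bump functions; they and the calculus of
    smooth functions on charts are built from the iterated partial derivatives
    in the definition of smoothness. *)

Set Implicit Arguments.
Unset Strict Implicit.
Unset Printing Implicit Defensive.

Import Order.TTheory GRing.Theory Num.Theory.
Import numFieldNormedType.Exports.

Local Open Scope classical_set_scope.
Local Open Scope ring_scope.

(** * Functions with continuous partial derivatives are differentiable *)

Section Euclidean.
Context (R : realType).

Lemma growth_line (m : nat) (f : 'rV[R]_m -> R) (x v : 'rV[R]_m) (s : R) :
  (fun h : R => h^-1 *: (((fun h : R => f (h *: v + x)) \o shift s) (h *: 1)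
                         - f (s *: v + x)))
  = (fun h : R => h^-1 *: ((f \o shift (s *: v + x)) (h *: v)
                         - f (s *: v + x))).
Proof.
apply/funext => h /=; congr (_ *: (f _ - _)).
by rewrite /GRing.scale /= mulr1 -/(_ *: _) scalerDl addrA.
Qed.

(** The directional derivative of f along v is the ordinary derivative of the
    restriction of f to a line, which gives access to the mean value theorem. *)
Lemma is_derive_line (m : nat) (f : 'rV[R]_m -> R) (x v : 'rV[R]_m) (s : R) :
  derivable f (s *: v + x) v ->
  is_derive s 1 (fun h : R => f (h *: v + x)) ('D_v f (s *: v + x)).
Proof.
move=> df; apply: DeriveDef; first by rewrite /derivable growth_line.
by rewrite /derive growth_line.
Qed.

Lemma MVT_signed (g dg : R -> R) (t : R) :
  (forall s : R, `|s| <= `|t| -> is_derive s 1 g (dg s)) ->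
  exists2 c, `|c| <= `|t| & g t - g 0 = dg c * t.
Proof.
move=> dgE.
have cg s : `|s| <= `|t| -> {for s, continuous g}.
  move=> /dgE ds; apply: differentiable_continuous; apply/derivable1_diffP.
  exact: ex_derive.
have [t0|t0] := leP 0 t.
  have [||c ct e] := @MVT_segment R g dg 0 t t0.
  - move=> x; rewrite in_itv /= => /andP[x0 xt]; apply: dgE.
    by rewrite !ger0_norm// ltW.
  - apply: continuous_in_subspaceT => x; rewrite inE /= in_itv /= => /andP[x0 xt].
    by apply: cg; rewrite !ger0_norm.
  exists c; last by rewrite e subr0.
  by move: ct; rewrite in_itv /= => /andP[c0 ct]; rewrite !ger0_norm.
have [||c ct e] := @MVT_segment R g dg t 0 (ltW t0).
- move=> x; rewrite in_itv /= => /andP[x0 xt]; apply: dgE.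
  by rewrite !ltr0_norm// lerN2 ltW.
- apply: continuous_in_subspaceT => x; rewrite inE /= in_itv /= => /andP[x0 xt].
  by apply: cg; rewrite (ltr0_norm t0) ler0_norm// lerN2.
exists c; last by rewrite -opprB e sub0r mulrN opprK.
move: ct; rewrite in_itv /= => /andP[c0 ct].
by rewrite (ltr0_norm t0) ler0_norm// lerN2.
Qed.

Lemma MVT_dir (m : nat) (f : 'rV[R]_m -> R) (x v : 'rV[R]_m) (t : R) :
  (forall s, `|s| <= `|t| -> derivable f (s *: v + x) v) ->
  exists2 c, `|c| <= `|t| &
    f (t *: v + x) - f x = t * 'D_v f (c *: v + x).
Proof.
move=> df.
have [s st|c ct e] := @MVT_signed (fun h => f (h *: v + x))
   (fun s => 'D_v f (s *: v + x)) t; first exact/is_derive_line/df.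
by exists c => //; move: e; rewrite scale0r add0r mulrC.
Qed.

Notation e_ i := (delta_mx 0 i).

Definition trunc (m : nat) (h : 'rV[R]_m) (k : nat) : 'rV[R]_m :=
  \row_i (if (i < k)%N then h 0 i else 0).

Lemma truncS m (h : 'rV[R]_m) (k : 'I_m) :
  trunc h k.+1 = h 0 k *: e_ k + trunc h k.
Proof.
apply/rowP => i; rewrite !mxE eqxx /= ltnS leq_eqVlt.
have [->|ik] /= := eqVneq i k; first by rewrite ltnn eqxx mulr1 addr0.
by rewrite (negbTE (ik : val i != val k)) mulr0 add0r.
Qed.

Lemma norm_rowP m (x : 'rV[R]_m) (r : R) : 0 <= r ->
  (`|x| <= r) <-> (forall i, `|x 0 i| <= r).
Proof.
move=> r0; rewrite [`|x|]mx_normrE; split=> [xr i|xr].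
  apply: le_trans xr; apply: (le_trans _ (le_bigmax _ _ (ord0, i))).
  exact: lexx.
by apply/bigmax_leP; split => // -[i j] _ /=; rewrite (ord1 i).
Qed.

Lemma norm_coord m (x : 'rV[R]_m) i : `|x 0 i| <= `|x|.
Proof. exact: (proj1 (norm_rowP x (normr_ge0 x))). Qed.

(** The points at which the mean value theorem is used on the path from 0 to h
    along the coordinate axes stay as close to 0 as h. *)
Lemma norm_trunc m (h : 'rV[R]_m) (k : 'I_m) (c : R) : `|c| <= `|h 0 k| ->
  `|c *: e_ k + trunc h k| <= `|h|.
Proof.
move=> ck; apply: (proj2 (norm_rowP _ (normr_ge0 h))) => i; rewrite !mxE eqxx /=.
have [->|ik] := eqVneq i k.
  by rewrite ltnn mulr1 addr0 (le_trans ck)// norm_coord.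
rewrite mulr0 add0r; case: ifP => _; first exact: norm_coord.
by rewrite normr0.
Qed.

Lemma continuous_sumr (T : topologicalType) (I : Type) (r : seq I)
    (F : I -> T -> R) (x : T) :
  (forall i, {for x, continuous (F i)}) ->
  {for x, continuous (fun y => \sum_(i <- r) F i y)}.
Proof.
move=> cF; elim: r => [|i r ih].
  by rewrite (_ : (fun=> _) = cst 0); [exact: cst_continuous
    |apply/funext => y; rewrite big_nil].
rewrite (_ : (fun=> _) = F i \+ (fun y => \sum_(j <- r) F j y)).
  exact: continuousD.
by apply/funext => y; rewrite big_cons.
Qed.

(** The increment of f along h is telescoped along the path that follows the
    coordinate axes; on each segment the mean value theorem produces a partial
    derivative at a point near x, which is close to the one at x. *)
Lemma differentiable_C1 (m : nat) (f : 'rV[R]_m -> R) (x : 'rV[R]_m) :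
  (\forall y \near x, forall i, derivable f y (e_ i)) ->
  (forall i, {for x, continuous (fun y => 'D_(e_ i) f y)}) ->
  differentiable f x /\
  forall h, 'D_h f x = \sum_i h 0 i * 'D_(e_ i) f x.
Proof.
move=> df cf.
pose L (h : 'rV[R]_m) : R := \sum_i h 0 i * 'D_(e_ i) f x.
have Llin : linear L.
  move=> c u v; rewrite /L scaler_sumr -big_split /=; apply: eq_bigr => i _.
  by rewrite !mxE mulrDl -mulrA.
pose LL := GRing.isLinear.Build _ _ _ _ L Llin.
pose Lh : {linear 'rV[R]_m -> R} := HB.pack L LL.
have Lc : continuous L.
  move=> y; apply: continuous_sumr => i.
  by apply: continuousM; [exact: coord_continuous|exact: cst_continuous].
have Lo (eps : R) : 0 < eps ->
    \forall h \near (0 : 'rV[R]_m), `|f (h + x) - f x - L h| <= eps * `|h|.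
  move=> eps0.
  (* Each of the m segments of the path contributes at most eps / (m + 1). *)
  have eps'0 : 0 < eps / (m.+1)%:R by rewrite divr_gt0.
  have [r /= r0 rP] : exists2 r : R, 0 < r & forall y, `|y - x| < r ->
     (forall i, derivable f y (e_ i)) /\
     (forall i, `|'D_(e_ i) f y - 'D_(e_ i) f x| < eps / (m.+1)%:R).
    have : \forall y \near x, (forall i, derivable f y (e_ i)) /\
       (forall i, `|'D_(e_ i) f y - 'D_(e_ i) f x| < eps / (m.+1)%:R).
      near=> y; split; near: y => //.
      apply: filter_forall => i; have := cf i.
      by move/cvgr_distC_lt => /(_ _ eps'0).
    by move=> /nbhs_ballP[r r0 rP]; exists r => // y yr; apply: rP;
      rewrite -ball_normE /ball_ /= distrC.
  have h0r : \forall h \near (0 : 'rV[R]_m), `|h| < r.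
    by apply/nbhs_normP; exists r => // h; rewrite /= sub0r normrN.
  near=> h => /=.
  have hr : `|h| < r.
    by near: h.
  have tele : f (h + x) - f x
      = \sum_(i < m) (f (trunc h i.+1 + x) - f (trunc h i + x)).
    rewrite -(big_mkord xpredT (fun i => f (trunc h i.+1 + x) - f (trunc h i + x))).
    rewrite telescope_sumr//; congr (f (_ + _) - f _).
      by apply/rowP => i; rewrite mxE ltn_ord.
    by rewrite -[LHS]add0r; congr (_ + _); apply/rowP => i; rewrite !mxE ltn0.
  rewrite tele /L -sumrB.
  apply: (le_trans (ler_norm_sum _ _ _)).
  have term (i : 'I_m) : `|f (trunc h i.+1 + x) - f (trunc h i + x)
      - h 0 i * 'D_(e_ i) f x| <= eps / (m.+1)%:R * `|h|.
    have nr c : `|c| <= `|h 0 i| -> `|(c *: e_ i + (trunc h i + x)) - x| < r.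
      by move=> ch; rewrite addrA addrK (le_lt_trans _ hr)// norm_trunc.
    have [s /nr /rP [+ _]|c ch e] := @MVT_dir m f (trunc h i + x) (e_ i) (h 0 i).
      exact.
    rewrite truncS -[_ + trunc h i + x]addrA e -mulrBr normrM mulrC ler_pM//.
      by have [_ /(_ i) /ltW] := rP _ (nr _ ch).
    exact: norm_coord.
  apply: (le_trans (ler_sum _ (fun i _ => term i))).
  rewrite sumr_const card_ord -[_ *+ m]mulr_natr mulrAC ler_wpM2r// -mulrA.
  by rewrite ger_pMr// mulrC ler_pdivrMr// mul1r ler_nat.
have dE : 'd f x = Lh :> ('rV[R]_m -> R).
  apply: diff_unique => //; apply/eqaddoP => eps /Lo; apply: filterS => h.
  by rewrite !fctE /= opprD addrA.
have dfx : differentiable f x.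
  apply/diff_locallyP; rewrite dE; split => //.
  apply/eqaddoP => eps /Lo; apply: filterS => h.
  by rewrite !fctE /= opprD addrA.
by split => // h; rewrite deriveE// dE.
Unshelve. all: by end_near. Qed.

End Euclidean.

(** * Symmetry of second partial derivatives *)

Section Schwarz.
Context (R : realType) (m : nat).
Notation e_ i := (delta_mx 0 i : 'rV[R]_m).

Lemma derive_translate (f : 'rV[R]_m -> R) (a x v : 'rV[R]_m) :
  (derivable (fun y => f (a + y)) x v <-> derivable f (a + x) v) /\
  'D_v (fun y => f (a + y)) x = 'D_v f (a + x).
Proof.
have E : (fun h : R => h^-1 *: (((fun y => f (a + y)) \o shift x) (h *: v)
       - f (a + x)))
    = (fun h : R => h^-1 *: ((f \o shift (a + x)) (h *: v) - f (a + x))).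
  by apply/funext => h /=; congr (_ *: (f _ - _)); rewrite addrCA.
by split; [rewrite /derivable E|rewrite /derive E].
Qed.

(** Two applications of the mean value theorem express the second difference of
    f along e_i and e_j as a mixed derivative at a nearby point; the second
    difference is symmetric in i and j. *)
Lemma second_difference (f : 'rV[R]_m -> R) (x : 'rV[R]_m) (i j : 'I_m)
    (r t : R) :
  (forall y, `|y - x| < r -> derivable f y (e_ i)) ->
  (forall y, `|y - x| < r -> derivable (fun z => 'D_(e_ i) f z) y (e_ j)) ->
  `|t| + `|t| < r ->
  exists2 y, `|y - x| < r &
    f (t *: e_ j + (t *: e_ i + x)) - f (t *: e_ i + x)
    - (f (t *: e_ j + x) - f x)
    = t * (t * 'D_(e_ j) (fun z => 'D_(e_ i) f z) y).
Proof.
move=> df ddf tr.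
have ne (k : 'I_m) c : `|c| <= `|t| -> `|c *: e_ k| <= `|t|.
  move=> ct; apply: (proj2 (norm_rowP _ (normr_ge0 t))) => l; rewrite !mxE.
  by case: (_ && _); rewrite ?mulr1// mulr0 normr0.
have nb c d : `|c| <= `|t| -> `|d| <= `|t| ->
    `|c *: e_ j + (d *: e_ i + x) - x| < r.
  move=> ct dt; rewrite addrA addrK; apply: le_lt_trans tr.
  by apply: (le_trans (ler_normD _ _)); rewrite lerD ?ne.
have nb0 d : `|d| <= `|t| -> `|d *: e_ i + x - x| < r.
  by move=> dt; have := nb 0 d; rewrite scale0r add0r normr0; apply.
have dg s : `|s| <= `|t| ->
    is_derive (s *: e_ i + x) (e_ i) (fun y => f (t *: e_ j + y) - f y)
      ('D_(e_ i) f (t *: e_ j + (s *: e_ i + x)) - 'D_(e_ i) f (s *: e_ i + x)).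
  move=> st; have [d1 d2] := derive_translate f (t *: e_ j) (s *: e_ i + x) (e_ i).
  rewrite -d2; apply: is_deriveB; apply/derivableP; last exact/df/nb0.
  by apply/d1/df/nb.
have [s st|c ct] := @MVT_dir R m (fun y => f (t *: e_ j + y) - f y) x (e_ i) t.
  by case: (dg s st).
have [_ ->] := dg c ct => ->.
have [s st|d dt ->] := @MVT_dir R m (fun z => 'D_(e_ i) f z) (c *: e_ i + x) (e_ j) t.
  exact/ddf/nb.
by exists (d *: e_ j + (c *: e_ i + x)) => //; exact: nb.
Qed.

Lemma near_ballP (x : 'rV[R]_m) (P : 'rV[R]_m -> Prop) :
  (\forall y \near x, P y) ->
  exists2 r : R, 0 < r & forall y, `|y - x| < r -> P y.
Proof.
move=> /nbhs_ballP[r /= r0 rP]; exists r => // y yr; apply: rP.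
by rewrite -ball_normE /= distrC.
Qed.

Lemma near_and (x : 'rV[R]_m) (P Q : 'rV[R]_m -> Prop) :
  (\forall y \near x, P y) -> (\forall y \near x, Q y) ->
  \forall y \near x, P y /\ Q y.
Proof. by move=> Px Qx; exact: filterI. Qed.

(** Schwarz: as t tends to 0 the two expressions of the same second difference
    tend to the two mixed derivatives. *)
Lemma derive_swap (f : 'rV[R]_m -> R) (x : 'rV[R]_m) (i j : 'I_m) :
  (\forall y \near x, derivable f y (e_ i)) ->
  (\forall y \near x, derivable f y (e_ j)) ->
  (\forall y \near x, derivable (fun z => 'D_(e_ i) f z) y (e_ j)) ->
  (\forall y \near x, derivable (fun z => 'D_(e_ j) f z) y (e_ i)) ->
  {for x, continuous (fun y => 'D_(e_ j) (fun z => 'D_(e_ i) f z) y)} ->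
  {for x, continuous (fun y => 'D_(e_ i) (fun z => 'D_(e_ j) f z) y)} ->
  'D_(e_ j) (fun z => 'D_(e_ i) f z) x = 'D_(e_ i) (fun z => 'D_(e_ j) f z) x.
Proof.
move=> di dj dji dij cji cij.
apply/eqP; rewrite -subr_eq0 -normr_le0; apply/ler_addgt0Pl => eps eps0.
have e20 : 0 < eps / 2 by rewrite divr_gt0.
move/cvgr_dist_lt : cji => /(_ _ e20) cji.
move/cvgr_dist_lt : cij => /(_ _ e20) cij.
have [r r0 rP] := near_ballP (near_and (near_and (near_and di dj)
  (near_and dji dij)) (near_and cji cij)).
pose t := r / 3.
have t0 : 0 < t by rewrite divr_gt0.
have tr : `|t| + `|t| < r by rewrite gtr0_norm// /t; lra.
have [||//|y yr e1] := @second_difference f x i j r t.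
- by move=> y /rP[[[]]].
- by move=> y /rP[[_ []]].
have [||//|z zr e2] := @second_difference f x j i r t.
- by move=> z /rP[[[]]].
- by move=> z /rP[[_ []]].
have : t * (t * 'D_(e_ j) (fun z => 'D_(e_ i) f z) y)
     = t * (t * 'D_(e_ i) (fun z => 'D_(e_ j) f z) z).
  rewrite -e1 -e2 (addrCA (t *: e_ i)) //.
  by rewrite !opprB addrACA [RHS]addrACA [- _ - _ in RHS]addrC.
move=> /(mulfI (lt0r_neq0 t0)) /(mulfI (lt0r_neq0 t0)) E.
have [_ [h1 _]] := rP _ yr; have [_ [_ h2]] := rP _ zr.
rewrite addr0; set A := 'D_(e_ j) _ x in h1 *; set B := 'D_(e_ i) _ x in h2 *.
rewrite E in h1; set C := 'D_(e_ i) _ z in h1 h2.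
have -> : A - B = (A - C) - (B - C) by ring.
clear -h1 h2. clearbody A B C.
apply: (le_trans (ler_normB _ _)).
rewrite [eps]splitr. apply: lerD; exact: ltW.
Qed.

End Schwarz.

(** * Functions of class C^k on open sets *)

Section CkClosure.
Context (R : realType).

Section OneDomain.
Context (m : nat) (W : set 'rV[R]_m) (oW : open W).
Notation e_ i := (delta_mx 0 i : 'rV[R]_m).
Implicit Types f g : 'rV[R]_m -> R.

Lemma near_open x (P : 'rV[R]_m -> Prop) : W x -> (forall y, W y -> P y) ->
  \forall y \near x, P y.
Proof. by move=> Wx WP; apply: filterS (open_nbhs_nbhs (conj oW Wx)). Qed.

Lemma Ck_ext k f g : (forall x, W x -> f x = g x) -> Ck_on k W f -> Ck_on k W g.
Proof.
elim: k f g => [|k ih] f g fg [cf df].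
  split => // x Wx; have H : \forall y \near x, f y = g y by exact: near_open fg.
  have := cf x Wx; rewrite /prop_for /continuous_at fg//.
  by apply: cvg_trans; exact: near_eq_cvg H.
split.
  move=> x Wx; have H : \forall y \near x, f y = g y by exact: near_open fg.
  have := cf x Wx; rewrite /prop_for /continuous_at fg//.
  by apply: cvg_trans; exact: near_eq_cvg H.
move=> i; have [d1 d2] := df i; split.
  move=> x Wx; apply: near_eq_derivable (d1 x Wx).
  exact: near_open fg.
apply: ih d2 => x Wx; apply: near_eq_derive.
exact: near_open fg.
Qed.

Lemma Ck_sub k (W' : set 'rV[R]_m) f : W' `<=` W -> Ck_on k W f -> Ck_on k W' f.
Proof.
move=> WW; elim: k f => [|k ih] f [cf df]; split=> //.
- by move=> x /WW; exact: cf.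
- by move=> x /WW; exact: cf.
- move=> i; have [d1 d2] := df i; split; last exact: ih.
  by move=> x /WW; exact: d1.
Qed.

Lemma Ck_pred k f : Ck_on k.+1 W f -> Ck_on k W f.
Proof.
elim: k f => [|k ih] f [cf df]; split=> //.
by move=> i; have [d1 d2] := df i; split => //; exact: ih.
Qed.

Lemma Ck_cont k f x : Ck_on k W f -> W x -> {for x, continuous f}.
Proof. by case: k => [|k] [cf _]; exact: cf. Qed.

Lemma Ck_cst k (c : R) : Ck_on k W (fun=> c).
Proof.
elim: k c => [|k ih] c; split=> //.
- by move=> x _; exact: cst_continuous.
- by move=> x _; exact: cst_continuous.
- move=> i; split; first by move=> x _; exact: derivable_cst.
  by apply: Ck_ext (ih 0) => x Wx; rewrite derive_cst.
Qed.

Lemma derive_coord (i j : 'I_m) (x : 'rV[R]_m) :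
  is_derive x (e_ i) (fun y : 'rV[R]_m => y 0 j) ((i == j)%:R).
Proof.
have d : differentiable (fun y : 'rV[R]_m => y 0 j) x.
  exact: differentiable_coord.
apply: DeriveDef; first exact: diff_derivable.
apply: cvg_lim => //; apply: cvg_near_cst.
near=> h; rewrite /= !mxE eqxx /= [j == i]eq_sym.
have h0 : h != 0 by near: h; exact: nbhs_dnbhs_neq.
by rewrite addrK /GRing.scale /= mulrA mulVf// mul1r.
Unshelve. all: by end_near. Qed.

Lemma Ck_coord k (j : 'I_m) : Ck_on k W (fun y => y 0 j).
Proof.
have c x : {for x, continuous (fun y : 'rV[R]_m => y 0 j)}.
  exact: coord_continuous.
case: k => [|k]; split=> // i; split.
  by move=> x _; case: (derive_coord i j x).
apply: Ck_ext (Ck_cst k (i == j)%:R) => x _.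
by have [_ ->] := derive_coord i j x.
Qed.

Lemma Ck_add k f g : Ck_on k W f -> Ck_on k W g ->
  Ck_on k W (fun x => f x + g x).
Proof.
elim: k f g => [|k ih] f g [cf df] [cg dg].
  by split => // x Wx; apply: continuousD; [exact: cf|exact: cg].
split; first by move=> x Wx; apply: continuousD; [exact: cf|exact: cg].
move=> i; have [d1 d2] := df i; have [d1' d2'] := dg i; split.
  by move=> x Wx; apply: derivableD; [exact: d1|exact: d1'].
apply: Ck_ext (ih _ _ d2 d2') => x Wx.
by rewrite deriveD; [|exact: d1|exact: d1'].
Qed.

Lemma Ck_mul k f g : Ck_on k W f -> Ck_on k W g ->
  Ck_on k W (fun x => f x * g x).
Proof.
elim: k f g => [|k ih] f g Cf Cg.
  have [cf _] := Cf; have [cg _] := Cg.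
  by split => // x Wx; apply: continuousM; [exact: cf|exact: cg].
have [cf df] := Cf; have [cg dg] := Cg.
split; first by move=> x Wx; apply: continuousM; [exact: cf|exact: cg].
move=> i; have [d1 d2] := df i; have [d1' d2'] := dg i; split.
  by move=> x Wx; apply: derivableM; [exact: d1|exact: d1'].
apply: Ck_ext (Ck_add (ih _ _ (Ck_pred Cf) d2') (ih _ _ (Ck_pred Cg) d2)) => x Wx.
by rewrite deriveM; [|exact: d1|exact: d1'].
Qed.

Lemma Ck_opp k f : Ck_on k W f -> Ck_on k W (fun x => - f x).
Proof.
move=> Cf; apply: Ck_ext (Ck_mul (Ck_cst k (-1)) Cf) => x _.
by rewrite mulN1r.
Qed.

Lemma Ck_sum k (I : Type) (r : seq I) (F : I -> 'rV[R]_m -> R) :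
  (forall i, Ck_on k W (F i)) -> Ck_on k W (fun x => \sum_(i <- r) F i x).
Proof.
move=> CF; elim: r => [|i r ih].
  by apply: Ck_ext (Ck_cst k 0) => x _; rewrite big_nil.
by apply: Ck_ext (Ck_add (CF i) ih) => x _; rewrite big_cons.
Qed.

Lemma Ck_diff k f x : Ck_on k.+1 W f -> W x ->
  differentiable f x /\
  forall h, 'D_h f x = \sum_i h 0 i * 'D_(e_ i) f x.
Proof.
move=> [_ df] Wx; apply: differentiable_C1.
  by apply: near_open Wx _ => y Wy i; have [d1 _] := df i; exact: d1.
by move=> i; have [_ d2] := df i; exact: Ck_cont d2 Wx.
Qed.

Lemma Ck_swap k f x i j : Ck_on k.+2 W f -> W x ->
  'D_(e_ j) (fun z => 'D_(e_ i) f z) x = 'D_(e_ i) (fun z => 'D_(e_ j) f z) x.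
Proof.
move=> [cf df] Wx; have [di ddi] := df i; have [dj ddj] := df j.
have [_ /(_ j)[dji cji]] := ddi; have [_ /(_ i)[dij cij]] := ddj.
exact: (derive_swap (near_open Wx di) (near_open Wx dj) (near_open Wx dji)
  (near_open Wx dij) (Ck_cont cji Wx) (Ck_cont cij Wx)).
Qed.

End OneDomain.

Lemma Ck_local m k (W : set 'rV[R]_m) f :
  (forall x, W x -> exists W', [/\ open W', W' x & Ck_on k W' f]) ->
  Ck_on k W f.
Proof.
elim: k f => [|k ih] f H.
  by split => // x /H[W' [oW' W'x [cf _]]]; exact: cf.
split; first by move=> x /H[W' [oW' W'x [cf _]]]; exact: cf.
move=> i; split.
  by move=> x /H[W' [oW' W'x [_ /(_ i)[d _]]]]; exact: d.
by apply: ih => x /H[W' [oW' W'x [_ /(_ i)[_ d]]]]; exists W'.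
Qed.

(** The chain rule needs differentiability of f and of phi, which follows from
    the continuity of their partial derivatives. *)
Lemma derive_comp m p (W : set 'rV[R]_m) (W' : set 'rV[R]_p)
    (f : 'rV[R]_p -> R) (phi : 'rV[R]_m -> 'rV[R]_p) x (i : 'I_m) :
  open W -> open W' -> W x -> W' (phi x) ->
  Ck_on 1 W' f -> (forall l, Ck_on 1 W (fun y => phi y 0 l)) ->
  is_derive x (delta_mx 0 i) (f \o phi)
   (\sum_l 'D_(delta_mx 0 l) f (phi x) * 'D_(delta_mx 0 i) (fun y => phi y 0 l) x).
Proof.
move=> oW oW' Wx W'x Cf Cphi.
have [df Df] := Ck_diff oW' Cf W'x.
have dphi : differentiable phi x.
  rewrite (_ : phi = \sum_l (fun y => phi y 0 l *: delta_mx 0 l)); last first.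
    by apply/funext => y; rewrite fct_sumE -row_sum_delta.
  apply: differentiable_sum => l; apply: differentiableZl.
  by have [] := Ck_diff oW (Cphi l) Wx.
have dc : differentiable (f \o phi) x by exact: differentiable_comp.
apply: DeriveDef; first exact: diff_derivable.
rewrite deriveE// diff_comp//= -deriveE// Df; apply: eq_bigr => l _.
rewrite mulrC; congr (_ * _).
by rewrite -deriveE// derive_mx ?mxE//; exact: diff_derivable.
Qed.

(** By the chain rule the partial derivatives of f o phi are sums of products of
    functions of class C^k, by induction applied to the partial derivatives of f. *)
Lemma Ck_comp m p k (W : set 'rV[R]_m) (W' : set 'rV[R]_p)
    (f : 'rV[R]_p -> R) (phi : 'rV[R]_m -> 'rV[R]_p) :
  open W -> open W' -> (forall x, W x -> W' (phi x)) ->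
  Coo_on W' f -> (forall l, Coo_on W (fun y => phi y 0 l)) ->
  Ck_on k W (f \o phi).
Proof.
move=> oW oW' WW + Cphi; elim: k f => [|k ih] f Cf.
  split=> // x Wx; apply: continuous_comp; last exact: Ck_cont (Cf 0%N) (WW _ Wx).
  apply: differentiable_continuous.
  rewrite (_ : phi = \sum_l (fun y => phi y 0 l *: delta_mx 0 l)); last first.
    by apply/funext => y; rewrite fct_sumE -row_sum_delta.
  apply: differentiable_sum => l; apply: differentiableZl.
  by have [] := Ck_diff oW (Cphi l 1%N) Wx.
have D x (Wx : W x) i := derive_comp i oW oW' Wx (WW _ Wx) (Cf 1%N)
  (fun l => Cphi l 1%N).
split; first by move=> x Wx; exact: Ck_cont (ih f Cf) Wx.
move=> i; split; first by move=> x Wx; case: (D x Wx i).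
have Cl l : Ck_on k W ((fun z => 'D_(delta_mx 0 l) f z) \o phi).
  by apply: ih => k'; have [_ /(_ l)[]] := Cf k'.+1.
apply: (Ck_ext oW) (Ck_sum oW (index_enum 'I_p) (fun l => Ck_mul oW (Cl l)
  (proj2 (proj2 (Cphi l k.+1) i)))) => x Wx.
by have [_ ->] := D x Wx i.
Qed.

Lemma Coo_comp m p (W : set 'rV[R]_m) (W' : set 'rV[R]_p)
    (f : 'rV[R]_p -> R) (phi : 'rV[R]_m -> 'rV[R]_p) :
  open W -> open W' -> (forall x, W x -> W' (phi x)) ->
  Coo_on W' f -> (forall l, Coo_on W (fun y => phi y 0 l)) ->
  Coo_on W (fun x => f (phi x)).
Proof. by move=> oW oW' WW Cf Cphi k; exact: Ck_comp WW Cf Cphi. Qed.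

(** A function of one variable is smooth on V when it starts a sequence in which
    each term is the derivative of the preceding one; this is easier to exhibit
    than iterated derivatives. *)
Definition smooth1 (V : set R) (g : R -> R) :=
  exists G : nat -> R -> R, G 0%N = g /\
    forall k t, V t -> is_derive t (1 : R) (G k) (G k.+1 t).

Lemma smooth1_comp m (W : set 'rV[R]_m) (V : set R) (g : R -> R)
    (phi : 'rV[R]_m -> R) :
  open W -> (forall x, W x -> V (phi x)) -> smooth1 V g -> Coo_on W phi ->
  Coo_on W (fun x => g (phi x)).
Proof.
move=> oW WV [G [E dG]] Cphi.
suff H k j : Ck_on k W (fun x => G j (phi x)) by move=> k; rewrite -E; exact: H.
have dif x : W x -> differentiable phi x.
  by move=> Wx; have [] := Ck_diff oW (Cphi 1%N) Wx.
have difG t i : V t -> differentiable (G i) t.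
  by move=> Vt; apply/derivable1_diffP; case: (dG i t Vt).
have dc (x : 'rV[R]_m) i : W x -> differentiable (fun x => G i (phi x)) x.
  by move=> Wx; apply: differentiable_comp; [exact: dif|exact/difG/WV].
elim: k j => [|k ih] j.
  by split => // x Wx; exact: differentiable_continuous (dc x j Wx).
split; first by move=> x Wx; exact: differentiable_continuous (dc x j Wx).
move=> i; split; first by move=> x Wx; apply: diff_derivable; exact: dc.
apply: (Ck_ext oW) (Ck_mul oW (ih j.+1) (proj2 (proj2 (Cphi k.+1) i))) => x Wx.
have Vx := WV _ Wx; rewrite [RHS]deriveE; last exact: dc.
rewrite (diff_comp (f := phi) (g := G j)); [|exact: dif|exact: difG].
rewrite /= -(deriveE _ (dif _ Wx)) diff1E; last exact: difG.
rewrite derive1E; have [_ ->] := dG j _ Vx.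
by rewrite /GRing.scale /= mulrC.
Qed.

End CkClosure.

(** * Bump functions on Euclidean space *)

Section Bump.
Context (R : realType).

(** Polynomials in 1/t are stable under differentiation, which yields all the
    derivatives of 1/t at once. *)
Lemma is_derive_inv_poly (p : {poly R}) (t : R) : t != 0 ->
  is_derive t (1 : R) (fun t => p.[t^-1]) (- 'X^2 * p^`()).[t^-1].
Proof.
move=> t0.
have d1 : is_derive t (1 : R) (fun t : R => t^-1) (- t ^- 2).
  have := @is_deriveV R id t 1 1 t0 (is_derive_id t 1).
  by rewrite /GRing.scale /= mulr1.
have := @is_derive1_comp R (horner p) (fun t => t^-1) t _ _ (is_derive_poly p t^-1) d1.
by rewrite mulrC !hornerE exprVn.
Qed.

Lemma smooth1_inv : smooth1 [set t : R | t != 0] (fun t => t^-1).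
Proof.
exists (fun k t => (iter k (fun p : {poly R} => - 'X^2 * p^`()) 'X).[t^-1]).
split; first by apply/funext => t; rewrite /= hornerX.
by move=> k t; exact: is_derive_inv_poly.
Qed.

(** Compare each monomial with a term of the exponential series. *)
Lemma poly_le_expR (p : {poly R}) :
  exists2 C : R, 0 <= C & forall s : R, 0 <= s -> `|p.[s]| <= C * expR s.
Proof.
exists (\sum_(i < size p) `|p`_i| * i`!%:R).
  by apply: sumr_ge0 => i _; rewrite mulr_ge0.
move=> s s0; rewrite horner_coef mulr_suml.
apply: (le_trans (ler_norm_sum _ _ _)); apply: ler_sum => i _.
rewrite normrM -mulrA ler_wpM2l// normrX ger0_norm//.
case: (nat_of_ord i) => [|k].
  by rewrite expr0 fact0 mul1r -expR0 ler_expR.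
rewrite -ler_pdivrMl ?ltr0n ?fact_gt0// mulrC.
by apply: le_trans (expR_ge1Dxn k s0); rewrite lerDr.
Qed.

(** The functions which agree with p(1/t) exp(-1/t) for t > 0 and vanish for
    t <= 0: this class is stable under differentiation, also at 0. *)
Definition flat_fun (p : {poly R}) (t : R) : R :=
  if 0 < t then p.[t^-1] * expR (- t^-1) else 0.

(** The difference quotient at 0 is O(h): the exponential beats the polynomial
    t^2 p(t) evaluated at 1/h. *)
Lemma flat_fun_bound (p : {poly R}) :
  exists2 C : R, 0 <= C & forall h : R, `|h^-1 * flat_fun p h| <= C * `|h|.
Proof.
have [C C0 CP] := poly_le_expR ('X^2 * p); exists C => // h.
rewrite /flat_fun; case: ifPn => [h0|_]; last by rewrite mulr0 normr0 mulr_ge0.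
have hi : 0 <= h^-1 by rewrite invr_ge0 ltW.
have B := CP _ hi; rewrite !hornerE in B; rewrite (gtr0_norm h0).
have e0 : 0 <= expR (- h^-1) * h by rewrite mulr_ge0 ?expR_ge0// ltW.
have -> : h^-1 * (p.[h^-1] * expR (- h^-1))
    = (h^-1 ^+ 2 * p.[h^-1]) * (expR (- h^-1) * h).
  by field; rewrite gt_eqF.
rewrite normrM (ger0_norm e0); apply: (le_trans (ler_wpM2r e0 B)).
by rewrite mulrA -(mulrA C) -expRD subrr expR0 mulr1.
Qed.

Lemma is_derive_flat_fun (p : {poly R}) (t : R) :
  is_derive t (1 : R) (flat_fun p) (flat_fun ('X^2 * (p - p^`())) t).
Proof.
have [t0|t0|->] := ltgtP t 0.
- have E : \forall u \near t, cst 0 u = flat_fun p u.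
    near=> u; rewrite /flat_fun ifF//; apply/negbTE; rewrite -leNgt ltW//.
    by near: u; exact: lt_nbhsl.
  rewrite {2}/flat_fun ltNge (ltW t0) /=.
  exact: near_eq_is_derive E (is_derive_cst _ _ _).
- have E : \forall u \near t, p.[u^-1] * expR (- u^-1) = flat_fun p u.
    by near=> u; rewrite /flat_fun ifT//; near: u; exact: lt_nbhsr.
  rewrite {2}/flat_fun t0.
  apply: near_eq_is_derive E _.
  have tn0 := lt0r_neq0 t0.
  have d1 := is_derive_inv_poly p tn0.
  have d2 : is_derive t (1 : R) (fun t => expR (- t^-1)) (expR (- t^-1) * t ^- 2).
    have := is_derive_inv_poly (- 'X) tn0.
    rewrite (_ : (fun t => _) = (fun t => - t^-1)).
      rewrite derivN derivX !hornerE mulrNN mulr1 exprVn => d.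
      exact: (@is_derive1_comp R expR (fun t => - t^-1) t _ _ (is_derive_expR _) d).
    by apply/funext => u; rewrite !hornerE.
  apply: (is_derive_eq (is_deriveM d1 d2)).
  rewrite /GRing.scale /= !(hornerM, hornerXn, hornerD, hornerN) !hornerX expr2 invfM.
  by ring.
rewrite {2}/flat_fun ltxx.
have L : (fun h : R => h^-1 *: ((flat_fun p \o shift 0) (h *: 1) - flat_fun p 0))
    @ 0^' --> (0 : R).
  have [C C0 CP] := flat_fun_bound p.
  apply/cvgr0Pnorm_le => eps eps0; near=> h.
  rewrite /= [flat_fun p 0]/flat_fun ltxx subr0 addr0 [h *: 1]mulr1.
  apply: (le_trans (CP h)).
  have : `|h| <= eps / (C + 1).
    by near: h; apply: dnbhs0_le; rewrite divr_gt0// ltr_wpDl.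
  rewrite ler_pdivlMr ?ltr_wpDl// => H; apply: le_trans H.
  by rewrite mulrC ler_wpM2l// lerDl.
apply: DeriveDef; first by apply/cvg_ex; exists 0.
exact: cvg_lim L.
Unshelve. all: by end_near. Qed.

Lemma smooth1_flat_fun (p : {poly R}) : smooth1 [set: R] (flat_fun p).
Proof.
exists (fun k => flat_fun (iter k (fun p : {poly R} => 'X^2 * (p - p^`())) p)).
by split=> // k t _; exact: is_derive_flat_fun.
Qed.

Definition exp_flat := flat_fun 1.

Lemma exp_flat_le0 t : t <= 0 -> exp_flat t = 0.
Proof. by move=> t0; rewrite /exp_flat /flat_fun ltNge t0. Qed.

Lemma exp_flatE t : 0 < t -> exp_flat t = expR (- t^-1).
Proof. by move=> t0; rewrite /exp_flat /flat_fun t0 hornerE mul1r. Qed.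

Lemma exp_flat1_gt0 : 0 < exp_flat 1.
Proof. by rewrite exp_flatE// expR_gt0. Qed.

(** The argument of the outer function is positive for t <= 0, where it is
    constant, and at most 0 for t >= 1, where exp_flat vanishes. *)
Definition smooth_step (t : R) : R :=
  exp_flat (exp_flat 1 - exp_flat t) / exp_flat (exp_flat 1).

Lemma smooth_step_le0 t : t <= 0 -> smooth_step t = 1.
Proof.
move=> t0; rewrite /smooth_step (exp_flat_le0 t0) subr0 divff//.
by rewrite (exp_flatE exp_flat1_gt0) gt_eqF ?expR_gt0.
Qed.

Lemma smooth_step_ge1 t : 1 <= t -> smooth_step t = 0.
Proof.
move=> t1; have t0 : 0 < t by apply: lt_le_trans t1.
rewrite /smooth_step exp_flat_le0 ?mul0r// subr_le0 !exp_flatE//.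
by rewrite ler_expR lerN2 invr1 invf_le1.
Qed.

Context (m : nat).

(** The argument of the step is at most 0 when |x_i - x0_i| <= r, and at least 1
    when |x_i - x0_i| exceeds 2 r. *)
Definition bump (x0 : 'rV[R]_m) (r : R) (x : 'rV[R]_m) : R :=
  \prod_(i < m) smooth_step (((x 0 i - x0 0 i) / r) ^+ 2 - 1).

Lemma bump_eq1 x0 r x : 0 < r -> `|x - x0| <= r -> bump x0 r x = 1.
Proof.
move=> r0 xr; rewrite /bump big1// => i _; apply: smooth_step_le0.
rewrite subr_le0 -real_normK ?num_real// expr_le1// normrM normfV (gtr0_norm r0).
rewrite ler_pdivrMr// mul1r; apply: le_trans xr.
by have := norm_coord (x - x0) i; rewrite !mxE.
Qed.

Lemma bump_supp x0 r x : 0 < r -> bump x0 r x != 0 -> `|x - x0| <= 2 * r.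
Proof.
move=> r0 b0; apply: (proj2 (norm_rowP _ _)); first by rewrite mulr_ge0// ltW.
move=> i; rewrite leNgt; apply/negP => xr; move/eqP: b0; apply.
rewrite /bump (bigD1 i)//= smooth_step_ge1 ?mul0r//.
move: xr; rewrite !mxE => xr; set d := x 0 i - x0 0 i in xr *.
have : 2 < `|d / r| by rewrite normrM normfV (gtr0_norm r0) ltr_pdivlMr.
rewrite -[(d / r) ^+ 2]real_normK ?num_real// => h.
have : 2 * 2 <= `|d / r| ^+ 2 by rewrite expr2; apply: ler_pM => //; exact: ltW.
by lra.
Qed.

Lemma Coo_bump x0 r (W : set 'rV[R]_m) : open W -> Coo_on W (bump x0 r).
Proof.
move=> oW; rewrite /bump.
have step (f : 'rV[R]_m -> R) : Coo_on W f -> Coo_on W (fun x => smooth_step (f x)).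
  move=> Cf k; rewrite /smooth_step; apply: Ck_mul => //; last exact: Ck_cst.
  have := @smooth1_comp R m W setT exp_flat
    (fun x => exp_flat 1 - exp_flat (f x)) oW (fun _ _ => I)
    (smooth1_flat_fun 1); apply.
  move=> k'; apply: Ck_add => //; first exact: Ck_cst.
  apply: Ck_opp => //.
  exact: (@smooth1_comp R m W setT exp_flat f oW (fun _ _ => I)
    (smooth1_flat_fun 1)).
have quad i : Coo_on W (fun x => ((x 0 i - x0 0 i) / r) ^+ 2 - 1).
  move=> k; apply: Ck_add => //; last exact: Ck_cst.
  have C : Ck_on k W (fun x => (x 0 i - x0 0 i) / r).
    apply: Ck_mul => //; last exact: Ck_cst.
    by apply: Ck_add => //; [exact: Ck_coord|exact: Ck_cst].
  by apply: (Ck_ext oW) (Ck_mul oW C C) => x _; rewrite expr2.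
move=> k; elim: (index_enum _) => [|i s ih].
  by apply: (Ck_ext oW) (Ck_cst oW k 1) => x _; rewrite big_nil.
have := Ck_mul oW (step _ (quad i) k) ih.
by apply: (Ck_ext oW) => x _; rewrite big_cons.
Qed.

End Bump.

Local Open Scope complex_scope.

(** * Complex-valued smooth functions *)

Section ComplexValued.
Context (R : realType) (m : nat).
Notation e_ i := (delta_mx 0 i : 'rV[R]_m).
Implicit Types (F G : 'rV[R]_m -> R[i]) (W : set 'rV[R]_m).

Lemma complex_eqP (x y : R[i]) :
  complex.Re x = complex.Re y -> complex.Im x = complex.Im y -> x = y.
Proof. by move: x y => [a b] [c d] /= -> ->. Qed.

Lemma ReD (x y : R[i]) : complex.Re (x + y) = complex.Re x + complex.Re y.
Proof. by move: x y => [a b] [c d]. Qed.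
Lemma ImD (x y : R[i]) : complex.Im (x + y) = complex.Im x + complex.Im y.
Proof. by move: x y => [a b] [c d]. Qed.
Lemma ReM (x y : R[i]) : complex.Re (x * y)
  = complex.Re x * complex.Re y - complex.Im x * complex.Im y.
Proof. by move: x y => [a b] [c d]. Qed.
Lemma ImM (x y : R[i]) : complex.Im (x * y)
  = complex.Re x * complex.Im y + complex.Im x * complex.Re y.
Proof. by move: x y => [a b] [c d]. Qed.

Definition CCoo W F :=
  Coo_on W (fun x => complex.Re (F x)) /\ Coo_on W (fun x => complex.Im (F x)).

Definition dC (i : 'I_m) F (x : 'rV[R]_m) : R[i] :=
  'D_(e_ i) (fun x => complex.Re (F x)) x
  +i* 'D_(e_ i) (fun x => complex.Im (F x)) x.

Section OneDomain.
Context (W : set 'rV[R]_m) (oW : open W).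

Lemma CCoo_ext F G : (forall x, W x -> F x = G x) -> CCoo W F -> CCoo W G.
Proof.
move=> FG [CR CI]; split=> k.
  by apply: (Ck_ext oW) (CR k) => x Wx; rewrite FG.
by apply: (Ck_ext oW) (CI k) => x Wx; rewrite FG.
Qed.

Lemma CCoo_cst (c : R[i]) : CCoo W (fun=> c).
Proof. by split=> k; exact: Ck_cst. Qed.

Lemma CCoo_add F G : CCoo W F -> CCoo W G -> CCoo W (fun x => F x + G x).
Proof.
move=> [F1 F2] [G1 G2]; split=> k.
  by apply: (Ck_ext oW) (Ck_add oW (F1 k) (G1 k)) => x _; rewrite ReD.
by apply: (Ck_ext oW) (Ck_add oW (F2 k) (G2 k)) => x _; rewrite ImD.
Qed.

Lemma CCoo_mul F G : CCoo W F -> CCoo W G -> CCoo W (fun x => F x * G x).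
Proof.
move=> [F1 F2] [G1 G2]; split=> k.
  apply: (Ck_ext oW) (Ck_add oW (Ck_mul oW (F1 k) (G1 k))
    (Ck_opp oW (Ck_mul oW (F2 k) (G2 k)))) => x _.
  by rewrite ReM.
apply: (Ck_ext oW) (Ck_add oW (Ck_mul oW (F1 k) (G2 k))
    (Ck_mul oW (F2 k) (G1 k))) => x _.
by rewrite ImM.
Qed.

Lemma CCoo_conj F : CCoo W F -> CCoo W (fun x => (F x)^*).
Proof.
move=> [F1 F2]; split=> k.
  by apply: (Ck_ext oW) (F1 k) => x _; case: (F x).
by apply: (Ck_ext oW) (Ck_opp oW (F2 k)) => x _; case: (F x).
Qed.

Lemma Coo_inv (f : 'rV[R]_m -> R) : (forall x, W x -> f x != 0) ->
  Coo_on W f -> Coo_on W (fun x => (f x)^-1).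
Proof.
move=> f0 Cf.
exact: (@smooth1_comp R m W [set t | t != 0] (fun t => t^-1) f oW f0
  (smooth1_inv R) Cf).
Qed.

(** 1/F is the conjugate of F divided by the real function |F|^2. *)
Lemma CCoo_inv F : (forall x, W x -> F x != 0) ->
  CCoo W F -> CCoo W (fun x => (F x)^-1).
Proof.
move=> F0 CF; have [F1 F2] := CF.
pose N x := complex.Re (F x) * complex.Re (F x)
            + complex.Im (F x) * complex.Im (F x).
have N0 x : W x -> N x != 0.
  move=> /F0; apply: contraNneq; rewrite /N; case: (F x) => a b /= /eqP.
  by rewrite paddr_eq0 -?expr2 ?sqr_ge0// !sqrf_eq0 => /andP[/eqP -> /eqP ->].
have CN : CCoo W (fun x => (N x)^-1%:C).
  split=> k; last exact: Ck_cst.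
  apply: Coo_inv => // k'.
  by apply: Ck_add => //; apply: Ck_mul.
apply: CCoo_ext (CCoo_mul (CCoo_conj CF) CN) => x Wx.
apply: (mulIf (F0 _ Wx)); rewrite mulVf ?F0// mulrAC.
have : (F x)^* * F x = (N x)%:C.
  by rewrite /N; case: (F x) => a b; apply: complex_eqP; rewrite /=; ring.
by move=> ->; rewrite -rmorphM mulfV ?N0.
Qed.

Lemma CCoo_dC i F : CCoo W F -> CCoo W (dC i F).
Proof.
by move=> [F1 F2]; split=> k; [have [_ /(_ i)[]] := F1 k.+1
  | have [_ /(_ i)[]] := F2 k.+1].
Qed.

Lemma CCoo_derivable F i x : CCoo W F -> W x ->
  derivable (fun x => complex.Re (F x)) x (e_ i) /\
  derivable (fun x => complex.Im (F x)) x (e_ i).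
Proof.
move=> [F1 F2] Wx; have [_ /(_ i)[d1 _]] := F1 1%N; have [_ /(_ i)[d2 _]] := F2 1%N.
by split; [exact: d1|exact: d2].
Qed.

Lemma dC_eq F G i x : W x -> (forall y, W y -> F y = G y) -> dC i F x = dC i G x.
Proof.
move=> Wx FG; rewrite /dC; congr (_ +i* _); apply: near_eq_derive;
  by apply: (near_open oW) Wx _ => y Wy; rewrite FG.
Qed.

Lemma dC_cst i (c : R[i]) x : dC i (fun=> c) x = 0.
Proof. by rewrite /dC !derive_cst. Qed.

Lemma dC_add i F G x : CCoo W F -> CCoo W G -> W x ->
  dC i (fun x => F x + G x) x = dC i F x + dC i G x.
Proof.
move=> CF CG Wx; have [F1 F2] := CCoo_derivable i CF Wx.
have [G1 G2] := CCoo_derivable i CG Wx.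
rewrite /dC -[RHS]/((_ + _) +i* (_ + _)) -deriveD// -deriveD//.
by congr (_ +i* _); congr ('D_(e_ i) _ x); apply/funext => y;
  rewrite !fctE ?ReD ?ImD.
Qed.

Lemma derive_mul_add (a b c d : 'rV[R]_m -> R) (x v : 'rV[R]_m) :
  derivable a x v -> derivable b x v -> derivable c x v -> derivable d x v ->
  'D_v (fun y => a y * b y + c y * d y) x
  = a x * 'D_v b x + b x * 'D_v a x + (c x * 'D_v d x + d x * 'D_v c x).
Proof.
move=> /derivableP da /derivableP db /derivableP dc /derivableP dd.
by case: (is_deriveD (is_deriveM da db) (is_deriveM dc dd)).
Qed.

Lemma dC_mul i F G x : CCoo W F -> CCoo W G -> W x ->
  dC i (fun x => F x * G x) x = dC i F x * G x + F x * dC i G x.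
Proof.
move=> CF CG Wx; have [F1 F2] := CCoo_derivable i CF Wx.
have [G1 G2] := CCoo_derivable i CG Wx.
have F2N : derivable (fun x => - complex.Im (F x)) x (e_ i) by exact: derivableN.
have DN : 'D_(e_ i) (fun x => - complex.Im (F x)) x
    = - 'D_(e_ i) (fun x => complex.Im (F x)) x.
  exact: deriveN.
apply: complex_eqP.
  rewrite ReD !ReM /=.
  transitivity ('D_(e_ i) (fun y => complex.Re (F y) * complex.Re (G y)
    + (- complex.Im (F y)) * complex.Im (G y)) x).
    by congr ('D_(e_ i) _ x); apply/funext => y; rewrite ReM mulNr.
  by rewrite (derive_mul_add F1 G1 F2N G2) DN; ring.
rewrite ImD !ImM /=.
transitivity ('D_(e_ i) (fun y => complex.Re (F y) * complex.Im (G y)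
    + complex.Im (F y) * complex.Re (G y)) x).
  by congr ('D_(e_ i) _ x); apply/funext => y; rewrite ImM.
by rewrite (derive_mul_add F1 G2 F2 G1); ring.
Qed.

Lemma dC_conj i F x : CCoo W F -> W x ->
  dC i (fun x => (F x)^*) x = (dC i F x)^*.
Proof.
move=> CF Wx; have [F1 F2] := CCoo_derivable i CF Wx.
apply: complex_eqP => /=.
  by congr ('D_(e_ i) _ x); apply/funext => y; case: (F y).
rewrite -deriveN//; congr ('D_(e_ i) _ x).
by apply/funext => y; rewrite !fctE; case: (F y).
Qed.

Lemma dC_swap i j F x : CCoo W F -> W x ->
  dC i (dC j F) x = dC j (dC i F) x.
Proof.
move=> [F1 F2] Wx; apply: complex_eqP.
  exact: (Ck_swap oW j i (F1 2%N) Wx).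
exact: (Ck_swap oW j i (F2 2%N) Wx).
Qed.

End OneDomain.

Lemma CCoo_sub W W' F : W' `<=` W -> CCoo W F -> CCoo W' F.
Proof.
by move=> WW [F1 F2]; split=> k; [exact: Ck_sub WW (F1 k)|exact: Ck_sub WW (F2 k)].
Qed.

Lemma CCoo_local W F :
  (forall x, W x -> exists W', [/\ open W', W' x & CCoo W' F]) -> CCoo W F.
Proof.
move=> H; split=> k; apply: Ck_local => x /H[W' [oW' W'x [F1 F2]]]; exists W'.
  by split => //; exact: F1.
by split => //; exact: F2.
Qed.

End ComplexValued.

Section ComplexComposition.
Context (R : realType) (m p : nat) (W : set 'rV[R]_m) (W' : set 'rV[R]_p).
Context (oW : open W) (oW' : open W').
Context (phi : 'rV[R]_m -> 'rV[R]_p) (WW : forall x, W x -> W' (phi x)).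
Context (Cphi : forall l, Coo_on W (fun y => phi y 0 l)).

Lemma CCoo_comp F : CCoo W' F -> CCoo W (fun x => F (phi x)).
Proof.
by move=> [F1 F2]; split; [exact: Coo_comp WW F1 Cphi|exact: Coo_comp WW F2 Cphi].
Qed.

Lemma dC_comp F i x : CCoo W' F -> W x ->
  dC i (fun x => F (phi x)) x
  = \sum_l dC i (fun y => (phi y 0 l)%:C) x * dC l F (phi x).
Proof.
move=> [F1 F2] Wx; rewrite /dC.
have D f : Coo_on W' f -> 'D_(delta_mx 0 i) (fun x => f (phi x)) x
    = \sum_l 'D_(delta_mx 0 i) (fun y => phi y 0 l) x
             * 'D_(delta_mx 0 l) f (phi x).
  move=> Cf; have [_ ->] := derive_comp i oW oW' Wx (WW Wx) (Cf 1%N)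
    (fun l => Cphi l 1%N).
  by apply: eq_bigr => l _; rewrite mulrC.
rewrite (D _ F1) (D _ F2) /=.
elim/big_rec3: _ => [|l y1 y2 y3 _ <-]; first exact: complex_eqP.
by apply: complex_eqP; rewrite ?ReD ?ImD ?ReM ?ImM /= derive_cst; ring.
Qed.

End ComplexComposition.

(** * Smooth functions on a complex manifold *)

Section Manifold.
Context (R : realType) (X : topologicalType) (n : nat) (M : charts R X n).
Context (hM : complex_manifold M).
Implicit Types (U V : set X) (f g : X -> R[i]) (a b : chart_idx M) (p q : X).

Notation img a U := (chart a @` (chart_dom a `&` U)).
Notation loc a f := (fun w => f (chart_inv a w)).

Lemma img_inv a U w : img a U w ->
  [/\ chart_dom a (chart_inv a w), U (chart_inv a w)
    & chart a (chart_inv a w) = w].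
Proof. by move=> [p [ap Up] <-]; rewrite (chart_invK hM). Qed.

Lemma mem_img a U p : chart_dom a p -> U p -> img a U (chart a p).
Proof. by move=> ap Up; exists p. Qed.

Lemma img_open a U : open U -> open (img a U).
Proof.
move=> oU; rewrite openE => w [p [ap Up] <-].
have c := chart_inv_continuous hM ap.
have N1 : nbhs (chart a p) [set w | U (chart_inv a w)].
  apply: c; apply: open_nbhs_nbhs; split; first exact: oU.
  by rewrite (chart_invK hM).
have N2 : nbhs (chart a p) (chart a @` chart_dom a).
  by apply: open_nbhs_nbhs; split; [exact: (chart_img_open hM)|exists p].
apply: filterS (filterI N1 N2) => w' [/= Uw' [q aq E]].
by exists q => //; split => //; rewrite -(chart_invK hM aq) E.
Qed.

Lemma dom_open a : open (chart_dom a). Proof. exact: (chart_dom_open hM). Qed.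

Lemma smooth_ext U f g : open U -> (forall p, U p -> f p = g p) ->
  smooth M U f -> smooth M U g.
Proof.
move=> oU fg sf a; apply: (CCoo_ext (img_open oU)) (sf a) => w /img_inv[_ Uw _].
exact: fg.
Qed.

Lemma smooth_sub U V f : V `<=` U -> smooth M U f -> smooth M V f.
Proof.
move=> VU sf a; apply: CCoo_sub (sf a) => w [p [ap Vp] <-].
by exists p => //; split => //; exact: VU.
Qed.

Lemma smooth_local U f :
  (forall p, U p -> exists V, [/\ open V, V p & smooth M V f]) -> smooth M U f.
Proof.
move=> H a; apply: CCoo_local => w [p [ap Up] <-].
have [V [oV Vp sf]] := H p Up; exists (img a V).
by split; [exact: img_open|exact: mem_img|exact: sf].
Qed.

Lemma smooth_cst U (c : R[i]) : open U -> smooth M U (fun=> c).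
Proof. by move=> oU a; apply: CCoo_cst; exact: img_open. Qed.

Lemma smooth_add U f g : open U -> smooth M U f -> smooth M U g ->
  smooth M U (fun p => f p + g p).
Proof. by move=> oU sf sg a; exact: (CCoo_add (img_open oU) (sf a) (sg a)). Qed.

Lemma smooth_mul U f g : open U -> smooth M U f -> smooth M U g ->
  smooth M U (fun p => f p * g p).
Proof. by move=> oU sf sg a; exact: (CCoo_mul (img_open oU) (sf a) (sg a)). Qed.

Lemma smooth_opp U f : open U -> smooth M U f -> smooth M U (fun p => - f p).
Proof.
move=> oU sf; apply: (smooth_ext oU) (smooth_mul oU (smooth_cst (-1) oU) sf).
by move=> p _; rewrite mulN1r.
Qed.

Lemma smooth_conj U f : open U -> smooth M U f -> smooth M U (fun p => (f p)^*).
Proof. by move=> oU sf a; exact: (CCoo_conj (img_open oU) (sf a)). Qed.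

Lemma smooth_inv U f : open U -> (forall p, U p -> f p != 0) ->
  smooth M U f -> smooth M U (fun p => (f p)^-1).
Proof.
move=> oU f0 sf a; apply: (CCoo_inv (img_open oU) _ (sf a)).
by move=> w /img_inv[_ Uw _]; exact: f0.
Qed.

Lemma smooth_sum U (I : Type) (r : seq I) (P : pred I) (F : I -> X -> R[i]) :
  open U -> (forall i, smooth M U (F i)) ->
  smooth M U (fun p => \sum_(i <- r | P i) F i p).
Proof.
move=> oU sF; elim: r => [|i r ih].
  by apply: (smooth_ext oU) (smooth_cst 0 oU) => p _; rewrite big_nil.
case Pi: (P i).
  by apply: (smooth_ext oU) (smooth_add oU (sF i) ih) => p _; rewrite big_cons Pi.
by apply: (smooth_ext oU) ih => p _; rewrite big_cons Pi.
Qed.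

Lemma smooth_prod U (I : Type) (r : seq I) (F : I -> X -> R[i]) :
  open U -> (forall i, smooth M U (F i)) ->
  smooth M U (fun p => \prod_(i <- r) F i p).
Proof.
move=> oU sF; elim: r => [|i r ih].
  by apply: (smooth_ext oU) (smooth_cst 1 oU) => p _; rewrite big_nil.
by apply: (smooth_ext oU) (smooth_mul oU (sF i) ih) => p _; rewrite big_cons.
Qed.

Lemma smooth_zcoord a k : smooth M (chart_dom a) (zcoord a k).
Proof. by have [] := chart_transition hM a k. Qed.

Lemma smooth_zbcoord a k : smooth M (chart_dom a) (zbcoord a k).
Proof. by apply: smooth_conj; [exact: dom_open|exact: smooth_zcoord]. Qed.

(** The real coordinates are the real and imaginary parts of the holomorphic
    ones, whose smoothness is part of the compatibility of charts. *)
Lemma smooth_xycoord a k : smooth M (chart_dom a) (xycoord a k).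
Proof.
rewrite -(fintype.splitK k); case: (fintype.split k) => j /= b; have [s1 s2] := smooth_zcoord a j b;
  by split=> // k'; apply: Ck_cst; apply: img_open; exact: dom_open.
Qed.

Lemma dxyE a k f p : dxy a k f p = dC k (loc a f) (chart a p).
Proof. by []. Qed.

Section Derivations.
Context (U : set X) (oU : open U) (a : chart_idx M) (k : 'I_(n + n)) (p : X).
Context (Up : U p) (ap : chart_dom a p).

Lemma dxy_eq f g : (forall q, U q -> f q = g q) -> dxy a k f p = dxy a k g p.
Proof.
move=> fg; rewrite !dxyE; apply: (dC_eq (img_open (a := a) oU)).
  exact: mem_img.
by move=> w /img_inv[_ Uw _]; exact: fg.
Qed.

Lemma dxy_cst (c : R[i]) : dxy a k (fun=> c) p = 0.
Proof. exact: dC_cst. Qed.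

Lemma dxy_add f g : smooth M U f -> smooth M U g ->
  dxy a k (fun q => f q + g q) p = dxy a k f p + dxy a k g p.
Proof.
move=> sf sg; rewrite !dxyE.
exact: (dC_add k (sf a) (sg a) (mem_img ap Up)).
Qed.

Lemma dxy_mul f g : smooth M U f -> smooth M U g ->
  dxy a k (fun q => f q * g q) p = dxy a k f p * g p + f p * dxy a k g p.
Proof.
move=> sf sg; rewrite !dxyE.
by rewrite (dC_mul k (sf a) (sg a) (mem_img ap Up)) (chart_invK hM).
Qed.

Lemma dxy_conj f : smooth M U f ->
  dxy a k (fun q => (f q)^*) p = (dxy a k f p)^*.
Proof.
move=> sf; rewrite !dxyE.
exact: (dC_conj k (sf a) (mem_img ap Up)).
Qed.

End Derivations.

(** In another chart b, f is the composite of its expression in a with the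
    transition map from b to a, which is smooth. *)
Lemma smooth_chart a U f : open U -> U `<=` chart_dom a ->
  CCoo (img a U) (loc a f) -> smooth M U f.
Proof.
move=> oU Ua Cf b.
have H1 w : img b U w -> img a U (chart a (chart_inv b w)).
  by move=> /img_inv[bw Uw _]; apply: mem_img => //; exact: Ua.
have H2 l : Coo_on (img b U) (fun w => (chart a (chart_inv b w)) 0 l).
  by have [C _] := smooth_sub Ua (smooth_xycoord a l) b.
apply: (CCoo_ext (img_open oU)) (CCoo_comp (img_open oU) (img_open oU) H1 H2 Cf).
by move=> w /img_inv[bw Uw _]; rewrite (chart_invK hM)//; exact: Ua.
Qed.

Lemma smooth_dxy U a k f : open U -> smooth M U f ->
  smooth M (U `&` chart_dom a) (dxy a k f).
Proof.
move=> oU sf; apply: (@smooth_chart a).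
- exact: openI oU (dom_open a).
- by move=> p [].
have o := img_open (a := a) (openI oU (dom_open a)).
have sf' := smooth_sub (@subIsetl _ U (chart_dom a)) sf.
apply: (CCoo_ext o) (CCoo_dC k (sf' a)) => w /img_inv[aw _ E].
by rewrite dxyE E.
Qed.

(** The chain rule for the transition map from the chart b to the chart a. *)
Lemma dxy_chain U a b k f p : open U -> smooth M U f -> U p ->
  chart_dom a p -> chart_dom b p ->
  dxy b k f p = \sum_l dxy b k (xycoord a l) p * dxy a l f p.
Proof.
move=> oU sf Up ap bp.
pose V := U `&` (chart_dom a `&` chart_dom b).
have oV : open V by apply: openI => //; apply: openI; exact: dom_open.
have VU : V `<=` U by move=> q [].
have Va : V `<=` chart_dom a by move=> q [_ []].
have bV : img b V (chart b p) by exact: mem_img.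
have H1 w : img b V w -> img a V (chart a (chart_inv b w)).
  by move=> /img_inv[bw Vw _]; apply: mem_img => //; exact: Va.
have H2 l : Coo_on (img b V) (fun w => (chart a (chart_inv b w)) 0 l).
  by have [C _] := smooth_sub Va (smooth_xycoord a l) b.
have := dC_comp (img_open oV) (img_open oV) H1 H2 k (smooth_sub VU sf a) bV.
rewrite (chart_invK hM bp) => <-.
apply: (dC_eq (img_open (a := b) oV) k bV) => w /img_inv[bw Vw _] /=.
by rewrite (chart_invK hM)//; exact: Va.
Qed.

Lemma dxy_coord a k l p : chart_dom a p -> dxy a k (xycoord a l) p = (k == l)%:R.
Proof.
move=> ap; have oD := img_open (a := a) (dom_open a).
rewrite dxyE (dC_eq oD k (mem_img ap ap) (G := fun w => (w 0 l)%:C)).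
  apply: complex_eqP; rewrite /dC /=; last by rewrite derive_cst; case: eqP.
  by have [_ ->] := derive_coord k l (chart a p); case: eqP.
by move=> w /img_inv[aw _ E]; rewrite /xycoord E.
Qed.

Lemma dxy_swap U a k l f p : open U -> smooth M U f -> U p -> chart_dom a p ->
  dxy a k (dxy a l f) p = dxy a l (dxy a k f) p.
Proof.
move=> oU sf Up ap; have oI := img_open (a := a) oU.
have aU : img a U (chart a p) by exact: mem_img.
rewrite !dxyE (dC_eq oI k aU (G := dC l (loc a f))); last first.
  by move=> w /img_inv[_ _ E]; rewrite dxyE E.
rewrite [RHS](dC_eq oI l aU (G := dC k (loc a f))); last first.
  by move=> w /img_inv[_ _ E]; rewrite dxyE E.
exact: (dC_swap oI k l (sf a) aU).
Qed.

(** * Bump functions on the manifold *)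

(** The bump function is transported by a chart and extended by 0. The extension
    is smooth because the closed ball is compact, so its image in X is closed by
    the Hausdorff property. *)
Lemma exists_bump U p : open U -> U p ->
  exists chi : X -> R[i], [/\ smooth M [set: X] chi,
    exists V, [/\ open V, V p, V `<=` U & forall q, V q -> chi q = 1]
    & exists2 K : set X, closed K & K `<=` U /\ forall q, ~ K q -> chi q = 0].
Proof.
move=> oU Up; pose a := chart_at M p; have ap := chart_at_dom hM p.
have oI := img_open (a := a) oU.
(* The bump function of radius r is supported in the ball of radius 2 r. *)
have [r r0 rP] : exists2 r : R, 0 < r &
    forall w, `|w - chart a p| <= 2 * r -> img a U w.
  have : nbhs (chart a p) (img a U).
    by apply: open_nbhs_nbhs; split => //; exact: mem_img.
  move=> /nbhs_ballP[e /= e0 eP]; exists (e / 3); first by rewrite divr_gt0.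
  move=> w we; apply: eP; rewrite -ball_normE /= distrC.
  by apply: (le_lt_trans we); rewrite mulrCA gtr_pMr// ltr_pdivrMr// mul1r ltr_nat.
pose B := [set w : 'rV[R]_(n + n) | `|w - chart a p| <= 2 * r].
have cB : compact B.
  have := @rV_compact R (n + n)
    (fun i => [set` `[chart a p 0 i - 2 * r, chart a p 0 i + 2 * r]])
    (fun i => @segment_compact R _ _).
  congr compact; apply/seteqP; split=> w /= H.
    apply: (proj2 (norm_rowP _ _)) => [|i]; first by rewrite mulr_ge0// ltW.
    by have := H i; rewrite !mxE ler_distl in_itv.
  move=> i; have := le_trans (norm_coord _ i) H.
  by rewrite !mxE ler_distl in_itv.
pose K := chart_inv a @` B.
have cK : closed K.
  apply: compact_closed; first exact: (manifold_hausdorff hM).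
  apply: continuous_compact cB; apply: continuous_in_subspaceT => w.
  rewrite inE => /rP[q [aq Uq] <-]; exact: (chart_inv_continuous hM).
have KU : K `<=` U by move=> q [w /rP/img_inv[_ Uw _] <-].
have Ka : K `<=` chart_dom a by move=> q [w /rP/img_inv[aw _ _] <-].
pose chi q := if asbool (chart_dom a q) then (bump (chart a p) r (chart a q))%:C else 0.
have chiK q : ~ K q -> chi q = 0.
  move=> Kq; rewrite /chi; case: asboolP => // aq.
  have [->//|b0] := eqVneq (bump (chart a p) r (chart a q)) 0.
  exfalso; apply: Kq; exists (chart a q); last by rewrite (chart_invK hM).
  exact: bump_supp b0.
exists chi; split; last by exists K.
- apply: smooth_local => q _; have [aq|aq] := pselect (chart_dom a q).
    exists (chart_dom a); split => //; first exact: dom_open.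
    apply: (@smooth_chart a) => //; first exact: dom_open.
    have oD := img_open (a := a) (dom_open a).
    have : CCoo (img a (chart_dom a)) (fun w => (bump (chart a p) r w)%:C).
      by split=> k; [exact: Coo_bump|exact: Ck_cst].
    apply: (CCoo_ext oD) => w /img_inv[aw _ E].
    by rewrite /chi (asboolT aw) E.
  have oKc : open (~` K) by rewrite openC.
  exists (~` K); split => //; first by move=> /Ka.
  apply: (smooth_ext oKc) (smooth_cst 0 oKc) => q' /chiK //.
have oB : open (ball (chart a p) r) by apply: ball_open.
have : nbhs p [set q | chart_dom a q /\ (U q /\ ball (chart a p) r (chart a q))].
  apply: filterI; first by apply: open_nbhs_nbhs; split => //; exact: dom_open.
  apply: filterI; first by apply: open_nbhs_nbhs; split.
  by apply: (chart_continuous hM ap); exact: nbhsx_ballx.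
rewrite nbhsE => -[V [oV Vp] VP]; exists V; split => //.
  by move=> q /VP[_ []].
move=> q /VP[aq [Uq Bq]]; rewrite /chi asboolT// bump_eq1//.
by move: Bq; rewrite -ball_normE /= distrC => /ltW.
Qed.

End Manifold.

(** * Tangent vectors and the Lie bracket *)

Section VectorFields.
Context (R : realType) (X : topologicalType) (n : nat) (M : charts R X n).
Context (hM : complex_manifold M).
Notation vfield := (X -> 'rV[R[i]]_(n + n)).
Notation smooth := (smooth M).
Notation vsmooth := (vsmooth M).
Notation tact := (tact M).
Notation vact := (vact M).
Implicit Types (U : set X) (f g : X -> R[i]) (a b : chart_idx M) (p q : X)
  (V W : vfield) (v w : 'rV[R[i]]_(n + n)).

Lemma tact_linear p c v w f :
  tact p (c *: v + w) f = c * tact p v f + tact p w f.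
Proof.
rewrite /Defs.tact mulr_sumr -big_split; apply: eq_bigr => k _ /=.
by rewrite !mxE mulrDl mulrA.
Qed.

Lemma tactZ p c v f : tact p (c *: v) f = c * tact p v f.
Proof.
by rewrite /Defs.tact mulr_sumr; apply: eq_bigr => k _; rewrite !mxE mulrA.
Qed.

Lemma tactDl p v w f : tact p (v + w) f = tact p v f + tact p w f.
Proof. by have := tact_linear p 1 v w f; rewrite scale1r mul1r. Qed.

Lemma tact0 p f : tact p 0 f = 0.
Proof. by rewrite -(scale0r (0 : 'rV_(n + n))) tactZ mul0r. Qed.

Lemma tactN p v f : tact p (- v) f = - tact p v f.
Proof. by rewrite -scaleN1r tactZ mulN1r. Qed.

Lemma tactB p v w f : tact p (v - w) f = tact p v f - tact p w f.
Proof. by rewrite tactDl tactN. Qed.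

Lemma at_dom p : chart_dom (chart_at M p) p. Proof. exact: chart_at_dom hM p. Qed.

Section Local.
Context (U : set X) (oU : open U) (p : X) (Up : U p).

Lemma tact_eq v f g : (forall q, U q -> f q = g q) -> tact p v f = tact p v g.
Proof.
move=> fg; apply: eq_bigr => k _; congr (_ * _).
exact: (dxy_eq hM oU _ Up (at_dom p) fg).
Qed.

Lemma tact_cst v (c : R[i]) : tact p v (fun=> c) = 0.
Proof. by rewrite /Defs.tact big1// => k _; rewrite dxy_cst mulr0. Qed.

Lemma tact_add v f g : smooth U f -> smooth U g ->
  tact p v (fun q => f q + g q) = tact p v f + tact p v g.
Proof.
move=> sf sg; rewrite /Defs.tact -big_split; apply: eq_bigr => k _ /=.
by rewrite (dxy_add _ Up (at_dom p) sf sg) mulrDr.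
Qed.

Lemma tact_mul v f g : smooth U f -> smooth U g ->
  tact p v (fun q => f q * g q) = tact p v f * g p + f p * tact p v g.
Proof.
move=> sf sg; rewrite /Defs.tact mulr_suml mulr_sumr -big_split.
apply: eq_bigr => k _ /=.
by rewrite (dxy_mul hM _ Up (at_dom p) sf sg); ring.
Qed.

Lemma tact_scale v (c : R[i]) f : smooth U f ->
  tact p v (fun q => c * f q) = c * tact p v f.
Proof.
by move=> sf; rewrite (tact_mul _ (smooth_cst hM c oU) sf) tact_cst mul0r add0r.
Qed.

Lemma tact_opp v f : smooth U f -> tact p v (fun q => - f q) = - tact p v f.
Proof.
move=> sf; rewrite -mulN1r -(tact_scale _ _ sf); apply: tact_eq => q _.
by rewrite mulN1r.
Qed.

Lemma tact_sub v f g : smooth U f -> smooth U g ->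
  tact p v (fun q => f q - g q) = tact p v f - tact p v g.
Proof.
by move=> sf sg; rewrite (tact_add _ sf (smooth_opp hM oU sg)) tact_opp.
Qed.

Lemma tact_sum v (I : Type) (r : seq I) (F : I -> X -> R[i]) :
  (forall i, smooth U (F i)) ->
  tact p v (fun q => \sum_(i <- r) F i q) = \sum_(i <- r) tact p v (F i).
Proof.
move=> sF; elim: r => [|i r ih].
  rewrite big_nil -[RHS](tact_cst v 0); apply: tact_eq => q _.
  by rewrite big_nil.
rewrite big_cons -ih -(tact_add _ (sF i) (smooth_sum hM r predT oU sF)).
by apply: tact_eq => q _; rewrite big_cons.
Qed.

Lemma tact_chart a v f : smooth U f -> chart_dom a p ->
  tact p v f = \sum_l tact p v (xycoord a l) * dxy a l f p.
Proof.
move=> sf ap; rewrite /Defs.tact; under [RHS]eq_bigr => l _ do rewrite mulr_suml.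
rewrite exchange_big; apply: eq_bigr => k _ /=.
rewrite (dxy_chain hM k oU sf Up ap (at_dom p)) mulr_sumr.
by apply: eq_bigr => l _; rewrite mulrA.
Qed.

End Local.

Lemma tact_coord p v k : tact p v (xycoord (chart_at M p) k) = v 0 k.
Proof.
rewrite /Defs.tact (bigD1 k)//= (dxy_coord hM)//; last exact: at_dom.
rewrite eqxx mulr1 big1 ?addr0// => l lk.
by rewrite (dxy_coord hM) ?(negbTE lk) ?mulr0//; exact: at_dom.
Qed.

(** The coordinates of the chart at p, cut off by a bump function, are global
    smooth functions that recover the components of a vector. *)
Lemma tact_ext p v w :
  (forall f, smooth [set: X] f -> tact p v f = tact p w f) -> v = w.
Proof.
move=> H; apply/rowP => k; rewrite -(tact_coord p v) -(tact_coord p w).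
set a := chart_at M p; have ap := at_dom p; have oa := dom_open hM a.
have [chi [schi [V [oV Vp VU chi1]] [K cK [KU chi0]]]] := exists_bump hM oa ap.
have E q : V q -> chi q * xycoord a k q = xycoord a k q.
  by move=> /chi1 ->; rewrite mul1r.
rewrite -(tact_eq oV Vp v E) -(tact_eq oV Vp w E); apply: H.
apply: (smooth_local hM) => q _; have [Kq|Kq] := pselect (K q).
  exists (chart_dom a); split => //; first exact: KU.
  apply: (smooth_mul hM oa) => //; first exact: smooth_sub schi.
  exact: (smooth_xycoord hM).
have oKc : open (~` K) by rewrite openC.
exists (~` K); split=> //; apply: (smooth_ext hM oKc) (smooth_cst hM 0 oKc).
by move=> q' /chi0 ->; rewrite mul0r.
Qed.

Lemma vact_smooth U V f : open U -> vsmooth U V -> smooth U f ->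
  smooth U (vact V f).
Proof.
move=> oU sV sf; apply: (smooth_local hM) => p Up.
set a := chart_at M p; exists (U `&` chart_dom a).
have o := openI oU (dom_open hM a).
split => //; first by split => //; exact: at_dom.
apply: (smooth_ext hM o) (smooth_sum hM (index_enum 'I_(n + n)) predT o
  (fun l => smooth_mul hM o (sV a l) (smooth_dxy hM a l oU sf))) => q [Uq aq].
by rewrite /Defs.vact (tact_chart oU Uq _ sf aq).
Qed.

Lemma vsmooth_sub U U' V : U' `<=` U -> vsmooth U V -> vsmooth U' V.
Proof.
move=> UU sV a k; apply: smooth_sub (sV a k) => q [Uq aq].
by split=> //; exact: UU.
Qed.

(** Expanding f in a chart, the terms with second derivatives of f cancel by
    symmetry of these, and the others are the components of the bracket. *)
Lemma lie_act U V W f p : open U -> vsmooth U V -> vsmooth U W -> smooth U f ->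
  U p -> tact p (lie M V W p) f = vact V (vact W f) p - vact W (vact V f) p.
Proof.
move=> oU sV sW sf Up; set a := chart_at M p; have ap := at_dom p.
have o := openI oU (dom_open hM a); set D := U `&` chart_dom a in o.
have Dp : D p by [].
have DU : D `<=` U by move=> q [].
have half V' W' : vsmooth U V' -> vsmooth U W' ->
  vact V' (vact W' f) p = \sum_l (vact V' (vact W' (xycoord a l)) p * dxy a l f p)
   + \sum_l \sum_k vact W' (xycoord a l) p * (V' p 0 k * dxy a k (dxy a l f) p).
  move=> sV' sW'.
  have E q : D q -> vact W' f q = \sum_l vact W' (xycoord a l) q * dxy a l f q.
    by move=> [Uq aq]; rewrite /Defs.vact (tact_chart oU Uq _ sf aq).
  rewrite /Defs.vact (tact_eq o Dp _ E).
  have sd l := smooth_dxy hM a l oU sf.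
  rewrite (tact_sum o Dp _ _ (fun l => smooth_mul hM o (sW' a l) (sd l))).
  rewrite -big_split; apply: eq_bigr => l _ /=.
  by rewrite (tact_mul Dp _ (sW' a l) (sd l)) -mulr_sumr.
rewrite half// half// opprD addrACA.
rewrite [X in _ + (X - _)](_ : _ = \sum_l \sum_k
  vact V (xycoord a l) p * (W p 0 k * dxy a k (dxy a l f) p)) ?subrr ?addr0.
  rewrite -sumrB; apply: eq_bigr => l _.
  by rewrite -mulrBl /Defs.lie mxE.
rewrite exchange_big; apply: eq_bigr => k _; apply: eq_bigr => l _ /=.
rewrite /Defs.vact !tact_coord (dxy_swap hM k l oU sf Up ap); ring.
Qed.

Lemma lie_smooth U V W : open U -> vsmooth U V -> vsmooth U W ->
  vsmooth U (lie M V W).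
Proof.
move=> oU sV sW a k; have o := openI oU (dom_open hM a).
have sx : smooth (U `&` chart_dom a) (xycoord a k).
  by apply: smooth_sub (smooth_xycoord hM a k) => q [].
have sV' := vsmooth_sub (@subIsetl _ U (chart_dom a)) sV.
have sW' := vsmooth_sub (@subIsetl _ U (chart_dom a)) sW.
apply: (smooth_ext hM o) (smooth_add hM o (vact_smooth o sV' (vact_smooth o sW' sx))
  (smooth_opp hM o (vact_smooth o sW' (vact_smooth o sV' sx)))) => q Uq.
by rewrite -(lie_act o sV' sW' sx Uq).
Qed.

Lemma lie_eq U V W V' W' p : open U -> U p ->
  (forall q, U q -> V q = V' q) -> (forall q, U q -> W q = W' q) ->
  lie M V W p = lie M V' W' p.
Proof.
move=> oU Up VV WW; apply/rowP => k.
rewrite !mxE /Defs.vact (VV p Up) (WW p Up); congr (_ - _).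
  by apply: (tact_eq oU Up) => q Uq; rewrite (WW q Uq).
by apply: (tact_eq oU Up) => q Uq; rewrite (VV q Uq).
Qed.

Lemma lie_antisym V W p : lie M V W p = - lie M W V p.
Proof. by apply/rowP => k; rewrite !mxE opprB. Qed.

Lemma vsmooth_linear U (h : X -> R[i]) V W : open U -> smooth U h ->
  vsmooth U V -> vsmooth U W -> vsmooth U (fun q => h q *: V q + W q).
Proof.
move=> oU sh sV sW a k; have o := openI oU (dom_open hM a).
have sh' : smooth (U `&` chart_dom a) h by apply: smooth_sub sh => q [].
apply: (smooth_ext hM o) (smooth_add hM o (smooth_mul hM o sh' (sV a k)) (sW a k)).
by move=> q _; rewrite /Defs.vact tactDl tactZ.
Qed.

End VectorFields.

(** * Vectors and covectors of type (0,1) *)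

Section Entries.
Context (A : pzRingType) (m1 n1 n2 : nat).
Implicit Types (u v : 'M[A]_(m1, n1)).

Lemma mxDE u v i j : (u + v) i j = u i j + v i j. Proof. by rewrite mxE. Qed.
Lemma mxZE c u i j : (c *: u) i j = c * u i j. Proof. by rewrite mxE. Qed.
Lemma mxNE u i j : (- u) i j = - u i j. Proof. by rewrite mxE. Qed.
Lemma mx0E i j : (0 : 'M[A]_(m1, n1)) i j = 0. Proof. by rewrite mxE. Qed.
Lemma lsubE (w : 'M[A]_(m1, n1 + n2)) i j : lsubmx w i j = w i (lshift n2 j).
Proof. by rewrite mxE. Qed.
Lemma rsubE (w : 'M[A]_(m1, n1 + n2)) i j : rsubmx w i j = w i (rshift n1 j).
Proof. by rewrite mxE. Qed.

Lemma row_split_ext (u v : 'rV[A]_(n1 + n2)) :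
  (forall k, u 0 (lshift n2 k) = v 0 (lshift n2 k)) ->
  (forall k, u 0 (rshift n1 k) = v 0 (rshift n1 k)) -> u = v.
Proof.
move=> ul ur; apply/rowP => k; rewrite -(fintype.splitK k).
by case: (fintype.split k) => j /=; [exact: ul|exact: ur].
Qed.

End Entries.

Section AntiholomorphicTangent.
Context (R : realType) (X : topologicalType) (n : nat) (M : charts R X n).
Context (hM : complex_manifold M).
Notation vfield := (X -> 'rV[R[i]]_(n + n)).
Notation smooth := (smooth M).
Notation vsmooth := (vsmooth M).
Notation tact := (tact M).
Notation vact := (vact M).
Implicit Types (U : set X) (f g : X -> R[i]) (a b : chart_idx M) (p q : X)
  (V W : vfield) (v : 'rV[R[i]]_(n + n)) (w : 'rV[R[i]]_n).

Lemma iiN : 'i * 'i = -1 :> R[i]. Proof. by rewrite -expr2 sqr_i. Qed.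
Lemma two_neq0 : 2 != 0 :> R[i]. Proof. by rewrite pnatr_eq0. Qed.
Lemma halfD : 2^-1 + 2^-1 = 1 :> R[i].
Proof. by rewrite -mulr2n -[_ *+ 2]mulr_natl mulfV ?two_neq0. Qed.

Definition dz a (k : 'I_n) f p : R[i] :=
  2^-1 * (dxy a (lshift n k) f p - 'i * dxy a (rshift n k) f p).

Definition emb10 w : 'rV[R[i]]_(n + n) := 2^-1 *: row_mx w (- ('i *: w)).
Definition pr10 v : 'rV[R[i]]_n := lsubmx v + 'i *: rsubmx v.

Lemma pr01E v k : pr01 v 0 k = v 0 (lshift n k) - 'i * v 0 (rshift n k).
Proof. by rewrite /pr01 mxDE mxNE mxZE lsubE rsubE. Qed.
Lemma pr10E v k : pr10 v 0 k = v 0 (lshift n k) + 'i * v 0 (rshift n k).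
Proof. by rewrite /pr10 mxDE mxZE lsubE rsubE. Qed.
Lemma emb01l w k : emb01 w 0 (lshift n k) = 2^-1 * w 0 k.
Proof. by rewrite /emb01 mxZE row_mxEl. Qed.
Lemma emb01r w k : emb01 w 0 (rshift n k) = 2^-1 * ('i * w 0 k).
Proof. by rewrite /emb01 mxZE row_mxEr mxZE. Qed.
Lemma emb10l w k : emb10 w 0 (lshift n k) = 2^-1 * w 0 k.
Proof. by rewrite /emb10 mxZE row_mxEl. Qed.
Lemma emb10r w k : emb10 w 0 (rshift n k) = 2^-1 * - ('i * w 0 k).
Proof. by rewrite /emb10 mxZE row_mxEr mxNE mxZE. Qed.

Lemma pr01_linear c v v' : pr01 (c *: v + v') = c *: pr01 v + pr01 v'.
Proof.
apply/rowP => k.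
rewrite (mxDE (c *: pr01 v)) (mxZE c (pr01 v)).
rewrite [LHS]pr01E [X in _ = _ * X + _]pr01E [X in _ = _ + X]pr01E.
by rewrite !mxDE !mxZE; ring. Qed.

Lemma pr01D v v' : pr01 (v + v') = pr01 v + pr01 v'.
Proof. by have := pr01_linear 1 v v'; rewrite !scale1r. Qed.

Lemma pr010 : pr01 (0 : 'rV[R[i]]_(n + n)) = 0.
Proof. by apply/rowP => k; rewrite pr01E !mx0E mulr0 subr0. Qed.

Lemma pr01Z c v : pr01 (c *: v) = c *: pr01 v.
Proof. by have := pr01_linear c v 0; rewrite !addr0 pr010 addr0. Qed.

Lemma pr01N v : pr01 (- v) = - pr01 v.
Proof. by rewrite -scaleN1r pr01Z scaleN1r. Qed.

Lemma emb01_linear c w w' : emb01 (c *: w + w') = c *: emb01 w + emb01 w'.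
Proof.
by apply: row_split_ext => k; rewrite [RHS]mxDE [X in _ = X + _]mxZE
  ?emb01l ?emb01r !mxDE !mxZE; ring.
Qed.

Lemma emb01D w w' : emb01 (w + w') = emb01 w + emb01 w'.
Proof. by have := emb01_linear 1 w w'; rewrite !scale1r. Qed.

Lemma emb010 : emb01 (0 : 'rV[R[i]]_n) = 0.
Proof.
by apply: row_split_ext => k; rewrite ?emb01l ?emb01r !mx0E ?mulr0.
Qed.

Lemma emb01Z c w : emb01 (c *: w) = c *: emb01 w.
Proof. by have := emb01_linear c w 0; rewrite !addr0 emb010 addr0. Qed.

Lemma split01 v : v = emb01 (pr01 v) + emb10 (pr10 v).
Proof.
apply: row_split_ext => k;
  rewrite [RHS]mxDE ?emb01l ?emb01r ?emb10l ?emb10r pr01E pr10E.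
  move: (v 0 (lshift n k)) (v 0 (rshift n k)) => x y; rewrite -mulrDr.
  have -> : x - 'i * y + (x + 'i * y) = 2 * x by ring.
  by rewrite mulKf ?two_neq0.
move: (v 0 (lshift n k)) (v 0 (rshift n k)) => x y; rewrite -mulrDr.
have -> : 'i * (x - 'i * y) + - ('i * (x + 'i * y)) = - (2 * ('i * 'i) * y) by ring.
by rewrite iiN mulrN1 mulNr opprK mulKf ?two_neq0.
Qed.

Lemma tact_emb01 p w f :
  tact p (emb01 w) f = \sum_k w 0 k * dzb (chart_at M p) k f p.
Proof.
rewrite /Defs.tact big_split_ord /= -big_split; apply: eq_bigr => k _ /=.
by rewrite emb01l emb01r /dzb; ring.
Qed.

Lemma tact_emb10 p w f :
  tact p (emb10 w) f = \sum_k w 0 k * dz (chart_at M p) k f p.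
Proof.
rewrite /Defs.tact big_split_ord /= -big_split; apply: eq_bigr => k _ /=.
by rewrite emb10l emb10r /dz; ring.
Qed.

Lemma zcoordE a k p :
  zcoord a k p = xycoord a (lshift n k) p + 'i * xycoord a (rshift n k) p.
Proof. by apply: complex_eqP; rewrite ?ReD ?ImD ?ReM ?ImM /=; ring. Qed.

Lemma zbcoordE a k p :
  zbcoord a k p = xycoord a (lshift n k) p - 'i * xycoord a (rshift n k) p.
Proof.
by apply: complex_eqP; rewrite -mulNr ?ReD ?ImD ?ReM ?ImM /=; ring.
Qed.

Lemma tact_zcoord a k p v : chart_dom a p -> tact p v (zcoord a k)
  = tact p v (xycoord a (lshift n k)) + 'i * tact p v (xycoord a (rshift n k)).
Proof.
move=> ap; have oa := dom_open hM a.
have sx := smooth_xycoord hM a.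
rewrite -(tact_scale hM oa ap _ _ (sx (rshift n k))).
rewrite -(tact_add hM ap _ (sx _) (smooth_mul hM oa (smooth_cst hM 'i oa) (sx _))).
by apply: (tact_eq hM oa ap) => q _; rewrite zcoordE.
Qed.

Lemma tact_zbcoord a k p v : chart_dom a p -> tact p v (zbcoord a k)
  = tact p v (xycoord a (lshift n k)) - 'i * tact p v (xycoord a (rshift n k)).
Proof.
move=> ap; have oa := dom_open hM a.
have sx := smooth_xycoord hM a.
rewrite -(tact_scale hM oa ap _ _ (sx (rshift n k))).
rewrite -(tact_sub hM oa ap _ (sx _) (smooth_mul hM oa (smooth_cst hM 'i oa) (sx _))).
by apply: (tact_eq hM oa ap) => q _; rewrite zbcoordE.
Qed.

Lemma tact_zchart U a p v f : open U -> smooth U f -> U p -> chart_dom a p ->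
  tact p v f = \sum_l (tact p v (zcoord a l) * dz a l f p
                     + tact p v (zbcoord a l) * dzb a l f p).
Proof.
move=> oU sf Up ap; rewrite (tact_chart hM oU Up _ sf ap) big_split_ord /= -big_split.
apply: eq_bigr => l _ /=; rewrite tact_zcoord// tact_zbcoord// /dz /dzb.
set tx := tact _ _ _; set ty := tact _ _ _; set fx := dxy _ _ _ _; set fy := dxy _ _ _ _.
have -> : (tx + 'i * ty) * (2^-1 * (fx - 'i * fy)) + (tx - 'i * ty) * (2^-1 * (fx + 'i * fy))
  = (2^-1 + 2^-1) * (tx * fx) - (2^-1 + 2^-1) * ('i * 'i) * (ty * fy) by ring.
by rewrite halfD iiN !mul1r mulN1r opprK.
Qed.

Lemma tact_zbcoord_at p v k : tact p v (zbcoord (chart_at M p) k) = pr01 v 0 k.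
Proof.
rewrite tact_zbcoord; last exact: at_dom.
by rewrite !(tact_coord hM) pr01E.
Qed.

Lemma tact_zcoord_at p v k : tact p v (zcoord (chart_at M p) k) = pr10 v 0 k.
Proof.
rewrite tact_zcoord; last exact: at_dom.
by rewrite !(tact_coord hM) pr10E.
Qed.

(** In the chart at p, a vector of type (0,1) is a combination of d/dzbar_k, and
    these annihilate holomorphic functions by definition. *)
Lemma emb01_holomorphic U f p w : U p -> holomorphic M U f ->
  tact p (emb01 w) f = 0.
Proof.
move=> Up [_ hf]; rewrite tact_emb01 big1// => k _.
by rewrite hf ?mulr0//; exact: at_dom.
Qed.

Lemma emb01_zcoord a p w k : chart_dom a p -> tact p (emb01 w) (zcoord a k) = 0.
Proof. by move=> ap; apply: emb01_holomorphic ap (chart_transition hM a k). Qed.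

Lemma dz_conj U a k f p : open U -> smooth U f -> U p -> chart_dom a p ->
  dz a k (fun q => (f q)^*) p = (dzb a k f p)^*.
Proof.
move=> oU sf Up ap; rewrite /dz /dzb !(dxy_conj _ Up ap sf).
rewrite -mulNr [RHS]rmorphM; congr (_ * _); first by rewrite [RHS]conjc_inv conjc_nat.
rewrite [RHS]rmorphD; congr (_ + _); rewrite [RHS]rmorphM; congr (_ * _).
by apply: complex_eqP; rewrite /= ?oppr0.
Qed.

Lemma emb10_zbcoord a p w k : chart_dom a p -> tact p (emb10 w) (zbcoord a k) = 0.
Proof.
move=> ap; rewrite tact_emb10 big1// => l _.
rewrite (dz_conj _ (dom_open hM a) (smooth_zcoord hM a k) ap (at_dom hM p)).
have [_ ->//] := chart_transition hM a k; last exact: at_dom.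
by rewrite rmorph0 mulr0.
Qed.

Lemma pr01_0_zbcoord a p v k : pr01 v = 0 -> chart_dom a p ->
  tact p v (zbcoord a k) = 0.
Proof.
move=> v0 ap; rewrite (split01 v) v0 tactDl emb10_zbcoord// addr0.
by rewrite emb010 tact0.
Qed.

(** The z_k and their conjugates separate vectors, so a vector that kills the
    former lies in the span of the d/dzbar_k. *)
Lemma type01P p v :
  (forall k, tact p v (zcoord (chart_at M p) k) = 0) -> v = emb01 (pr01 v).
Proof.
move=> v0; rewrite [LHS]split01 (_ : pr10 v = 0); last first.
  by apply/rowP => k; rewrite -(tact_zcoord_at p) v0 mx0E.
by rewrite /emb10 scaler0 oppr0 row_mx0 scaler0 addr0.
Qed.

Lemma emb01_ext p w w' :
  (forall f, smooth [set: X] f -> tact p (emb01 w) f = tact p (emb01 w') f) ->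
  w = w'.
Proof. by move=> /(tact_ext hM) /(can_inj (@pr01K R n)). Qed.

Lemma tact_zbchart U a p w f : open U -> smooth U f -> U p -> chart_dom a p ->
  tact p (emb01 w) f = \sum_l tact p (emb01 w) (zbcoord a l) * dzb a l f p.
Proof.
move=> oU sf Up ap; rewrite (tact_zchart _ oU sf Up ap); apply: eq_bigr => l _.
by rewrite emb01_zcoord// mul0r add0r.
Qed.

Lemma tact_coord_vf U a k p f : open U -> smooth U f -> U p -> chart_dom a p ->
  tact p (coord_vf a k p) f = dxy a k f p.
Proof.
move=> oU sf Up ap.
rewrite (dxy_chain hM k oU sf Up (at_dom hM p) ap) /Defs.tact.
by apply: eq_bigr => l _; rewrite mxE.
Qed.

Lemma coord_vf01E a k p : coord_vf01 a k p
  = \row_l dzb a k (zbcoord (chart_at M p) l) p.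
Proof.
apply/rowP => l; rewrite !mxE (bigD1 k)//= mxE !eqxx mul1r big1 ?addr0// => j jk.
by rewrite mxE eqxx /= (negbTE jk) mul0r.
Qed.

Lemma emb01_coord_vf01 a k p : chart_dom a p ->
  emb01 (coord_vf01 a k p)
  = 2^-1 *: (coord_vf a (lshift n k) p + 'i *: coord_vf a (rshift n k) p).
Proof.
move=> ap; set v := RHS.
have av U f : open U -> smooth U f -> U p -> tact p v f = dzb a k f p.
  move=> oU sf Up; rewrite /v tactZ tactDl tactZ.
  by rewrite !(tact_coord_vf _ oU sf Up ap).
have ap' := at_dom hM p; set b := chart_at M p in ap'.
have ob := dom_open hM b.
rewrite [RHS](@type01P p) => [|l].
  congr emb01; rewrite coord_vf01E; apply/rowP => l.
  by rewrite -(tact_zbcoord_at p) (av _ _ ob (smooth_zbcoord hM b l) ap') mxE.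
rewrite (av _ _ ob (smooth_zcoord hM b l) ap').
by have [_ ->] := chart_transition hM b l.
Qed.

Lemma tact_coord_vf01 U a k p f : open U -> smooth U f -> U p -> chart_dom a p ->
  tact p (emb01 (coord_vf01 a k p)) f = dzb a k f p.
Proof.
move=> oU sf Up ap; rewrite emb01_coord_vf01// tactZ tactDl tactZ.
by rewrite !(tact_coord_vf _ oU sf Up ap).
Qed.

Lemma dzb_zbcoord a k l p : chart_dom a p -> dzb a k (zbcoord a l) p = (k == l)%:R.
Proof.
move=> ap; have sz := smooth_zbcoord hM a l; have oa := dom_open hM a.
have sx j := smooth_xycoord hM a j.
have D j : dxy a j (zbcoord a l) p
    = (j == lshift n l)%:R - 'i * (j == rshift n l)%:R.
  rewrite -(tact_coord_vf j oa sz ap ap) (tact_zbcoord l _ ap).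
  rewrite [X in X - _](tact_coord_vf j oa (sx _) ap ap).
  rewrite [X in _ - 'i * X](tact_coord_vf j oa (sx _) ap ap).
  by rewrite [X in X - _](dxy_coord hM _ _ ap) [X in _ - 'i * X](dxy_coord hM _ _ ap).
rewrite /dzb (D (lshift n k)) (D (rshift n k)) eq_lshift eq_lrshift eq_rlshift eq_rshift.
case: eqP => _; last by rewrite mulr0 subr0 mulr0 addr0 mulr0.
by rewrite mulr0 subr0 sub0r mulr1 mulrN iiN opprK mulrDr mulr1 halfD.
Qed.

Local Notation TV a x w := (trivV (b := T01 M) (j := a) x w).
Local Notation tr a x w := (triv (b := T01 M) a (x := x) w).

Lemma TV_sum a x w : TV a x w = \sum_l w 0 l *: coord_vf01 a l x.
Proof.
apply/rowP => k; rewrite !mxE summxE; apply: eq_bigr => l _.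
by rewrite coord_vf01E !mxE.
Qed.

Lemma emb01_sum (I : Type) (r : seq I) (F : I -> 'rV[R[i]]_n) :
  emb01 (\sum_(i <- r) F i) = \sum_(i <- r) emb01 (F i).
Proof.
elim: r => [|i r ih]; last by rewrite !big_cons emb01D ih.
by rewrite !big_nil emb010.
Qed.

Lemma tact_suml p (I : Type) (r : seq I) (F : I -> 'rV[R[i]]_(n + n)) f :
  tact p (\sum_(i <- r) F i) f = \sum_(i <- r) tact p (F i) f.
Proof.
elim: r => [|i r ih]; last by rewrite !big_cons tactDl ih.
by rewrite !big_nil tact0.
Qed.

(** On vectors of type (0,1) only the terms d/dzbar_l of the chart survive. *)
Lemma T01_trivK a x w : chart_dom a x -> TV a x (tr a x w) = w.
Proof.
move=> ax; apply: (can_inj (@pr01K R n)); apply: (tact_ext hM (p := x)) => f sf.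
rewrite TV_sum emb01_sum tact_suml.
rewrite [RHS](tact_zbchart _ openT sf I ax); apply: eq_bigr => l _.
by rewrite emb01Z tactZ (tact_coord_vf01 _ openT sf I ax) mxE.
Qed.

Lemma T01_trivVK a x w : chart_dom a x -> tr a x (TV a x w) = w.
Proof.
move=> ax; apply/rowP => k; rewrite mxE TV_sum emb01_sum tact_suml.
have sz := smooth_zbcoord hM a k; have oa := dom_open hM a.
rewrite (eq_bigr (fun l => w 0 l * (l == k)%:R)) => [|l _].
  rewrite (bigD1 k)//= eqxx mulr1 big1 ?addr0// => l lk.
  by rewrite (negbTE lk) mulr0.
by rewrite emb01Z tactZ (tact_coord_vf01 _ oa sz ax ax) (dzb_zbcoord l k ax).
Qed.

Lemma T01_linear a x c w w' :
  tr a x (c *: w + w') = c *: tr a x w + tr a x w'.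
Proof. by apply/rowP => k; rewrite !mxE emb01_linear tact_linear. Qed.

Lemma smooth_dzb U a k f : open U -> smooth U f ->
  smooth (U `&` chart_dom a) (dzb a k f).
Proof.
move=> oU sf; have o := openI oU (dom_open hM a).
apply: (smooth_mul hM o (smooth_cst hM _ o)).
apply: (smooth_add hM o (smooth_dxy hM a _ oU sf)).
exact: (smooth_mul hM o (smooth_cst hM _ o) (smooth_dxy hM a _ oU sf)).
Qed.

Lemma T01_bundle : vector_bundle smooth (T01 M).
Proof.
split=> /=.
- exact: (dom_open hM).
- by move=> x; exists (chart_at M x); exact: at_dom.
- by move=> a x c u v _; exact: T01_linear.
- by move=> a x u; exact: T01_trivK.
- by move=> a x w; exact: T01_trivVK.
- move=> a a' w k; have o := openI (dom_open hM a) (dom_open hM a').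
  have o' := openI (dom_open hM a') (dom_open hM a).
  apply: (smooth_ext hM o) (smooth_sum hM (index_enum 'I_n) predT o
   (fun l => smooth_mul hM o (smooth_cst hM (w 0 l) o)
     (smooth_sub _ (smooth_dzb a l (dom_open hM a') (smooth_zbcoord hM a' k))))).
  + move=> x [ax ax'] /=; rewrite mxE.
    rewrite -[X in emb01 X]/(TV a x w) TV_sum emb01_sum tact_suml.
    apply: eq_bigr => l _; rewrite emb01Z tactZ.
    by rewrite (tact_coord_vf01 _ (dom_open hM a') (smooth_zbcoord hM a' k) ax' ax).
  + by move=> _ x [].
Qed.

Local Notation TVd a x w := (trivV (b := T01dual M) (j := a) x w).
Local Notation trd a x w := (triv (b := T01dual M) a (x := x) w).

Lemma pair_linearl (m : nat) c (u u' v : 'rV[R[i]]_m) :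
  pair (c *: u + u') v = c * pair u v + pair u' v.
Proof.
rewrite /pair mulr_sumr -big_split; apply: eq_bigr => k _ /=.
by rewrite !mxE; ring.
Qed.
Lemma pair_linearr (m : nat) c (u v v' : 'rV[R[i]]_m) :
  pair u (c *: v + v') = c * pair u v + pair u v'.
Proof.
rewrite /pair mulr_sumr -big_split; apply: eq_bigr => k _ /=.
by rewrite !mxE; ring.
Qed.
Lemma pairZl (m : nat) c (u v : 'rV[R[i]]_m) : pair (c *: u) v = c * pair u v.
Proof. by rewrite /pair mulr_sumr; apply: eq_bigr => k _; rewrite mxE mulrA. Qed.
Lemma pairZr (m : nat) c (u v : 'rV[R[i]]_m) : pair u (c *: v) = c * pair u v.
Proof. by rewrite /pair mulr_sumr; apply: eq_bigr => k _; rewrite mxE mulrCA. Qed.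
Lemma pairDl (m : nat) (u u' v : 'rV[R[i]]_m) : pair (u + u') v = pair u v + pair u' v.
Proof. by have := pair_linearl 1 u u' v; rewrite scale1r mul1r. Qed.
Lemma pairDr (m : nat) (u v v' : 'rV[R[i]]_m) : pair u (v + v') = pair u v + pair u v'.
Proof. by have := pair_linearr 1 u v v'; rewrite scale1r mul1r. Qed.
Lemma pairNl (m : nat) (u v : 'rV[R[i]]_m) : pair (- u) v = - pair u v.
Proof. by rewrite -scaleN1r pairZl mulN1r. Qed.
Lemma pairNr (m : nat) (u v : 'rV[R[i]]_m) : pair u (- v) = - pair u v.
Proof. by rewrite -scaleN1r pairZr mulN1r. Qed.
Lemma pair_sumr (m : nat) (I : Type) (r : seq I) (F : I -> 'rV[R[i]]_m) u :
  pair u (\sum_(i <- r) F i) = \sum_(i <- r) pair u (F i).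
Proof.
elim: r => [|i r ih]; last by rewrite !big_cons pairDr ih.
by rewrite !big_nil -(scale0r (0 : 'rV_m)) pairZr mul0r.
Qed.
Lemma pair_delta (m : nat) (u : 'rV[R[i]]_m) k : pair u (delta_mx 0 k) = u 0 k.
Proof.
rewrite /pair (bigD1 k)//= mxE !eqxx mulr1 big1 ?addr0// => l lk.
by rewrite mxE eqxx /= (negbTE lk) mulr0.
Qed.

Lemma trdE a x eta k : trd a x eta 0 k = pair eta (coord_vf01 a k x).
Proof. by rewrite mxE. Qed.

(** The trivialisations of the bundle and of its dual over a chart are dual to
    each other. *)
Lemma pair_chart a x (eta w : 'rV[R[i]]_n) : chart_dom a x ->
  pair eta w = \sum_k trd a x eta 0 k * tr a x w 0 k.
Proof.
move=> ax; rewrite -{1}(T01_trivK w ax) TV_sum pair_sumr; apply: eq_bigr => k _.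
by rewrite pairZr trdE mulrC.
Qed.

Lemma T01dual_trivK a x eta : chart_dom a x -> TVd a x (trd a x eta) = eta.
Proof.
move=> ax; apply/rowP => k; rewrite mxE -[RHS]pair_delta (pair_chart _ _ ax).
apply: eq_bigr => l _; congr (_ * _); rewrite mxE tact_emb01 (bigD1 k)//=.
rewrite mxE !eqxx mul1r big1 ?addr0// => j jk.
by rewrite mxE eqxx /= (negbTE jk) mul0r.
Qed.

Lemma T01dual_trivVK a x w : chart_dom a x -> trd a x (TVd a x w) = w.
Proof.
move=> ax; apply/rowP => k; rewrite trdE /pair.
under eq_bigr => m _ do rewrite mxE mulr_suml.
rewrite exchange_big /=.
rewrite (eq_bigr (fun l => w 0 l * (k == l)%:R)) => [|l _].
  rewrite (bigD1 k)//= eqxx mulr1 big1 ?addr0// => l lk.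
  by rewrite eq_sym (negbTE lk) mulr0.
under eq_bigr => m _ do rewrite -mulrA [X in _ * X]mulrC.
rewrite -mulr_sumr -tact_emb01; congr (_ * _).
rewrite (tact_coord_vf01 _ (dom_open hM a) (smooth_zbcoord hM a l) ax ax).
exact: dzb_zbcoord.
Qed.

Lemma T01dual_bundle : vector_bundle smooth (T01dual M).
Proof.
split=> /=.
- exact: (dom_open hM).
- by move=> x; exists (chart_at M x); exact: at_dom.
- by move=> a x c u v _; apply/rowP => k; rewrite !mxE pair_linearl.
- by move=> a x u; exact: T01dual_trivK.
- by move=> a x w; exact: T01dual_trivVK.
- move=> a a' w k; have o := openI (dom_open hM a) (dom_open hM a').
  apply: (smooth_ext hM o) (smooth_sum hM (index_enum 'I_n) predT o
   (fun l => smooth_mul hM o (smooth_cst hM (w 0 l) o)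
     (smooth_dzb a' k (dom_open hM a) (smooth_zbcoord hM a l)))).
  move=> x [ax ax'] /=; rewrite mxE -[X in pair _ X]/(coord_vf01 a' k x).
  rewrite (pair_chart _ _ ax); apply: eq_bigr => l _.
  rewrite -[X in trd a x X]/(TVd a x w) T01dual_trivVK// mxE.
  by rewrite (tact_coord_vf01 _ (dom_open hM a) (smooth_zbcoord hM a l) ax ax').
Qed.

End AntiholomorphicTangent.

(** * Sections of vector bundles and tensorial functionals *)

Section Bundles.
Context (R : realType) (X : topologicalType) (n : nat) (M : charts R X n).
Context (hM : complex_manifold M).
Notation smooth := (smooth M).
Notation Sec U s := (section_on (Defs.smooth M) U s).
Notation Gamma s := (section_on (Defs.smooth M) [set: X] s).

Section OneBundle.
Context (E : bundle R X) (bE : vector_bundle (Defs.smooth M) E).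
Implicit Types (U V : set X) (s t : section E) (f : X -> R[i]) (j : tidx E).

Lemma triv_D j x (u v : E x) : tdom j x -> triv j (u + v) = triv j u + triv j v.
Proof.
by move=> jx; rewrite -[u in LHS]scale1r (triv_linear bE)// scale1r.
Qed.

Lemma triv_0 j x : tdom j x -> triv j (0 : E x) = 0.
Proof.
move=> jx; have := triv_D (0 : E x) 0 jx; rewrite addr0 => /eqP.
by rewrite -subr_eq0 opprD addNKr oppr_eq0 => /eqP.
Qed.

Lemma triv_Z j x c (u : E x) : tdom j x -> triv j (c *: u) = c *: triv j u.
Proof.
by move=> jx; rewrite -[_ *: u]addr0 (triv_linear bE)// triv_0// addr0.
Qed.

Lemma triv_inj j x (u v : E x) : tdom j x -> triv j u = triv j v -> u = v.
Proof. by move=> jx uv; rewrite -(trivK bE u jx) uv (trivK bE). Qed.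

Lemma triv_sum j x (I : Type) (r : seq I) (F : I -> E x) : tdom j x ->
  triv j (\sum_(i <- r) F i) = \sum_(i <- r) triv j (F i).
Proof.
move=> jx; elim: r => [|i r ih]; first by rewrite !big_nil triv_0.
by rewrite !big_cons triv_D// ih.
Qed.

Definition frame j (k : 'I_(trank j)) : section E := fun x => trivV x (delta_mx 0 k).

Lemma frame_expansion j x (u : E x) : tdom j x ->
  u = \sum_k triv j u 0 k *: frame k x.
Proof.
move=> jx; apply: (triv_inj jx); rewrite triv_sum// {1}[triv j u]row_sum_delta.
by apply: eq_bigr => k _; rewrite triv_Z// (trivVK bE).
Qed.

Lemma tdomO j : open (tdom j). Proof. exact: (tdom_open bE). Qed.

Lemma section_sub U V s : V `<=` U -> Sec U s -> Sec V s.
Proof.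
move=> VU ss j k; apply: smooth_sub (ss j k) => x [Vx jx].
by split=> //; exact: VU.
Qed.

Lemma section_ext U s t : open U -> (forall x, U x -> s x = t x) ->
  Sec U s -> Sec U t.
Proof.
move=> oU st ss j k; apply: (smooth_ext hM (openI oU (tdomO j))) (ss j k).
by move=> x [Ux jx]; rewrite st.
Qed.

Lemma section_local U s :
  (forall x, U x -> exists V, [/\ open V, V x & Sec V s]) -> Sec U s.
Proof.
move=> H j k; apply: (smooth_local hM) => x [Ux jx].
have [V [oV Vx ss]] := H x Ux; exists (V `&` tdom j).
by split=> //; exact: openI oV (tdomO j).
Qed.

Lemma section_add U s t : open U -> Sec U s -> Sec U t ->
  Sec U (fun x => s x + t x).
Proof.
move=> oU ss st j k; have o := openI oU (tdomO j).
apply: (smooth_ext hM o) (smooth_add hM o (ss j k) (st j k)) => x [Ux jx].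
by rewrite triv_D// mxDE.
Qed.

Lemma section_scale U f s : open U -> smooth U f -> Sec U s ->
  Sec U (fun x => f x *: s x).
Proof.
move=> oU sf ss j k; have o := openI oU (tdomO j).
have sf' : smooth (U `&` tdom j) f by apply: smooth_sub sf => x [].
apply: (smooth_ext hM o) (smooth_mul hM o sf' (ss j k)) => x [Ux jx].
by rewrite triv_Z// mxZE.
Qed.

Lemma section_0 U : open U -> Sec U (fun x => 0 : E x).
Proof.
move=> oU j k; have o := openI oU (tdomO j).
apply: (smooth_ext hM o) (smooth_cst hM 0 o) => x [Ux jx].
by rewrite triv_0// mx0E.
Qed.

Lemma section_cscale U (c : R[i]) s : open U -> Sec U s ->
  Sec U (fun x => c *: s x).
Proof. by move=> oU; apply: section_scale => //; exact: (smooth_cst hM). Qed.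

Lemma section_sum U (I : Type) (r : seq I) (F : I -> section E) : open U ->
  (forall i, Sec U (F i)) -> Sec U (fun x => \sum_(i <- r) F i x).
Proof.
move=> oU sF; elim: r => [|i r ih].
  by apply: (section_ext oU) (section_0 oU) => x _; rewrite big_nil.
by apply: (section_ext oU) (section_add oU (sF i) ih) => x _; rewrite big_cons.
Qed.

Lemma frame_smooth j k : Sec (tdom j) (frame (j := j) k).
Proof. by move=> j' k'; exact: (triv_transition bE). Qed.

End OneBundle.

(** A cut-off function for U at p turns objects which are smooth on U only into
    global ones, without changing them near p. *)
Record cutoff (U : set X) (p : X) (chi : X -> R[i]) (V : set X) : Prop := Cutoff {
  cutoff_smooth : smooth [set: X] chi;
  cutoff_open : open V;
  cutoff_at : V p;
  cutoff_sub : V `<=` U;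
  cutoff1 : forall q, V q -> chi q = 1;
  cutoff0 : forall q, ~ U q -> chi q = 0;
  cutoff_fun : forall f, smooth U f -> smooth [set: X] (fun q => chi q * f q);
  cutoff_section : forall (E : bundle R X) (s : section E),
    vector_bundle (Defs.smooth M) E -> Sec U s -> Gamma (fun q => chi q *: s q) }.

Lemma exists_cutoff U p : open U -> U p -> exists chi V, cutoff U p chi V.
Proof.
move=> oU Up.
have [chi [schi [V [oV Vp VU chi1]] [K cK [KU chi0]]]] := exists_bump hM oU Up.
have oKc : open (~` K) by rewrite openC.
exists chi, V; split => //.
- by move=> q Uq; apply: chi0 => /KU.
- move=> f sf; apply: (smooth_local hM) => q _; have [Kq|Kq] := pselect (K q).
    exists U; split => //; first exact: KU.
    by apply: (smooth_mul hM oU) => //; exact: smooth_sub schi.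
  exists (~` K); split=> //; apply: (smooth_ext hM oKc) (smooth_cst hM 0 oKc).
  by move=> q' /chi0 ->; rewrite mul0r.
- move=> E s bE ss; apply: (section_local bE) => q _.
  have [Kq|Kq] := pselect (K q).
    exists U; split => //; first exact: KU.
    by apply: (section_scale bE oU) => //; exact: smooth_sub schi.
  exists (~` K); split=> //; apply: (section_ext bE oKc) (section_0 bE oKc).
  by move=> q' /chi0 ->; rewrite scale0r.
Qed.

Section Tensorial.
Context (E : bundle R X) (bE : vector_bundle (Defs.smooth M) E) (p : X).

(** The functionals that factor through the value at p. *)
Definition tensorial (T : section E -> R[i]) : Prop :=
  (forall s t, Gamma s -> Gamma t -> T (fun x => s x + t x) = T s + T t) /\
  (forall f s, smooth [set: X] f -> Gamma s ->
     T (fun x => f x *: s x) = f p * T s).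

Lemma tensorial0 T : tensorial T -> T (fun x => 0) = 0.
Proof.
move=> [_ TZ]; have := TZ (fun=> 0) (fun x => 0) (smooth_cst hM 0 openT)
  (section_0 bE openT).
by rewrite mul0r => <-; congr T; apply/functional_extensionality_dep => x;
  rewrite scale0r.
Qed.

Lemma tensorial_sum T (I : Type) (r : seq I) (F : I -> section E) : tensorial T ->
  (forall i, Gamma (F i)) ->
  T (fun x => \sum_(i <- r) F i x) = \sum_(i <- r) T (F i).
Proof.
move=> TT gF; elim: r => [|i r ih].
  rewrite big_nil -[RHS](tensorial0 TT); congr T.
  by apply/functional_extensionality_dep => x; rewrite big_nil.
rewrite big_cons -ih -TT.1//; last exact: (section_sum bE r openT gF).
by congr T; apply/functional_extensionality_dep => x; rewrite big_cons.
Qed.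

(** Near p a section is a combination of frame fields; cutting off twice makes
    this a global identity. *)
Lemma tensorial_expansion j : tdom j p -> exists chi V, cutoff (tdom j) p chi V /\
  forall T s, tensorial T -> Gamma s ->
    T s = \sum_k triv j (s p) 0 k * T (fun x => chi x *: frame k x).
Proof.
move=> jp; have oj := tdom_open bE j.
have [chi [V cV]] := exists_cutoff oj jp; exists chi, V; split => // T s TT gs.
have chip : chi p = 1 by apply: (cutoff1 cV); exact: (cutoff_at cV).
have schi := cutoff_smooth cV.
have gk k : Gamma (fun x => chi x *: frame (E := E) (j := j) k x).
  by apply: (cutoff_section cV bE); exact: frame_smooth.
have fk k : smooth [set: X] (fun x => chi x * triv j (s x) 0 k).
  by apply: (cutoff_fun cV); apply: smooth_sub (gs j k) => x.
(* One factor chi extends the components of s, the other one the frame. *)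
have step : T s = T (fun x => chi x *: (chi x *: s x)).
  by rewrite !TT.2 ?chip ?mul1r//; apply: (section_scale bE openT).
rewrite step.
transitivity (T (fun x => \sum_k (chi x * triv j (s x) 0 k)
    *: (chi x *: frame (E := E) (j := j) k x))).
  congr T; apply/functional_extensionality_dep => x.
  have [c0|c0] := eqVneq (chi x) 0.
    by rewrite c0 scale0r big1// => k _; rewrite mul0r scale0r.
  have jx : tdom j x.
    by apply: contrapT => /(cutoff0 cV)/eqP; rewrite (negbTE c0).
  rewrite {1}(frame_expansion bE (s x) jx) !scaler_sumr.
  by apply: eq_bigr => k _; rewrite !scalerA; congr (_ *: _); ring.
rewrite tensorial_sum//.
  by apply: eq_bigr => k _; rewrite TT.2// chip mul1r.
by move=> k; apply: (section_scale bE openT).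
Qed.

End Tensorial.
End Bundles.

(** * Evaluation at a point and Riesz representation *)

Section Evaluation.
Context (R : realType) (X : topologicalType) (n : nat) (M : charts R X n).
Context (hM : complex_manifold M).
Notation smooth := (smooth M).
Notation Sec U s := (section_on (Defs.smooth M) U s).
Notation Gamma s := (section_on (Defs.smooth M) [set: X] s).

Lemma exists_section (E : bundle R X) (bE : vector_bundle (Defs.smooth M) E) p
  (u : E p) : exists s : section E, Gamma s /\ s p = u.
Proof.
have [j jp] := tdom_cover bE p; have oj := tdom_open bE j.
have [chi [V cV]] := exists_cutoff hM oj jp.
exists (fun x => chi x *: \sum_k triv j u 0 k *: frame (E := E) (j := j) k x).
split; last first.
  by rewrite (cutoff1 cV) ?scale1r -?(frame_expansion bE)//; exact: (cutoff_at cV).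
apply: (cutoff_section cV bE); apply: (section_sum hM bE) => // k.
exact: (section_cscale hM bE _ oj (frame_smooth bE (j := j) k)).
Qed.

Lemma holomorphic_ext U f g : open U -> (forall p, U p -> f p = g p) ->
  holomorphic M U f -> holomorphic M U g.
Proof.
move=> oU fg [sf hf]; split=> [|a k p Up ap]; first exact: (smooth_ext hM oU fg).
rewrite -(hf a k p Up ap) /dzb.
by rewrite !(dxy_eq hM oU _ Up ap fg).
Qed.

Lemma holomorphic_sub U V f : V `<=` U -> holomorphic M U f -> holomorphic M V f.
Proof.
move=> VU [sf hf]; split=> [|a k p /VU Up]; first exact: smooth_sub sf.
exact: hf.
Qed.

Lemma holomorphic_bundle_smooth (E : bundle R X) :
  vector_bundle (holomorphic M) E -> vector_bundle (Defs.smooth M) E.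
Proof.
move=> [h1 h2 h3 h4 h5 h6]; split=> //.
by move=> j j' w k; have [] := h6 j j' w k.
Qed.

(** Near p a section is a combination of a holomorphic frame, and the sections
    of the frame remain holomorphic near p when they are cut off. *)
Lemma tensorial_holomorphic (E : bundle R X)
    (bE : vector_bundle (holomorphic M) E) p (T : section E -> R[i]) :
  tensorial M p T ->
  (forall (e : section E) V, open V -> V p -> Gamma e ->
     section_on (holomorphic M) V e -> T e = 0) ->
  forall s, Gamma s -> T s = 0.
Proof.
move=> TT Th s gs; have bE' := holomorphic_bundle_smooth bE.
have [j jp] := tdom_cover bE' p.
have [chi [V [cV exp]]] := tensorial_expansion hM bE' jp.
rewrite (exp T s TT gs) big1// => k _; rewrite (Th _ V) ?mulr0//.
- exact: (cutoff_open cV).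
- exact: (cutoff_at cV).
- by apply: (cutoff_section cV bE'); exact: frame_smooth.
move=> j' k'; have oV' := openI (cutoff_open cV) (tdom_open bE j').
have h := triv_transition bE (delta_mx 0 k : 'rV_(trank j)) k'.
apply: (holomorphic_ext oV') (holomorphic_sub _ h) => [x [Vx _]|x [Vx j'x]].
  by rewrite (cutoff1 cV)// scale1r.
by split=> //; exact: (cutoff_sub cV).
Qed.

Lemma smooth_det U r (A : X -> 'M[R[i]]_r) : open U ->
  (forall i j, smooth U (fun x => A x i j)) -> smooth U (fun x => \det (A x)).
Proof.
move=> oU sA; apply: (smooth_sum hM _ _ oU) => s.
apply: (smooth_mul hM oU); first exact: (smooth_cst hM).
exact: (smooth_prod hM).
Qed.

Lemma smooth_invmx U r (A : X -> 'M[R[i]]_r) i j : open U ->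
  (forall i j, smooth U (fun x => A x i j)) ->
  (forall x, U x -> A x \in unitmx) ->
  smooth U (fun x => invmx (A x) i j).
Proof.
move=> oU sA uA.
have sd := smooth_det oU sA.
have sc : smooth U (fun x => cofactor (A x) j i).
  apply: (smooth_mul hM oU); first exact: (smooth_cst hM).
  apply: smooth_det => // k l; apply: (smooth_ext hM oU) (sA (lift j k) (lift i l)).
  by move=> x _; rewrite !mxE.
have s := smooth_mul hM oU (smooth_inv hM oU _ sd) sc.
apply: (smooth_ext hM oU) (s _) => [x Ux|x Ux].
  by rewrite /invmx uA// !mxE.
by have := uA _ Ux; rewrite unitmxE unitfE.
Qed.

Section Gram.
Context (A : courant R X n) (hA : courant_algebroid M A).
Notation bA := (courant_bundle hA).
Notation ip := (@cinner _ _ _ A _).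

Lemma innerDl x (u v w : A x) : ip (u + v) w = ip u w + ip v w.
Proof.
by have [h _ _] := courant_metric hA x; rewrite -{1}(scale1r u) h mul1r.
Qed.

Lemma inner0l x (w : A x) : ip 0 w = 0.
Proof.
by apply: (@addrI _ (ip 0 w)); rewrite -innerDl !addr0.
Qed.

Lemma innerZl x c (u w : A x) : ip (c *: u) w = c * ip u w.
Proof.
have [h _ _] := courant_metric hA x.
by rewrite -[c *: u]addr0 h inner0l addr0.
Qed.

Lemma innerC x (u v : A x) : ip u v = ip v u.
Proof. by have [_ h _] := courant_metric hA x. Qed.

Lemma innerDr x (u v w : A x) : ip w (u + v) = ip w u + ip w v.
Proof. by rewrite innerC innerDl !(innerC w). Qed.

Lemma innerZr x c (u w : A x) : ip w (c *: u) = c * ip w u.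
Proof. by rewrite innerC innerZl innerC. Qed.

Lemma innerNl x (u w : A x) : ip (- u) w = - ip u w.
Proof. by rewrite -scaleN1r innerZl mulN1r. Qed.

Lemma innerBl x (u v w : A x) : ip (u - v) w = ip u w - ip v w.
Proof. by rewrite innerDl innerNl. Qed.

Lemma innerNr x (u w : A x) : ip w (- u) = - ip w u.
Proof. by rewrite innerC innerNl innerC. Qed.

Lemma inner_sumr x (I : Type) (r : seq I) (F : I -> A x) w :
  ip w (\sum_(i <- r) F i) = \sum_(i <- r) ip w (F i).
Proof.
elim: r => [|i r ih]; last by rewrite !big_cons innerDr ih.
by rewrite !big_nil innerC inner0l.
Qed.

Lemma inner_ext x (u v : A x) : (forall w, ip w u = ip w v) -> u = v.
Proof.
move=> uv; have [_ _ nd] := courant_metric hA x.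
apply/eqP; rewrite -subr_eq0; apply/eqP; apply: nd => w.
by rewrite innerBl !(innerC _ w) uv subrr.
Qed.

Lemma inner_ext_section x (u v : A x) :
  (forall s : section A, Gamma s -> ip (s x) u = ip (s x) v) -> u = v.
Proof.
by move=> uv; apply: inner_ext => w; have [s [gs <-]] := exists_section bA w; exact: uv.
Qed.

Definition gram (j : tidx A) (x : X) : 'M[R[i]]_(trank j) :=
  \matrix_(k, l) ip (frame k x) (frame l x).

(** A vector in the kernel of the Gram matrix gives an element of the fibre that
    is orthogonal to everything, hence zero. *)
Lemma gram_unit j x : tdom j x -> gram j x \in unitmx.
Proof.
move=> jx; rewrite unitmxE unitfE; apply/det0P => -[v v0 vG].
have u0 : \sum_k v 0 k *: frame (E := A) (j := j) k x = 0.
  apply: inner_ext => w; rewrite (innerC w 0) inner0l.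
  rewrite (frame_expansion bA w jx) innerC inner_sumr big1// => l _.
  rewrite innerZr innerC inner_sumr.
  have := congr1 (fun m : 'rV_(trank j) => m 0 l) vG; rewrite !mxE => e.
  rewrite (_ : \sum_(i <- _) _ = 0) ?mulr0//; rewrite -[RHS]e.
  by apply: eq_bigr => k _; rewrite mxE innerZr innerC.
move/eqP: v0; apply; have := congr1 (fun u : A x => triv j u) u0.
rewrite (triv_0 bA jx) (triv_sum bA _ _ jx) => <-.
rewrite [LHS]matrix.row_sum_delta; apply: eq_bigr => k _.
by rewrite (triv_Z bA _ _ jx) (trivVK bA).
Qed.

(** In a frame, the coefficients of the representing vector solve a linear system
    with the Gram matrix. *)
Lemma riesz p (T : section A -> R[i]) : tensorial M p T ->
  exists u : A p, forall s, Gamma s -> ip (s p) u = T s.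
Proof.
move=> TT; have [j jp] := tdom_cover bA p.
have [chi [V [cV exp]]] := tensorial_expansion hM bA jp.
pose t : 'rV[R[i]]_(trank j) := \row_k T (fun x => chi x *: frame k x).
pose c := t *m invmx (gram j p).
exists (\sum_l c 0 l *: frame l p) => s gs.
rewrite (exp T s TT gs) {1}(frame_expansion bA (s p) jp) innerC inner_sumr.
apply: eq_bigr => k _; rewrite innerZr; congr (_ * _).
have := congr1 (fun m : 'rV_(trank j) => m 0 k) (mulmxKV (gram_unit jp) t).
rewrite [RHS]mxE => <-; rewrite -/c mxE innerC inner_sumr.
by apply: eq_bigr => l _; rewrite innerZr [X in _ = _ * X]mxE innerC.
Qed.

(** The components of u in a frame are obtained from its products with the
    sections of the frame by inverting the Gram matrix. *)
Lemma section_of_inner (u : section A) :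
  (forall s, Gamma s -> smooth [set: X] (fun x => ip (s x) (u x))) -> Gamma u.
Proof.
move=> su; apply: (section_local hM bA) => p _.
have [j jp] := tdom_cover bA p; have oj := tdom_open bA j.
have [chi [V cV]] := exists_cutoff hM oj jp.
have oV := cutoff_open cV; have Vj := cutoff_sub cV.
exists V; split => //; first exact: (cutoff_at cV).
have sb k : smooth V (fun x => ip (frame (E := A) (j := j) k x) (u x)).
  have := su _ (cutoff_section cV bA (frame_smooth bA k)).
  move=> /(smooth_sub (@subsetT _ V)); apply: (smooth_ext hM oV) => x Vx.
  by rewrite (cutoff1 cV)// scale1r.
have sG k l : smooth V (fun x => gram j x k l).
  have f i := section_sub Vj (frame_smooth bA (j := j) i).
  apply: (smooth_ext hM oV) (courant_inner_smooth hA oV (f k) (f l)) => x _.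
  by rewrite mxE.
have sI k l := smooth_invmx k l oV sG (fun x Vx => gram_unit (Vj x Vx)).
have sc l : smooth V (fun x => triv j (u x) 0 l).
  apply: (smooth_ext hM oV) (smooth_sum hM (index_enum _) predT oV
    (fun k => smooth_mul hM oV (sb k) (sI k l))) => x Vx.
  pose b : 'rV[R[i]]_(trank j) := \row_k ip (frame k x) (u x).
  have <- : b *m invmx (gram j x) = triv j (u x).
    rewrite -[RHS](mulmxK (gram_unit (Vj x Vx))); congr (_ *m _).
    apply/rowP => k; rewrite !mxE {1}(frame_expansion bA (u x) (Vj x Vx)).
    by rewrite inner_sumr; apply: eq_bigr => i _; rewrite innerZr mxE innerC.
  by rewrite mxE; apply: eq_bigr => k _; rewrite mxE.
have f i := section_sub Vj (frame_smooth bA (j := j) i).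
apply: (section_ext hM bA oV) (section_sum hM bA (index_enum _) oV
  (fun k => section_scale hM bA oV (sc k) (f k))) => x Vx.
by rewrite -(frame_expansion bA _ (Vj x Vx)).
Qed.

End Gram.
End Evaluation.

(** * Consequences of the Courant algebroid axioms *)

Section Courant.
Context (R : realType) (X : topologicalType) (n : nat) (M : charts R X n).
Context (hM : complex_manifold M).
Context (A : courant R X n) (hA : courant_algebroid M A).
Notation smooth f := (Defs.smooth M [set: X] f).
Notation Gamma s := (section_on (Defs.smooth M) [set: X] s).
Notation bA := (courant_bundle hA).
Notation ip := (@cinner _ _ _ A _).
Notation rho := (@canchor _ _ _ A _).
Notation dorf := (@cdorf _ _ _ A).
Notation act s f := (vact M (fun q => rho (s q)) f).
Notation cD f := (calD M (@cinner _ _ _ A) (@canchor _ _ _ A) f).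
Notation funx := functional_extensionality_dep.
Implicit Types (s t u phi psi chi : section A) (f g : X -> R[i]) (x p : X).

Lemma anchorD x (u v : A x) : rho (u + v) = rho u + rho v.
Proof.
by have := courant_anchor_linear hA 1 u v; rewrite !scale1r.
Qed.

Lemma anchor0 x : rho (0 : A x) = 0.
Proof. by apply: (@addrI _ (rho (0 : A x))); rewrite -anchorD !addr0. Qed.

Lemma anchorZ x c (u : A x) : rho (c *: u) = c *: rho u.
Proof.
by have := courant_anchor_linear hA c u 0; rewrite !addr0 anchor0 addr0.
Qed.

Lemma anchor_vsmooth s : Gamma s -> vsmooth M [set: X] (fun q => rho (s q)).
Proof. by move=> gs; exact: (courant_anchor_smooth hA openT gs). Qed.

Lemma act_smooth s f : Gamma s -> smooth f -> smooth (act s f).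
Proof.
by move=> gs sf; apply: (vact_smooth hM openT) => //; exact: anchor_vsmooth.
Qed.

Lemma inner_smooth s t : Gamma s -> Gamma t -> smooth (fun x => ip (s x) (t x)).
Proof. by move=> gs gt; exact: (courant_inner_smooth hA openT gs gt). Qed.

Lemma dorf_smooth s t : Gamma s -> Gamma t -> Gamma (dorf s t).
Proof. exact: (courant_dorf_smooth hA). Qed.

Lemma add_smooth s t : Gamma s -> Gamma t -> Gamma (fun x => s x + t x).
Proof. exact: (section_add hM bA openT). Qed.

Lemma scale_smooth f s : smooth f -> Gamma s -> Gamma (fun x => f x *: s x).
Proof. exact: (section_scale hM bA openT). Qed.

Lemma calD_inner f x (v : A x) : smooth f -> ip (cD f x) v = tact M x (rho v) f.
Proof.
move=> sf; pose T s := tact M x (rho (s x)) f.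
have TT : tensorial M x T.
  split=> [s t _ _|h s _ _]; first by rewrite /T anchorD tactDl.
  by rewrite /T anchorZ tactZ.
have [u0 u0P] := riesz hM hA TT.
have u0Q (w : A x) : ip u0 w = tact M x (rho w) f.
  have [s [gs <-]] := exists_section hM bA w.
  by rewrite (innerC hA) u0P.
rewrite /calD.
case: (xgetP 0 [set u : A x | forall v : A x, ip u v = tact M x (rho v) f])
  => [y _ /(_ v)//|].
by move=> /(_ u0); case.
Qed.

Lemma calD_unique f x (w : A x) : smooth f ->
  (forall v, ip v w = tact M x (rho v) f) -> w = cD f x.
Proof.
move=> sf wP; apply: (inner_ext hA) => v.
by rewrite wP (innerC hA v (cD f x)) calD_inner.
Qed.

Lemma calD_smooth f : smooth f -> Gamma (cD f).
Proof.
move=> sf; apply: (section_of_inner hM hA) => s gs.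
apply: (smooth_ext hM openT) (act_smooth gs sf) => x _.
by rewrite (innerC hA) calD_inner.
Qed.

Lemma calD_add f g x : smooth f -> smooth g ->
  cD (fun q => f q + g q) x = cD f x + cD g x.
Proof.
move=> sf sg; symmetry; apply: calD_unique => [|v].
  exact: (smooth_add hM openT).
by rewrite (innerDr hA) (innerC hA v (cD f x)) (innerC hA v (cD g x))
  (calD_inner v sf) (calD_inner v sg) (tact_add hM I _ sf sg).
Qed.

Lemma calD_mul f g x : smooth f -> smooth g ->
  cD (fun q => f q * g q) x = f x *: cD g x + g x *: cD f x.
Proof.
move=> sf sg; symmetry; apply: calD_unique => [|v].
  exact: (smooth_mul hM openT).
rewrite (innerDr hA) !(innerZr hA) (innerC hA v (cD f x)) (innerC hA v (cD g x)).
by rewrite (calD_inner v sf) (calD_inner v sg) (tact_mul hM I _ sf sg); ring.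
Qed.

Let ax := courant_dorfman hA.

Lemma dorfDr phi s t : Gamma phi -> Gamma s -> Gamma t ->
  dorf phi (fun x => s x + t x) = fun x => dorf phi s x + dorf phi t x.
Proof.
move=> gp gs gt; apply: funx => x.
have := dorf_linearr ax 1 gp gs gt (I : [set: X] x).
rewrite (_ : (fun x => 1 *: s x + t x) = (fun x => s x + t x)) ?scale1r//.
by apply: funx => y; rewrite scale1r.
Qed.

Lemma dorfDl phi s t : Gamma phi -> Gamma s -> Gamma t ->
  dorf (fun x => s x + t x) phi = fun x => dorf s phi x + dorf t phi x.
Proof.
move=> gp gs gt; apply: funx => x.
have := dorf_linearl ax 1 gs gt gp (I : [set: X] x).
rewrite (_ : (fun x => 1 *: s x + t x) = (fun x => s x + t x)) ?scale1r//.
by apply: funx => y; rewrite scale1r.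
Qed.

Lemma dorfZr f phi psi : smooth f -> Gamma phi -> Gamma psi ->
  dorf phi (fun x => f x *: psi x)
  = fun x => act phi f x *: psi x + f x *: dorf phi psi x.
Proof.
by move=> sf gp gs; apply: funx => x; exact: (dorf_leibniz ax sf gp gs I).
Qed.

Lemma dorfJ phi s t : Gamma phi -> Gamma s -> Gamma t ->
  dorf phi (dorf s t) = fun x => dorf (dorf phi s) t x + dorf s (dorf phi t) x.
Proof.
by move=> gp gs gt; apply: funx => x; exact: (dorf_jacobi ax gp gs gt I).
Qed.

Lemma zmod_cancel (V : zmodType) (p q a b d g h : V) :
  (p + g) + (d + (b + h)) = (a + b) + ((q + d) + (g + h)) -> p - q - a = 0.
Proof.
rewrite [LHS](AC (2*(1*2)) (1*(2*(3*(4*5)))))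
  [RHS](AC (2*(2*2)) ((1*3)*(5*(4*(2*6))))).
by move=> /addIr ->; rewrite addrK subrr.
Qed.

Lemma half_twice (V : lmodType R[i]) (v : V) : 2^-1 *: (v + v) = v.
Proof. by rewrite scalerDr -scalerDl halfD scale1r. Qed.

(** Polarisation of the axiom on phi <> phi. *)
Lemma dorf_sym phi psi x : Gamma phi -> Gamma psi ->
  dorf phi psi x + dorf psi phi x = cD (fun q => ip (phi q) (psi q)) x.
Proof.
move=> gp gs; have gps := add_smooth gp gs.
have := dorf_diag ax gps (I : [set: X] x).
rewrite dorfDl// dorfDr// dorfDr//.
have -> : (fun q => ip (phi q + psi q) (phi q + psi q)) =
  (fun q => (ip (phi q) (phi q) + ip (psi q) (psi q))
    + (ip (phi q) (psi q) + ip (phi q) (psi q))).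
  apply: funx => q; rewrite !(innerDl hA) !(innerDr hA) (innerC hA (psi q) (phi q)).
  by ring.
have s1 := inner_smooth gp gp; have s2 := inner_smooth gs gs.
have s3 := inner_smooth gp gs.
rewrite (calD_add x (smooth_add hM openT s1 s2) (smooth_add hM openT s3 s3)).
rewrite (calD_add x s1 s2) (calD_add x s3 s3) [RHS]scalerDr half_twice [X in _ = X + _]scalerDr.
rewrite -(dorf_diag ax gp (I : [set: X] x)) -(dorf_diag ax gs (I : [set: X] x)).
set a := dorf phi phi x; set b := dorf psi psi x; set c := dorf phi psi x.
set d := dorf psi phi x; rewrite [d + b]addrC addrACA.
by move=> /addrI.
Qed.

(** The rule for functions in the left argument follows from the one on the right
    by dorf_sym. *)
Lemma dorfZl f phi psi x : smooth f -> Gamma phi -> Gamma psi ->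
  dorf (fun q => f q *: phi q) psi x
  = f x *: dorf phi psi x - act psi f x *: phi x + ip (phi x) (psi x) *: cD f x.
Proof.
move=> sf gp gs; have gfp := scale_smooth sf gp.
have := dorf_sym x gfp gs.
have -> : (fun q => ip (f q *: phi q) (psi q)) = (fun q => f q * ip (phi q) (psi q)).
  by apply: funx => q; rewrite (innerZl hA).
rewrite calD_mul//; last exact: inner_smooth.
rewrite -(dorf_sym x gp gs) dorfZr// scalerDr => /(canRL (addrK _)) ->.
rewrite opprD; set a := f x *: _; set b := f x *: _; set c := _ *: cD f x.
set d := act _ _ _ *: _.
by rewrite [- d - b]addrC addrA [a + b + c]addrAC addrK addrAC.
Qed.

(** Apply the Jacobi identity to f chi for a section chi with chi(x) <> 0: the
    terms in which f is differentiated twice give the claim. If the bundle has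
    rank 0 near x, both sides vanish. *)
Lemma dorf_act phi psi f x : Gamma phi -> Gamma psi -> smooth f ->
  act (dorf phi psi) f x = act phi (act psi f) x - act psi (act phi f) x.
Proof.
move=> gp gs sf; have [j jx] := tdom_cover bA x.
have [r0|r0] := posnP (trank j).
  have z q (u : A q) : tdom j q -> u = 0.
    move=> jq; rewrite (frame_expansion bA u jq) big1// => k _.
    by have := ltn_ord k; rewrite {2}r0.
  have az s g q : tdom j q -> act s g q = 0.
    by move=> jq; rewrite /vact (z q (s q) jq) anchor0 tact0.
  have oj := tdom_open bA j.
  rewrite /vact (z x (dorf phi psi x) jx) (z x (phi x) jx) (z x (psi x) jx).
  by rewrite !anchor0 !tact0 subrr.
have [chi [gc chi0]] := exists_section hM bA (frame (E := A) (j := j) (Ordinal r0) x).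
have cn0 : chi x != 0.
  apply/eqP => c0; have := congr1 (fun u : A x => triv j u 0 (Ordinal r0)) (etrans (esym chi0) c0).
  rewrite (trivVK bA)// (triv_0 bA)// mxE mx0E !eqxx /= => /eqP.
  by rewrite oner_eq0.
have spf := act_smooth gp sf; have ssf := act_smooth gs sf.
have gpc := dorf_smooth gp gc; have gsc := dorf_smooth gs gc.
have gfc := scale_smooth sf gc.
have := congr1 (fun F : section A => F x) (dorfJ gp gs gfc).
rewrite (dorfZr sf gs gc) (dorfZr sf gp gc) (dorfZr sf (dorf_smooth gp gs) gc).
rewrite (dorfDr gp (scale_smooth ssf gc) (scale_smooth sf gsc)).
rewrite (dorfDr gs (scale_smooth spf gc) (scale_smooth sf gpc)).
rewrite (dorfZr ssf gp gc) (dorfZr sf gp gsc) (dorfZr spf gs gc) (dorfZr sf gs gpc).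
rewrite (dorfJ gp gs gc) => e.
have e2 : (act phi (act psi f) x - act psi (act phi f) x
    - act (dorf phi psi) f x) *: chi x = 0.
  rewrite !scalerBl; apply: (@zmod_cancel _ _ _ _ (f x *: dorf (dorf phi psi) chi x)
    (act phi f x *: dorf psi chi x) (act psi f x *: dorf phi chi x)
    (f x *: dorf psi (dorf phi chi) x)).
  by rewrite -scalerDr.
move/eqP: e2; rewrite scaler_eq0 (negbTE cn0) orbF subr_eq0 => /eqP ->//.
Qed.

(** The symmetric part of the bracket is D<phi, psi>, while the anchor of the
    bracket is antisymmetric; hence rho(D<phi, psi>) = 0. Replacing phi by f phi
    gives <phi, psi> rho(D f) = 0, and <phi, psi> can be made nonzero at x unless
    the fibre is zero. *)
Lemma calD_anchor f x : smooth f -> rho (cD f x) = 0.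
Proof.
move=> sf; apply: (tact_ext hM (p := x)) => g sg; rewrite tact0.
have key phi psi : Gamma phi -> Gamma psi ->
    tact M x (rho (cD (fun q => ip (phi q) (psi q)) x)) g = 0.
  move=> gp gs; rewrite -dorf_sym// anchorD tactDl.
  rewrite -[tact _ _ _ _]/(act (dorf phi psi) g x) dorf_act//.
  rewrite -[X in _ + X]/(act (dorf psi phi) g x) dorf_act//.
  by rewrite addrA subrK subrr.
have [[u [v uv]]|H] := pselect (exists u v : A x, ip u v <> 0); last first.
  suff -> : cD f x = 0 by rewrite anchor0 tact0.
  have H' (u v : A x) : ip u v = 0 by apply: contrapT => h; apply: H; exists u, v.
  by apply: (inner_ext hA) => w; rewrite !H'.
have [phi [gp phix]] := exists_section hM bA u.
have [psi [gs psix]] := exists_section hM bA v.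
have gfp := scale_smooth sf gp.
have sps := inner_smooth gp gs.
have := key _ _ gfp gs.
have -> : (fun q => ip (f q *: phi q) (psi q)) = (fun q => f q * ip (phi q) (psi q)).
  by apply: funx => q; rewrite (innerZl hA).
rewrite (calD_mul x sf sps) anchorD 2!anchorZ tactDl
  [X in X + _]tactZ [X in _ + X]tactZ.
rewrite (key phi psi gp gs) mulr0 add0r.
rewrite phix psix.
by move=> /eqP; rewrite mulf_eq0 => /orP[/eqP/uv[]|/eqP].
Qed.

(** If chi is a cut-off function at p for V, then phi = (1 - chi) phi, and the
    rules for functions give only terms with a factor 1 - chi(p) or phi(p), or
    <phi(p), psi(p)>, which are all zero. *)
Lemma dorf_local_zero V phi psi p : open V -> V p -> Gamma phi -> Gamma psi ->
  (forall q, V q -> phi q = 0) -> dorf phi psi p = 0 /\ dorf psi phi p = 0.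
Proof.
move=> oV Vp gp gs p0; have [chi [V' cV]] := exists_cutoff hM oV Vp.
have sc := cutoff_smooth cV; have cp := cutoff1 cV (cutoff_at cV).
pose h q := 1 - chi q.
have sh : smooth h.
  exact: (smooth_add hM openT (smooth_cst hM 1 openT) (smooth_opp hM openT sc)).
have E : phi = fun q => h q *: phi q.
  apply: funx => q; have [Vq|Vq] := pselect (V q); first by rewrite p0// scaler0.
  by rewrite /h (cutoff0 cV)// subr0 scale1r.
have hp : h p = 0 by rewrite /h cp subrr.
have pp : phi p = 0 by exact: p0.
split; rewrite E.
  by rewrite dorfZl// hp pp (inner0l hA) scaler0 !scale0r subr0 addr0.
by rewrite dorfZr// hp pp scaler0 scale0r addr0.
Qed.

End Courant.

(** * Algebraic Cartan calculus *)

Section CartanCalculus.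
Context (X : Type) (C : comNzRingType) (PF : (X -> C) -> Prop).
Context (L : Type) (PL : L -> Prop) (act : L -> (X -> C) -> X -> C) (br : L -> L -> L).
Implicit Types (f g : X -> C) (Y Z : L).

Hypothesis PF_add : forall f g, PF f -> PF g -> PF (fun x => f x + g x).
Hypothesis PF_sub : forall f g, PF f -> PF g -> PF (fun x => f x - g x).
Hypothesis PF_act : forall Y f, PL Y -> PF f -> PF (act Y f).
Hypothesis PL_br : forall Y Z, PL Y -> PL Z -> PL (br Y Z).

(** D stands for a vector field which need not belong to L. *)
Definition additive_action (D : (X -> C) -> X -> C) :=
  (forall f g x, PF f -> PF g -> D (fun x => f x + g x) x = D f x + D g x) /\
  (forall f g x, PF f -> PF g -> D (fun x => f x - g x) x = D f x - D g x).

Hypothesis act_additive : forall Y, PL Y -> additive_action (act Y).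
Hypothesis act_br : forall Y Z f x, PL Y -> PL Z -> PF f ->
  act (br Y Z) f x = act Y (act Z f) x - act Z (act Y f) x.

(** One-forms enter only through their values on fields, and the identities of
    this section use only that these respect the identities of a Lie bracket. *)
Record form_like (eta : L -> X -> C) : Prop := FormLike {
  form_smooth : forall Y, PL Y -> PF (eta Y);
  form_anti : forall Y Z x, PL Y -> PL Z -> eta (br Y Z) x = - eta (br Z Y) x;
  form_jacobi : forall Y Y' Z x, PL Y -> PL Y' -> PL Z ->
    eta (br Y (br Y' Z)) x = eta (br (br Y Y') Z) x + eta (br Y' (br Y Z)) x }.

(** The form component L_Y eta' - i_Y' d eta of a standard Dorfman bracket. *)
Definition form_bracket (Y : L) (eta : L -> X -> C) (Y' : L) (eta' : L -> X -> C)
    (Z : L) (x : X) : C :=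
  act Y (eta' Z) x - eta' (br Y Z) x
  - act Y' (eta Z) x + act Z (eta Y') x + eta (br Y' Z) x.

Lemma form_bracket_action D Y eta Y' eta' Z x : additive_action D ->
  PL Y -> PL Y' -> PL Z -> form_like eta -> form_like eta' ->
  D (form_bracket Y eta Y' eta' Z) x =
  D (act Y (eta' Z)) x - D (eta' (br Y Z)) x
  - D (act Y' (eta Z)) x + D (act Z (eta Y')) x + D (eta (br Y' Z)) x.
Proof.
move=> [DD DB] pY pY' pZ F F'.
have s1 := PF_act pY (form_smooth F' pZ).
have s2 := form_smooth F' (PL_br pY pZ).
have s3 := PF_act pY' (form_smooth F pZ).
have s4 := PF_act pZ (form_smooth F pY').
have s5 := form_smooth F (PL_br pY' pZ).
have s12 := PF_sub s1 s2; have s123 := PF_sub s12 s3; have s1234 := PF_add s123 s4.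
by rewrite /form_bracket (DD _ _ x s1234 s5) (DD _ _ x s123 s4) (DB _ _ x s12 s3)
  (DB _ _ x s1 s2).
Qed.

Lemma form_bracket_eq Y eta1 eta2 Y' eta1' eta2' Z x : PL Y -> PL Y' -> PL Z ->
  (forall U, PL U -> eta1 U = eta2 U) -> (forall U, PL U -> eta1' U = eta2' U) ->
  form_bracket Y eta1 Y' eta1' Z x = form_bracket Y eta2 Y' eta2' Z x.
Proof.
move=> pY pY' pZ e e'; rewrite /form_bracket (e' _ pZ) (e _ pZ) (e _ pY').
by rewrite (e' _ (PL_br pY pZ)) (e _ (PL_br pY' pZ)).
Qed.

Lemma form_bracket_smooth Y eta Y' eta' Z : PL Y -> PL Y' -> PL Z ->
  form_like eta -> form_like eta' -> PF (form_bracket Y eta Y' eta' Z).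
Proof.
move=> pY pY' pZ F F'.
have s1 := PF_act pY (form_smooth F' pZ).
have s2 := form_smooth F' (PL_br pY pZ).
have s3 := PF_act pY' (form_smooth F pZ).
have s4 := PF_act pZ (form_smooth F pY').
have s5 := form_smooth F (PL_br pY' pZ).
exact: (PF_add (PF_add (PF_sub (PF_sub s1 s2) s3) s4) s5).
Qed.

(** Expanding, all terms cancel by the commutation of derivations and the Jacobi
    identities inside the forms. *)
Lemma form_bracket_jacobi Y1 eta1 Y2 eta2 Y3 eta3 Z x :
  PL Y1 -> PL Y2 -> PL Y3 -> PL Z ->
  form_like eta1 -> form_like eta2 -> form_like eta3 ->
  form_bracket Y1 eta1 (br Y2 Y3) (form_bracket Y2 eta2 Y3 eta3) Z x
  = form_bracket (br Y1 Y2) (form_bracket Y1 eta1 Y2 eta2) Y3 eta3 Z x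
  + form_bracket Y2 eta2 (br Y1 Y3) (form_bracket Y1 eta1 Y3 eta3) Z x.
Proof.
move=> p1 p2 p3 pZ F1 F2 F3.
have A1 := act_additive p1; have A2 := act_additive p2.
have A3 := act_additive p3; have AZ := act_additive pZ.
rewrite {1 3 5}/form_bracket.
rewrite (form_bracket_action x A1 p2 p3 pZ F2 F3).
rewrite (form_bracket_action x A3 p1 p2 pZ F1 F2).
rewrite (form_bracket_action x AZ p1 p2 p3 F1 F2).
rewrite (form_bracket_action x A2 p1 p3 pZ F1 F3).
rewrite /form_bracket.
have f1 := form_smooth F1; have f2 := form_smooth F2; have f3 := form_smooth F3.
rewrite (act_br x p2 p3 (f1 _ pZ)) (act_br x p1 p2 (f3 _ pZ)).
rewrite (act_br x p1 p3 (f2 _ pZ)).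
rewrite (act_br x p1 pZ (f2 _ p3)) (act_br x p3 pZ (f1 _ p2)).
rewrite (act_br x p2 pZ (f1 _ p3)).
have J1 := form_jacobi F1; have J2 := form_jacobi F2; have J3 := form_jacobi F3.
rewrite (J3 Y1 Y2 Z x p1 p2 pZ) (J2 Y1 Y3 Z x p1 p3 pZ) (J1 Y2 Y3 Z x p2 p3 pZ).
ring.
Qed.

Section Transport.
Context (D : (X -> C) -> X -> C) (lam : L -> L).
Context (DP : L -> (X -> C) -> X -> C) (lamP : L -> L -> L).
Hypothesis D_additive : additive_action D.
Hypothesis PF_D : forall f, PF f -> PF (D f).
Hypothesis PL_lam : forall Y, PL Y -> PL (lam Y).
(** The commutator of D with a field Y splits into a field lam Y and a field
    acting by - DP Y, for which lamP Y plays the role of lam. *)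
Hypothesis D_act : forall Y f x, PL Y -> PF f ->
  D (act Y f) x - act Y (D f) x = act (lam Y) f x - DP Y f x.

Definition lie_derivation (E : (X -> C) -> X -> C) (l : L -> L)
  (eta : L -> X -> C) (Z : L) (x : X) : C := E (eta Z) x - eta (l Z) x.

Definition transports (eta : L -> X -> C) := forall Y Z x, PL Y -> PL Z ->
  eta (lam (br Y Z)) x = eta (br (lam Y) Z) x + eta (br Y (lam Z)) x
    - eta (lamP Y Z) x + eta (lamP Z Y) x.

(** The failure of lie_derivation to be a derivation of the form bracket. After
    expansion, D_act and the hypotheses transports leave only terms with DP and
    lamP. *)
Lemma form_bracket_transport Y1 eta1 Y2 eta2 Z x :
  PL Y1 -> PL Y2 -> PL Z -> form_like eta1 -> form_like eta2 ->
  transports eta1 -> transports eta2 ->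
  lie_derivation D lam (form_bracket Y1 eta1 Y2 eta2) Z x
  - form_bracket (lam Y1) (lie_derivation D lam eta1) Y2 eta2 Z x
  - form_bracket Y1 eta1 (lam Y2) (lie_derivation D lam eta2) Z x
  - lie_derivation (DP Y2) (lamP Y2) eta1 Z x
  + lie_derivation (DP Y1) (lamP Y1) eta2 Z x
  = - (lie_derivation (DP Z) (lamP Z) eta1 Y2 x + eta2 (lamP Z Y1) x).
Proof.
move=> p1 p2 pZ F1 F2 T1 T2.
have A1 := act_additive p1; have A2 := act_additive p2; have AZ := act_additive pZ.
have f1 := form_smooth F1; have f2 := form_smooth F2.
rewrite {1}/lie_derivation (form_bracket_action x D_additive p1 p2 pZ F1 F2).
rewrite /form_bracket /lie_derivation.
rewrite (A2.2 _ _ x (PF_D (f1 _ pZ)) (f1 _ (PL_lam pZ))).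
rewrite (AZ.2 _ _ x (PF_D (f1 _ p2)) (f1 _ (PL_lam p2))).
rewrite (A1.2 _ _ x (PF_D (f2 _ pZ)) (f2 _ (PL_lam pZ))).
rewrite (T2 Y1 Z x p1 pZ) (T1 Y2 Z x p2 pZ).
have c1 := D_act x p1 (f2 _ pZ); have c2 := D_act x p2 (f1 _ pZ).
have c3 := D_act x pZ (f1 _ p2).
rewrite -(subrK (act Y1 (D (eta2 Z)) x) (D (act Y1 (eta2 Z)) x)) c1.
rewrite -(subrK (act Y2 (D (eta1 Z)) x) (D (act Y2 (eta1 Z)) x)) c2.
rewrite -(subrK (act Z (D (eta1 Y2)) x) (D (act Z (eta1 Y2)) x)) c3.
ring.
Qed.

End Transport.

End CartanCalculus.

Section BracketOfFields.
Context (X : Type) (C : comNzRingType) (PF : (X -> C) -> Prop).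
Context (V : lmodType C) (PL : (X -> V) -> Prop).
Context (der : X -> V -> (X -> C) -> C) (br : (X -> V) -> (X -> V) -> X -> V).
Notation act Y f := (fun x => der x (Y x) f).
Implicit Types (f g : X -> C) (Y Z : X -> V) (x : X).

(** The calculus is abstract because the same identities are needed twice: for
    all complex vector fields and for those of type (0,1). *)
Record field_calculus : Prop := FieldCalculus {
  fc_PF_act : forall Y f, PL Y -> PF f -> PF (act Y f);
  fc_PF_cst : forall c : C, PF (fun=> c);
  fc_der_cst : forall x u c, der x u (fun=> c) = 0;
  fc_PL_add : forall Y Z, PL Y -> PL Z -> PL (fun x => Y x + Z x);
  fc_PL_scale : forall f Y, PF f -> PL Y -> PL (fun x => f x *: Y x);
  fc_PL_br : forall Y Z, PL Y -> PL Z -> PL (br Y Z);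
  fc_derD : forall x u v f, der x (u + v) f = der x u f + der x v f;
  fc_derZ : forall x c u f, der x (c *: u) f = c * der x u f;
  fc_der_add : forall x u f g, PF f -> PF g ->
    der x u (fun y => f y + g y) = der x u f + der x u g;
  fc_der_sub : forall x u f g, PF f -> PF g ->
    der x u (fun y => f y - g y) = der x u f - der x u g;
  fc_der_mul : forall x u f g, PF f -> PF g ->
    der x u (fun y => f y * g y) = der x u f * g x + f x * der x u g;
  fc_der_ext : forall x u v,
    (forall f, PF f -> der x u f = der x v f) -> u = v;
  fc_der_br : forall Y Z f x, PL Y -> PL Z -> PF f ->
    der x (br Y Z x) f = der x (Y x) (act Z f) - der x (Z x) (act Y f) }.

Context (FC : field_calculus).
Let PF_act := fc_PF_act FC.
Let PF_cst := fc_PF_cst FC.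
Let der_cst := fc_der_cst FC.
Let PL_add := fc_PL_add FC.
Let PL_scale := fc_PL_scale FC.
Let PL_br := fc_PL_br FC.
Let derD := fc_derD FC.
Let derZ := fc_derZ FC.
Let der_add := fc_der_add FC.
Let der_sub := fc_der_sub FC.
Let der_mul := fc_der_mul FC.
Let der_ext := fc_der_ext FC.
Let der_br := fc_der_br FC.

Lemma br_anti Y Z x : PL Y -> PL Z -> br Y Z x = - br Z Y x.
Proof.
move=> pY pZ; apply: (@der_ext x) => f pf.
have -> : - br Z Y x = (-1) *: br Z Y x by rewrite scaleN1r.
by rewrite derZ !der_br//; ring.
Qed.

Lemma brDr Y Z Z' x : PL Y -> PL Z -> PL Z' ->
  br Y (fun q => Z q + Z' q) x = br Y Z x + br Y Z' x.
Proof.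
move=> pY pZ pZ'; have pZZ := PL_add pZ pZ'.
apply: (@der_ext x) => f pf; rewrite derD !der_br//.
have -> : act (fun q => Z q + Z' q) f = fun q => act Z f q + act Z' f q.
  by apply/funext => q; rewrite derD.
by rewrite der_add ?derD; [ring|exact: PF_act..].
Qed.

Lemma brZr Y f Z x : PF f -> PL Y -> PL Z ->
  br Y (fun q => f q *: Z q) x = act Y f x *: Z x + f x *: br Y Z x.
Proof.
move=> pf pY pZ; have pfZ := PL_scale pf pZ.
apply: (@der_ext x) => g pg; rewrite derD !derZ !der_br//.
have -> : act (fun q => f q *: Z q) g = fun q => f q * act Z g q.
  by apply/funext => q; rewrite derZ.
by rewrite der_mul ?derZ//; [ring|exact: PF_act].
Qed.

Lemma brDl Y Y' Z x : PL Y -> PL Y' -> PL Z ->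
  br (fun q => Y q + Y' q) Z x = br Y Z x + br Y' Z x.
Proof.
move=> pY pY' pZ; have pYY := PL_add pY pY'.
by rewrite (br_anti x pYY pZ) brDr// opprD -(br_anti x pY pZ) -(br_anti x pY' pZ).
Qed.

Lemma brZl Y f Z x : PF f -> PL Y -> PL Z ->
  br (fun q => f q *: Y q) Z x = f x *: br Y Z x - act Z f x *: Y x.
Proof.
move=> pf pY pZ; have pfY := PL_scale pf pY.
by rewrite (br_anti x pfY pZ) brZr// opprD addrC -scalerN -(br_anti x pY pZ).
Qed.

Lemma br_linear_r c Y Z Z' x : PL Y -> PL Z -> PL Z' ->
  br Y (fun q => c *: Z q + Z' q) x = c *: br Y Z x + br Y Z' x.
Proof.
move=> pY pZ pZ'; have pcZ := PL_scale (PF_cst c) pZ.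
by rewrite (brDr x pY pcZ pZ') (brZr x (PF_cst c) pY pZ) der_cst scale0r add0r.
Qed.

Lemma br_linear_l c Y Y' Z x : PL Y -> PL Y' -> PL Z ->
  br (fun q => c *: Y q + Y' q) Z x = c *: br Y Z x + br Y' Z x.
Proof.
move=> pY pY' pZ; have pcY := PL_scale (PF_cst c) pY.
by rewrite (brDl x pcY pY' pZ) (brZl x (PF_cst c) pY pZ) der_cst scale0r subr0.
Qed.

Lemma br_diag Y x : PL Y -> br Y Y x = 0.
Proof.
move=> pY; apply: (@der_ext x) => f pf; rewrite der_br// subrr.
by rewrite -(scale0r (0 : V)) derZ mul0r.
Qed.

Lemma br_jacobi Y Y' Z x : PL Y -> PL Y' -> PL Z ->
  br Y (br Y' Z) x = br (br Y Y') Z x + br Y' (br Y Z) x.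
Proof.
move=> pY pY' pZ.
have p1 := PL_br pY' pZ; have p2 := PL_br pY pY'; have p3 := PL_br pY pZ.
have E Y1 Y2 f : PL Y1 -> PL Y2 -> PF f ->
    act (br Y1 Y2) f = fun q => act Y1 (act Y2 f) q - act Y2 (act Y1 f) q.
  by move=> *; apply/funext => q; exact: der_br.
have sa Y1 g : PL Y1 -> PF g -> PF (act Y1 g) by exact: PF_act.
apply: (@der_ext x) => f pf; rewrite derD (der_br x pY p1 pf) (der_br x p2 pZ pf).
rewrite (der_br x pY' p3 pf) (E Y' Z)// (E Y Y')// (E Y Z)//.
rewrite (der_sub _ _ (sa _ _ pY' (sa _ _ pZ pf)) (sa _ _ pZ (sa _ _ pY' pf))).
rewrite (der_sub _ _ (sa _ _ pY (sa _ _ pY' pf)) (sa _ _ pY' (sa _ _ pY pf))).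
rewrite (der_sub _ _ (sa _ _ pY (sa _ _ pZ pf)) (sa _ _ pZ (sa _ _ pY pf))).
rewrite (der_br x pY' pZ (sa _ _ pY pf)) (der_br x pY pY' (sa _ _ pZ pf)).
rewrite (der_br x pY pZ (sa _ _ pY' pf)).
by ring.
Qed.

Context (W : lmodType C) (PW : (X -> W) -> Prop) (pairing : X -> W -> V -> C).
Notation ev eta := (fun U q => pairing q (eta q) (U q)).
Notation FB Y eta Y' eta' Z x :=
  (form_bracket (fun U h q => der q (U q) h) br Y (ev eta) Y' (ev eta') Z x).
Implicit Types (eta : X -> W).

Record form_calculus : Prop := FormCalculus {
  fc_pairing_smooth : forall eta Y, PW eta -> PL Y -> PF (ev eta Y);
  fc_pairingDl : forall x u u' v,
    pairing x (u + u') v = pairing x u v + pairing x u' v;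
  fc_pairingZl : forall x c u v, pairing x (c *: u) v = c * pairing x u v;
  fc_pairingDr : forall x u v v',
    pairing x u (v + v') = pairing x u v + pairing x u v';
  fc_pairingZr : forall x c u v, pairing x u (c *: v) = c * pairing x u v }.

Context (PC : form_calculus).
Let pairing_smooth := fc_pairing_smooth PC.
Let pairingDl := fc_pairingDl PC.
Let pairingZl := fc_pairingZl PC.
Let pairingDr := fc_pairingDr PC.
Let pairingZr := fc_pairingZr PC.

Lemma pairingNr x u v : pairing x u (- v) = - pairing x u v.
Proof. by rewrite -scaleN1r pairingZr mulN1r. Qed.

Lemma form_like_pairing eta : PW eta -> form_like PF PL br (ev eta).
Proof.
move=> pe; split=> [Y pY|Y Z x pY pZ|Y Y' Z x pY pY' pZ].
- exact: pairing_smooth.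
- by rewrite /= (br_anti x pY pZ) pairingNr.
- by rewrite /= (br_jacobi x pY pY' pZ) pairingDr.
Qed.

Definition dform eta Y Z x :=
  der x (Y x) (ev eta Z) - der x (Z x) (ev eta Y) - pairing x (eta x) (br Y Z x).

Lemma dformDr eta Y Z Z' x : PW eta -> PL Y -> PL Z -> PL Z' ->
  dform eta Y (fun q => Z q + Z' q) x = dform eta Y Z x + dform eta Y Z' x.
Proof.
move=> pe pY pZ pZ'; rewrite /dform brDr// pairingDr derD.
have -> : ev eta (fun q => Z q + Z' q) = fun q => ev eta Z q + ev eta Z' q.
  by apply/funext => q; rewrite pairingDr.
by rewrite der_add; [ring|exact: pairing_smooth..].
Qed.

Lemma dformZr f eta Y Z x : PF f -> PW eta -> PL Y -> PL Z ->
  dform eta Y (fun q => f q *: Z q) x = f x * dform eta Y Z x.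
Proof.
move=> pf pe pY pZ; rewrite /dform brZr// pairingDr !pairingZr derZ.
have -> : ev eta (fun q => f q *: Z q) = fun q => f q * ev eta Z q.
  by apply/funext => q; rewrite pairingZr.
by rewrite der_mul//; [ring|exact: pairing_smooth].
Qed.

Lemma form_bracketE Y eta Y' eta' Z x :
  FB Y eta Y' eta' Z x = dform eta' Y Z x + der x (Z x) (ev eta' Y) - dform eta Y' Z x.
Proof. by rewrite /form_bracket /dform; ring. Qed.

Lemma form_bracket_Dr Y eta Y' eta' Y'' eta'' Z x : PW eta -> PW eta' -> PW eta'' ->
  PL Y -> PL Y' -> PL Y'' -> PL Z ->
  FB Y eta (fun q => Y' q + Y'' q) (fun q => eta' q + eta'' q) Z x
  = FB Y eta Y' eta' Z x + FB Y eta Y'' eta'' Z x.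
Proof.
move=> pe pe' pe'' pY pY' pY'' pZ; rewrite /form_bracket brDl// !pairingDr !pairingDl derD.
have -> : ev (fun q => eta' q + eta'' q) Z = fun q => ev eta' Z q + ev eta'' Z q.
  by apply/funext => q; rewrite pairingDl.
have -> : ev eta (fun q => Y' q + Y'' q) = fun q => ev eta Y' q + ev eta Y'' q.
  by apply/funext => q; rewrite pairingDr.
rewrite (der_add x _ (pairing_smooth pe' pZ) (pairing_smooth pe'' pZ)).
rewrite (der_add x _ (pairing_smooth pe pY') (pairing_smooth pe pY'')).
by ring.
Qed.

Lemma form_bracket_Dl Y eta Y' eta' Y'' eta'' Z x : PW eta -> PW eta' -> PW eta'' ->
  PL Y -> PL Y' -> PL Y'' -> PL Z ->
  FB (fun q => Y' q + Y'' q) (fun q => eta' q + eta'' q) Y eta Z x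
  = FB Y' eta' Y eta Z x + FB Y'' eta'' Y eta Z x.
Proof.
move=> pe pe' pe'' pY pY' pY'' pZ; rewrite /form_bracket brDl// !pairingDr !pairingDl derD.
have -> : ev (fun q => eta' q + eta'' q) Z = fun q => ev eta' Z q + ev eta'' Z q.
  by apply/funext => q; rewrite pairingDl.
have -> : ev (fun q => eta' q + eta'' q) Y = fun q => ev eta' Y q + ev eta'' Y q.
  by apply/funext => q; rewrite pairingDl.
rewrite (der_add x _ (pairing_smooth pe' pZ) (pairing_smooth pe'' pZ)).
rewrite (der_add x _ (pairing_smooth pe' pY) (pairing_smooth pe'' pY)).
by ring.
Qed.

Hypothesis PW_scale : forall f eta, PF f -> PW eta -> PW (fun x => f x *: eta x).

Lemma form_bracket_linear_r c Y eta Y' eta' Y'' eta'' Z x :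
  PW eta -> PW eta' -> PW eta'' -> PL Y -> PL Y' -> PL Y'' -> PL Z ->
  FB Y eta (fun q => c *: Y' q + Y'' q) (fun q => c *: eta' q + eta'' q) Z x
  = c * FB Y eta Y' eta' Z x + FB Y eta Y'' eta'' Z x.
Proof.
move=> pe pe' pe'' pY pY' pY'' pZ.
have pcY := PL_scale (PF_cst c) pY'; have pce := PW_scale (PF_cst c) pe'.
rewrite (form_bracket_Dr x pe pce pe'' pY pcY pY'' pZ); congr (_ + _).
rewrite /form_bracket (brZl x (PF_cst c) pY' pZ) der_cst scale0r subr0.
rewrite !pairingZr !pairingZl derZ.
have -> : ev (fun q => c *: eta' q) Z = fun q => c * ev eta' Z q.
  by apply/funext => q; rewrite pairingZl.
have -> : ev eta (fun q => c *: Y' q) = fun q => c * ev eta Y' q.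
  by apply/funext => q; rewrite pairingZr.
rewrite (der_mul x _ (PF_cst c) (pairing_smooth pe' pZ)).
rewrite (der_mul x _ (PF_cst c) (pairing_smooth pe pY')) !der_cst.
by ring.
Qed.

Lemma form_bracket_linear_l c Y eta Y' eta' Y'' eta'' Z x :
  PW eta -> PW eta' -> PW eta'' -> PL Y -> PL Y' -> PL Y'' -> PL Z ->
  FB (fun q => c *: Y' q + Y'' q) (fun q => c *: eta' q + eta'' q) Y eta Z x
  = c * FB Y' eta' Y eta Z x + FB Y'' eta'' Y eta Z x.
Proof.
move=> pe pe' pe'' pY pY' pY'' pZ.
have pcY := PL_scale (PF_cst c) pY'; have pce := PW_scale (PF_cst c) pe'.
rewrite (form_bracket_Dl x pe pce pe'' pY pcY pY'' pZ); congr (_ + _).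
rewrite /form_bracket (brZl x (PF_cst c) pY' pZ) der_cst scale0r subr0.
rewrite !pairingZr !pairingZl derZ.
have -> : ev (fun q => c *: eta' q) Z = fun q => c * ev eta' Z q.
  by apply/funext => q; rewrite pairingZl.
have -> : ev (fun q => c *: eta' q) Y = fun q => c * ev eta' Y q.
  by apply/funext => q; rewrite pairingZl.
rewrite (der_mul x _ (PF_cst c) (pairing_smooth pe' pZ)).
rewrite (der_mul x _ (PF_cst c) (pairing_smooth pe' pY)) !der_cst.
by ring.
Qed.

Lemma form_bracket_Zr f Y eta Y' eta' Z x : PF f -> PW eta -> PW eta' ->
  PL Y -> PL Y' -> PL Z ->
  FB Y eta (fun q => f q *: Y' q) (fun q => f q *: eta' q) Z x
  = der x (Y x) f * pairing x (eta' x) (Z x) + f x * FB Y eta Y' eta' Z x.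
Proof.
move=> pf pe pe' pY pY' pZ; rewrite /form_bracket brZl// pairingDr pairingNr.
rewrite !pairingZr !pairingZl derZ.
have -> : ev (fun q => f q *: eta' q) Z = fun q => f q * ev eta' Z q.
  by apply/funext => q; rewrite pairingZl.
have -> : ev eta (fun q => f q *: Y' q) = fun q => f q * ev eta Y' q.
  by apply/funext => q; rewrite pairingZr.
rewrite (der_mul x _ pf (pairing_smooth pe' pZ)) (der_mul x _ pf (pairing_smooth pe pY')).
by ring.
Qed.

Lemma form_bracket_diag Y eta Z x : FB Y eta Y eta Z x = der x (Z x) (ev eta Y).
Proof. by rewrite /form_bracket; ring. Qed.

Lemma form_bracket_metric Y eta Y' eta' x : PL Y -> PL Y' ->
  FB Y eta Y' eta' Y' x + pairing x (eta' x) (br Y Y' x) = der x (Y x) (ev eta' Y').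
Proof.
move=> pY pY'; rewrite /form_bracket.
have -> : pairing x (eta x) (br Y' Y' x) = 0.
  by rewrite (br_diag x pY') -(scale0r (0 : V)) pairingZr mul0r.
by ring.
Qed.

End BracketOfFields.

(** * Fields and forms of type (0,1) *)

Section DirectSum.
Context (R : realType) (X : topologicalType) (n : nat) (M : charts R X n).
Context (hM : complex_manifold M).
Notation smooth := (smooth M).
Notation Sec U s := (section_on (Defs.smooth M) U s).
Context (E1 E2 : bundle R X).
Context (b1 : vector_bundle (Defs.smooth M) E1) (b2 : vector_bundle (Defs.smooth M) E2).

Lemma dsum_section U (s : section (dsum_bundle E1 E2)) : open U ->
  Sec U s <-> Sec U (fun x => (s x).1) /\ Sec U (fun x => (s x).2).
Proof.
move=> oU; split=> [ss|[s1 s2]].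
  split=> j k; apply: (smooth_local hM) => x [Ux jx].
    have [j2 j2x] := tdom_cover b2 x; exists (U `&` (tdom j `&` tdom j2)).
    have o : open (U `&` (tdom j `&` tdom j2)).
      by apply: openI => //; apply: openI; [exact: (tdom_open b1)|exact: (tdom_open b2)].
    split=> //; apply: (smooth_ext hM o) (ss (j, j2) (lshift _ k)) => y _ /=.
    by rewrite row_mxEl.
  have [j1 j1x] := tdom_cover b1 x; exists (U `&` (tdom j1 `&` tdom j)).
  have o : open (U `&` (tdom j1 `&` tdom j)).
    by apply: openI => //; apply: openI; [exact: (tdom_open b1)|exact: (tdom_open b2)].
  split=> //; apply: (smooth_ext hM o) (ss (j1, j) (rshift _ k)) => y _ /=.
  by rewrite row_mxEr.
move=> [j1 j2] k; have o : open (U `&` (tdom j1 `&` tdom j2)).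
  by apply: openI => //; apply: openI; [exact: (tdom_open b1)|exact: (tdom_open b2)].
rewrite -(fintype.splitK k); case: (fintype.split k) => i /=.
  apply: (smooth_ext hM o) (smooth_sub _ (s1 j1 i)) => [y _|y [Uy [jy _]]//].
  by rewrite row_mxEl.
apply: (smooth_ext hM o) (smooth_sub _ (s2 j2 i)) => [y _|y [Uy [_ jy]]//].
by rewrite row_mxEr.
Qed.

Lemma dsum_vector_bundle : vector_bundle (Defs.smooth M) (dsum_bundle E1 E2).
Proof.
split=> /=.
- by move=> [j1 j2]; apply: openI; [exact: (tdom_open b1)|exact: (tdom_open b2)].
- move=> x; have [j1 j1x] := tdom_cover b1 x; have [j2 j2x] := tdom_cover b2 x.
  by exists (j1, j2).
- move=> [j1 j2] x c u v [/= j1x j2x].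
  by rewrite (triv_linear b1)// (triv_linear b2)// scale_row_mx add_row_mx.
- move=> [j1 j2] x [u1 u2] [/= j1x j2x].
  by rewrite row_mxKl row_mxKr (trivK b1)// (trivK b2).
- move=> [j1 j2] x w [/= j1x j2x].
  by rewrite (trivVK b1)// (trivVK b2)// hsubmxK.
- move=> [j1 j2] [j1' j2']; rewrite /= => w k.
  set U := _ `&` _; have oU : open U.
    by apply: openI; apply: openI; [exact: (tdom_open b1)|exact: (tdom_open b2)|
      exact: (tdom_open b1)|exact: (tdom_open b2)].
  rewrite -(fintype.splitK k); case: (fintype.split k) => i /=.
    apply: (smooth_ext hM oU) (smooth_sub _ (triv_transition b1 (lsubmx w) i)).
      by move=> y _; rewrite row_mxEl.
    by move=> y [[? ?] [? ?]].
  apply: (smooth_ext hM oU) (smooth_sub _ (triv_transition b2 (rsubmx w) i)).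
    by move=> y _; rewrite row_mxEr.
  by move=> y [[? ?] [? ?]].
Qed.

End DirectSum.

Section StandardCourant.
Context (R : realType) (X : topologicalType) (n : nat) (M : charts R X n).
Context (hM : complex_manifold M).
Notation smooth := (smooth M).
Notation Sec U s := (section_on (Defs.smooth M) U s).
Notation Gamma s := (section_on (Defs.smooth M) [set: X] s).
Notation T := (T01 M).
Notation Td := (T01dual M).
Notation bT := (T01_bundle hM).
Notation bTd := (T01dual_bundle hM).
Notation act Y f := (act01 (M := M) Y f).
Notation lie Y Z := (lie01 (M := M) Y Z).
Notation pr eta Y := (fun x => pair (eta x) (Y x)).
Notation funx := functional_extensionality_dep.
Implicit Types (U : set X) (f g : X -> R[i]) (Y Z : section T) (eta : section Td)
  (x p q : X).

Lemma T01_vsmooth U Y : open U -> Sec U Y <-> vsmooth M U (fun q => emb01 (Y q)).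
Proof.
move=> oU; split=> sY a k; have o := openI oU (dom_open hM a).
  apply: (smooth_ext hM o) (smooth_sum hM (index_enum 'I_n) predT o
    (fun l => smooth_mul hM o (sY a l) (smooth_sub _
      (smooth_dzb hM a l (dom_open hM a) (smooth_xycoord hM a k))))).
    move=> q [Uq aq]; rewrite /vact.
    rewrite (tact_zbchart hM _ (dom_open hM a) (smooth_xycoord hM a k) aq aq).
    by apply: eq_bigr => l _; rewrite mxE.
  by move=> l q [Uq aq].
apply: (smooth_ext hM o) (vact_smooth hM o (vsmooth_sub _ sY)
  (smooth_sub _ (smooth_zbcoord hM a k))) => [q _||].
- by rewrite mxE.
- by move=> q [].
- by move=> q [].
Qed.

Lemma act01_smooth Y f : Gamma Y -> smooth [set: X] f -> smooth [set: X] (act Y f).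
Proof.
by move=> /(T01_vsmooth _ openT) gY sf; exact: (vact_smooth hM openT gY sf).
Qed.

(** The bracket of two fields that kill the holomorphic coordinates kills them
    too: T^{0,1} is involutive. *)
Lemma emb01_lie01 Y Z x : Gamma Y -> Gamma Z -> emb01 (lie Y Z x)
  = Defs.lie M (fun q => emb01 (Y q)) (fun q => emb01 (Z q)) x.
Proof.
move=> /(T01_vsmooth _ openT) gY /(T01_vsmooth _ openT) gZ.
rewrite /lie01 -(type01P hM (p := x))// => k; set a := chart_at M x.
have oa := dom_open hM a; have ax := at_dom hM x.
rewrite (lie_act hM oa (vsmooth_sub (@subsetT _ _) gY) (vsmooth_sub (@subsetT _ _) gZ)
  (smooth_zcoord hM a k) ax).
have z W q : chart_dom a q -> vact M (fun q => emb01 (W q : 'rV[R[i]]_n)) (zcoord a k) q = 0.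
  by move=> aq; exact: (emb01_zcoord hM).
rewrite /vact (tact_eq hM oa ax _ (g := fun=> 0)) => [|q aq]; last exact: (z Z).
rewrite [X in _ - X](tact_eq hM oa ax _ (g := fun=> 0)) => [|q aq]; last exact: (z Y).
by rewrite !(tact_cst) subrr.
Qed.

Lemma lie01_act Y Z f x : Gamma Y -> Gamma Z -> smooth [set: X] f ->
  act (lie Y Z) f x = act Y (act Z f) x - act Z (act Y f) x.
Proof.
move=> gY gZ sf; rewrite {1}/act01 /vact emb01_lie01//.
move: gY gZ => /(T01_vsmooth _ openT) gY /(T01_vsmooth _ openT) gZ.
exact: (lie_act hM openT gY gZ sf).
Qed.

Lemma lie01_tact Y Z f x : Gamma Y -> Gamma Z -> smooth [set: X] f ->
  tact M x (emb01 (lie Y Z x)) f = act Y (act Z f) x - act Z (act Y f) x.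
Proof. exact: lie01_act. Qed.

Lemma lie01_smooth Y Z : Gamma Y -> Gamma Z -> Gamma (lie Y Z).
Proof.
move=> gY gZ; apply/(T01_vsmooth _ openT).
rewrite (_ : (fun q => _) =
    Defs.lie M (fun q => emb01 (Y q)) (fun q => emb01 (Z q))); last first.
  by apply: funx => q; exact: emb01_lie01.
by apply: (lie_smooth hM openT); apply/(T01_vsmooth _ openT).
Qed.

Lemma field_calculus_T01 :
  field_calculus (smooth [set: X]) (fun Y : section T => Gamma Y)
    (fun x (w : 'rV[R[i]]_n) f => tact M x (emb01 w) f) (lie01 (M := M)).
Proof.
split.
- exact: act01_smooth.
- by move=> c; exact: (smooth_cst hM _ openT).
- by move=> x u c; exact: tact_cst.
- by move=> Y Z gY gZ; exact: (section_add hM bT openT gY gZ).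
- by move=> f Y sf gY; exact: (section_scale hM bT openT sf gY).
- exact: lie01_smooth.
- by move=> x u v f; rewrite emb01D tactDl.
- by move=> x c u f; rewrite emb01Z tactZ.
- by move=> x u f g sf sg; exact: (tact_add hM I _ sf sg).
- by move=> x u f g sf sg; exact: (tact_sub hM openT I _ sf sg).
- by move=> x u f g sf sg; exact: (tact_mul hM I _ sf sg).
- by move=> x u v; exact: (emb01_ext hM).
- by move=> Y Z f x gY gZ sf; exact: lie01_act.
Qed.
Notation FC := field_calculus_T01.

Lemma pair_smooth U eta Y : open U -> Sec U eta -> Sec U Y -> smooth U (pr eta Y).
Proof.
move=> oU se sY; apply: (smooth_local hM) => p Up; set a := chart_at M p.
have o := openI oU (dom_open hM a); exists (U `&` chart_dom a).
split => //; first by split => //; exact: (at_dom hM).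
apply: (smooth_ext hM o) (smooth_sum hM (index_enum 'I_n) predT o
  (fun k => smooth_mul hM o (se a k) (sY a k))) => q [Uq aq].
by rewrite (pair_chart hM _ _ aq).
Qed.

(** The components of eta in a chart are its values on coordinate fields, which
    coincide near any point with global fields. *)
Lemma dual_smooth eta : (forall Y, Gamma Y -> smooth [set: X] (pr eta Y)) -> Gamma eta.
Proof.
move=> H a k; apply: (smooth_local hM) => p [_ ap].
have [chi [V cV]] := exists_cutoff hM (dom_open hM a) ap.
have oV := cutoff_open cV.
exists V; split => //; first exact: (cutoff_at cV).
pose W : section T := coord_vf01 a k.
have gW : Sec (chart_dom a) W := frame_smooth bT (j := a) k.
have gY := cutoff_section cV bT gW; set Y := (Y in Gamma Y) in gY.
apply: (smooth_ext hM oV) (smooth_sub (@subsetT _ V) (H Y gY)) => q Vq.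
rewrite [RHS]trdE; congr pair.
by rewrite /Y (cutoff1 cV Vq) scale1r.
Qed.

Lemma dual_ext x (eta eta' : Td x) :
  (forall Z, Gamma Z -> pair eta (Z x) = pair eta' (Z x)) -> eta = eta'.
Proof.
move=> H; apply/rowP => k; rewrite -!pair_delta.
by have [Z [gZ <-]] := exists_section hM bT (delta_mx 0 k : T x); exact: H.
Qed.

Lemma form_calculus_T01 :
  form_calculus (smooth [set: X]) (fun Y : section T => Gamma Y)
    (fun eta : section Td => Gamma eta)
    (fun _ (u : 'rV[R[i]]_n) (v : 'rV[R[i]]_n) => pair u v).
Proof.
split.
- by move=> eta Y ge gY; exact: (pair_smooth openT ge gY).
- by move=> x u u' v; exact: (pairDl (m := n) u u' v).
- by move=> x c u v; exact: (pairZl (m := n) c u v).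
- by move=> x u v v'; exact: (pairDr (m := n) u v v').
- by move=> x c u v; exact: (pairZr (m := n) c u v).
Qed.
Notation PC := form_calculus_T01.

Lemma pair_dbar0 f w x : smooth [set: X] f ->
  pair (dbar0 M f x) w = tact M x (emb01 w) f.
Proof.
move=> sf; rewrite tact_emb01 /pair; apply: eq_bigr => k _; rewrite mulrC mxE.
by congr (_ * _); exact: (tact_coord_vf01 hM _ openT sf I (at_dom hM x)).
Qed.

(** iota_dbar is defined on coordinate fields; being tensorial it computes the
    contraction with every field. *)
Lemma pair_iota_dbar Y eta Z x : Gamma Y -> Gamma eta -> Gamma Z ->
  pair (iota_dbar Y eta x) (Z x) = dbar1 eta Y Z x.
Proof.
move=> gY ge gZ; pose D Z := dbar1 eta Y Z x.
have TD : tensorial M x D.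
  split=> [Z1 Z2 g1 g2|f Z1 sf g1].
    exact: (dformDr FC PC x ge gY g1 g2).
  exact: (dformZr FC PC x sf ge gY g1).
pose a := chart_at M x; have ax : tdom (b := T) a x := at_dom hM x.
have [chi [V [cV exp]]] := tensorial_expansion hM bT ax.
apply: (etrans _ (esym (exp D Z TD gZ))); apply: eq_bigr => k _.
rewrite mulrC; congr (_ * _).
  by rewrite mxE (tact_zbcoord_at hM) pr01K.
have oV := cutoff_open cV; have Vx := cutoff_at cV.
have E q : V q -> coord_vf01 a k q = chi q *: frame (E := T) (j := a) k q.
  by move=> Vq; rewrite (cutoff1 cV)// scale1r.
pose W : section T := fun q => chi q *: frame (E := T) (j := a) k q.
have F1 : act Y (pr eta (coord_vf01 a k)) x = act Y (pr eta W) x.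
  by apply: (tact_eq hM oV Vx) => q Vq; rewrite (E q Vq).
have F2 : act (coord_vf01 a k) (pr eta Y) x = act W (pr eta Y) x.
  by rewrite /act01 /vact (E x Vx).
have F3 : pair (eta x) (lie Y (coord_vf01 a k) x) = pair (eta x) (lie Y W x).
  have e q : V q -> emb01 (coord_vf01 a k q) = emb01 (W q).
    by move=> Vq; rewrite (E q Vq).
  exact: (congr1 (fun v => pair (eta x) (pr01 v))
    (lie_eq hM oV Vx (fun q _ => erefl (emb01 (Y q))) e)).
rewrite [LHS]mxE.
exact: (f_equal2 (fun u v => u - v) (f_equal2 (fun u v => u - v) F1 F2) F3).
Qed.

End StandardCourant.

(** * The standard Courant algebroid of the antiholomorphic tangent bundle *)

Section StandardCourantAlgebroid.
Context (R : realType) (X : topologicalType) (n : nat) (M : charts R X n).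
Context (hM : complex_manifold M).
Notation smooth := (smooth M).
Notation Sec U s := (section_on (Defs.smooth M) U s).
Notation Gamma s := (section_on (Defs.smooth M) [set: X] s).
Notation T := (T01 M).
Notation Td := (T01dual M).
Notation bT := (T01_bundle hM).
Notation bTd := (T01dual_bundle hM).
Notation A := (C01 M).
Notation act Y f := (act01 (M := M) Y f).
Notation lie Y Z := (lie01 (M := M) Y Z).
Notation pr eta Y := (fun x => pair (eta x) (Y x)).
Notation funx := functional_extensionality_dep.
Notation FC := (field_calculus_T01 hM).
Notation PC := (form_calculus_T01 hM).
Notation FB Y eta Y' eta' Z x :=
  (form_bracket (fun (U : X -> 'rV[R[i]]_n) (h : X -> R[i]) (q : X) =>
     tact M q (emb01 (U q)) h)
    (lie01 (M := M)) Y (fun (U : X -> 'rV[R[i]]_n) (q : X) => pair (eta q) (U q)) Y'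
    (fun (U : X -> 'rV[R[i]]_n) (q : X) => pair (eta' q) (U q)) Z x).
Notation fst_s b := (fun x => (b x).1).
Notation snd_s b := (fun x => (b x).2).
Implicit Types (U : set X) (f g : X -> R[i]) (Y Z : section T) (eta : section Td)
  (x p q : X) (b : section A).

Lemma C01_section U b : open U ->
  Sec U b <-> Sec U (fst_s b : section T) /\ Sec U (snd_s b : section Td).
Proof. exact: (dsum_section hM bT bTd). Qed.

Lemma C01_ext x (u v : A x) : u.1 = v.1 ->
  (forall Z, Gamma Z -> pair u.2 (Z x) = pair v.2 (Z x)) -> u = v.
Proof.
move: u v => [u1 u2] [v1 v2] /= -> e; congr (_, _).
exact: (dual_ext hM e).
Qed.

Lemma C01_inner_ext x (u v : A x) :
  (forall w : A x, cinner (c := A) u w = cinner (c := A) v w) -> u = v.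
Proof.
move: u v => [u1 u2] [v1 v2] e; congr (_, _); apply/rowP => k.
  have := e (0, delta_mx 0 k); rewrite /= -!(pair_delta (m := n)).
  have z (w : 'rV[R[i]]_n) : pair w 0 = 0.
    by rewrite -(scale0r (0 : 'rV[R[i]]_n)) pairZr mul0r.
  have c (w w' : 'rV[R[i]]_n) : pair w w' = pair w' w.
    by rewrite /pair; apply: eq_bigr => j _; rewrite mulrC.
  by rewrite !z !add0r !(c (delta_mx 0 k)).
have := e (delta_mx 0 k, 0); rewrite /= !pair_delta.
have z (w : 'rV[R[i]]_n) : pair 0 w = 0.
  by rewrite -(scale0r (0 : 'rV[R[i]]_n)) pairZl mul0r.
by rewrite !z !addr0.
Qed.

Lemma calD_C01 f x : smooth [set: X] f ->
  calD M (@cinner _ _ _ A) (@canchor _ _ _ A) f x = (0, dbar0 M f x).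
Proof.
move=> sf; have H (v : A x) : cinner (c := A) ((0, dbar0 M f x) : A x) v
    = tact M x (canchor v) f.
  rewrite /= (pair_dbar0 hM _ _ sf) -(scale0r (0 : 'rV[R[i]]_n)) pairZr mul0r.
  exact: addr0.
rewrite /calD.
case: (xgetP 0 [set u : A x | forall v : A x, cinner u v = tact M x (canchor v) f])
  => [y _ yP|]; last by move=> /(_ (0, dbar0 M f x) H).
by apply: C01_inner_ext => v; rewrite H; exact: yP.
Qed.

(** The components iota_dbar and dbar0 of the bracket, paired with a field,
    combine into the Cartan formula; the axioms can then be checked in the
    algebraic calculus. *)
Lemma C01_bracket_form b b' Z x : Gamma b -> Gamma b' -> Gamma Z ->
  pair (cdorf b b' x).2 (Z x)
  = FB (fst_s b) (snd_s b) (fst_s b') (snd_s b') Z x.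
Proof.
move=> /(C01_section _ openT)[gY ge] /(C01_section _ openT)[gY' ge'] gZ.
have sf := pair_smooth hM openT ge' gY.
have i1 := pair_iota_dbar hM x gY ge' gZ.
have i2 := pair_iota_dbar hM x gY' ge gZ.
have d1 := pair_dbar0 hM (Z x) x sf.
have := f_equal2 (fun u v => u - v) (f_equal2 +%R i1 d1) i2.
move=> e; apply: (etrans (etrans _ e)).
  rewrite -pairNl -!pairDl //.
symmetry; exact: (form_bracketE (fun q (w : 'rV[R[i]]_n) h => tact M q (emb01 w) h)
  (lie01 (M := M)) (fun _ (u : 'rV[R[i]]_n) v => pair u v)).
Qed.

Lemma C01_bracket_smooth b b' : Gamma b -> Gamma b' -> Gamma (cdorf b b').
Proof.
move=> gb gb'; apply/(C01_section _ openT).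
have [gY ge] := proj1 (C01_section b openT) gb.
have [gY' ge'] := proj1 (C01_section b' openT) gb'.
split; first exact: (lie01_smooth hM gY gY').
apply: (dual_smooth hM) => Z gZ.
have s : smooth [set: X] (form_bracket (fun (U : X -> 'rV[R[i]]_n) (h : X -> R[i]) (q : X) =>
     tact M q (emb01 (U q)) h)
    (lie01 (M := M)) (fst_s b) (fun (U : X -> 'rV[R[i]]_n) (q : X) => pair ((b q).2) (U q))
    (fst_s b') (fun (U : X -> 'rV[R[i]]_n) (q : X) => pair ((b' q).2) (U q)) Z).
  have sub f g : smooth [set: X] f -> smooth [set: X] g ->
      smooth [set: X] (fun x => f x - g x).
    by move=> sf sg; exact: (smooth_add hM openT sf (smooth_opp hM openT sg)).
  have add f g : smooth [set: X] f -> smooth [set: X] g ->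
      smooth [set: X] (fun x => f x + g x).
    exact: (smooth_add hM openT).
  exact: (form_bracket_smooth add sub (act01_smooth hM) (lie01_smooth hM) gY gY' gZ
    (form_like_pairing FC PC ge) (form_like_pairing FC PC ge')).
apply: (smooth_ext hM openT) s => x _.
exact: (esym (C01_bracket_form x gb gb' gZ)).
Qed.

Lemma C01_metric : fibre_metric (@cinner _ _ _ A).
Proof.
move=> x; split=> [c u v w|u v|u u0].
- rewrite /= (pair_linearl (m := n)) (pair_linearr (m := n)); ring.
- exact: addrC.
- apply: C01_inner_ext => w; rewrite u0 /=.
  rewrite -(scale0r (0 : 'rV[R[i]]_n)) (pairZl (m := n)) (pairZr (m := n)).
  by rewrite !mul0r addr0.
Qed.

Lemma C01_inner_smooth U b b' : open U -> Sec U b -> Sec U b' ->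
  smooth U (fun x => cinner (b x) (b' x)).
Proof.
move=> oU /(C01_section _ oU)[gY ge] /(C01_section _ oU)[gY' ge'].
exact: (smooth_add hM oU (pair_smooth hM oU ge gY') (pair_smooth hM oU ge' gY)).
Qed.

Let C01_linear c b b' : Gamma b -> Gamma b' -> Gamma (fun x => c *: b x + b' x).
Proof.
move=> gb gb'; have bA := dsum_vector_bundle hM bT bTd.
exact: (section_add hM bA openT (section_cscale hM bA c openT gb) gb').
Qed.

Let dual_scale f eta : smooth [set: X] f -> Gamma eta -> Gamma (fun x => f x *: eta x).
Proof. by move=> sf ge; exact: (section_scale hM bTd openT sf ge). Qed.

Let ffb b b' (U : section T) (x : X) : R[i] :=
  FB (fst_s b) (snd_s b) (fst_s b') (snd_s b') U x.

(** Each axiom is an identity between fields and an identity between forms; the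
    latter is tested on an arbitrary field Z of type (0,1). *)
Lemma C01_dorfman : dorfman_axioms M (@cinner _ _ _ A) (@canchor _ _ _ A)
  (@cdorf _ _ _ A) [set: X] (smooth [set: X]) (section_on smooth [set: X]).
Proof.
have SP b : Gamma b -> Gamma (fst_s b : section T) /\ Gamma (snd_s b : section Td).
  exact: (proj1 (C01_section b openT)).
split.
- move=> c b b' b'' gb gb' gb'' x _.
  have [gY ge] := SP _ gb; have [gY' ge'] := SP _ gb'; have [gY'' ge''] := SP _ gb''.
  apply: C01_ext => [|Z gZ]; first exact: (br_linear_l FC c x gY gY' gY'').
  apply: (etrans (C01_bracket_form x (C01_linear c gb gb') gb'' gZ)).
  apply: (etrans (form_bracket_linear_l FC PC dual_scale c x ge'' ge ge' gY'' gY gY' gZ)).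
  apply: (etrans _ (esym (pair_linearl (m := n) c _ _ _))).
  by rewrite -(C01_bracket_form x gb gb'' gZ) -(C01_bracket_form x gb' gb'' gZ).
- move=> c b b' b'' gb gb' gb'' x _.
  have [gY ge] := SP _ gb; have [gY' ge'] := SP _ gb'; have [gY'' ge''] := SP _ gb''.
  apply: C01_ext => [|Z gZ]; first exact: (br_linear_r FC c x gY gY' gY'').
  apply: (etrans (C01_bracket_form x gb (C01_linear c gb' gb'') gZ)).
  apply: (etrans (form_bracket_linear_r FC PC dual_scale c x ge ge' ge'' gY gY' gY'' gZ)).
  apply: (etrans _ (esym (pair_linearl (m := n) c _ _ _))).
  by rewrite -(C01_bracket_form x gb gb' gZ) -(C01_bracket_form x gb gb'' gZ).
- move=> b1 b2 b3 g1 g2 g3 x _.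
  have [gY1 ge1] := SP _ g1; have [gY2 ge2] := SP _ g2; have [gY3 ge3] := SP _ g3.
  have g23 := C01_bracket_smooth g2 g3; have g12 := C01_bracket_smooth g1 g2.
  have g13 := C01_bracket_smooth g1 g3.
  apply: C01_ext => [|Z gZ]; first exact: (br_jacobi FC x gY1 gY2 gY3).
  apply: (etrans (C01_bracket_form x g1 g23 gZ)).
  apply: (etrans _ (esym (pairDl (m := n) _ _ _))).
  have form_eq b b' : Gamma b -> Gamma b' -> forall U : section T, Gamma U ->
      (fun q => pair (cdorf b b' q).2 (U q)) = ffb b b' U.
    by move=> gb gb' U gU; apply: funx => q; exact: C01_bracket_form.
  have e12 := form_eq _ _ g1 g2; have e13 := form_eq _ _ g1 g3.
  have e23 := form_eq _ _ g2 g3.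
  have F1 := form_like_pairing FC PC ge1; have F2 := form_like_pairing FC PC ge2.
  have F3 := form_like_pairing FC PC ge3.
  have brG := lie01_smooth hM.
  have act_additive (Y : section T) : Gamma Y ->
      additive_action (smooth [set: X]) (fun f q => tact M q (emb01 (Y q)) f).
    move=> _; split=> f g q sf sg; first exact: (tact_add hM I _ sf sg).
    exact: (tact_sub hM openT I _ sf sg).
  have add f g : smooth [set: X] f -> smooth [set: X] g ->
      smooth [set: X] (fun x => f x + g x).
    exact: (smooth_add hM openT).
  have sub f g : smooth [set: X] f -> smooth [set: X] g ->
      smooth [set: X] (fun x => f x - g x).
    by move=> sf sg; exact: (smooth_add hM openT sf (smooth_opp hM openT sg)).
  have J := form_bracket_jacobi add sub (act01_smooth hM) brG act_additive
    (lie01_tact (M := M) hM) x gY1 gY2 gY3 gZ F1 F2 F3.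
  have L := form_bracket_eq (fun (U : section T) (h : X -> R[i]) (q : X) =>
     tact M q (emb01 (U q)) h) brG x gY1 (brG _ _ gY2 gY3) gZ
    (fun W _ => erefl (fun q => pair (b1 q).2 (W q))) e23.
  have R1 := form_bracket_eq (fun (U : section T) (h : X -> R[i]) (q : X) =>
     tact M q (emb01 (U q)) h) brG x (brG _ _ gY1 gY2) gY3 gZ
    e12 (fun W _ => erefl (fun q => pair (b3 q).2 (W q))).
  have R2 := form_bracket_eq (fun (U : section T) (h : X -> R[i]) (q : X) =>
     tact M q (emb01 (U q)) h) brG x gY2 (brG _ _ gY1 gY3) gZ
    (fun W _ => erefl (fun q => pair (b2 q).2 (W q))) e13.
  apply: (etrans L); apply: (etrans J); symmetry; apply: (f_equal2 +%R).
    exact: (etrans (C01_bracket_form x g12 g3 gZ) R1).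
  exact: (etrans (C01_bracket_form x g2 g13 gZ) R2).
- move=> f b b' sf gb gb' x _.
  have [gY ge] := SP _ gb; have [gY' ge'] := SP _ gb'.
  apply: C01_ext => [|Z gZ]; first exact: (brZr FC x sf gY gY').
  have gfb := section_scale hM (dsum_vector_bundle hM bT bTd) openT sf gb'.
  apply: (etrans (C01_bracket_form x gb gfb gZ)).
  apply: (etrans (form_bracket_Zr FC PC x sf ge ge' gY gY' gZ)).
  apply: (etrans _ (esym (pair_linearl (m := n) _ _ _ _))).
  by rewrite (pairZl (m := n)) -(C01_bracket_form x gb gb' gZ).
- move=> b gb x _; have [gY ge] := SP _ gb.
  have sp := pair_smooth hM openT ge gY.
  have s2 := smooth_add hM openT sp sp.
  rewrite (calD_C01 x s2); apply: C01_ext => [|Z gZ].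
    by apply: (etrans (br_diag FC x gY)); rewrite /= scaler0.
  apply: (etrans (C01_bracket_form x gb gb gZ)).
  apply: (etrans (form_bracket_diag (fun q (w : 'rV[R[i]]_n) h => tact M q (emb01 w) h)
    (lie01 (M := M)) (fun _ (u v : 'rV[R[i]]_n) => pair u v) _ _ _ _)).
  rewrite /= (pairZl (m := n)) (pair_dbar0 hM _ _ s2) (tact_add hM I _ sp sp).
  by rewrite mulrDr -mulrDl halfD mul1r.
- move=> b b' gb gb' x _; have [gY ge] := SP _ gb; have [gY' ge'] := SP _ gb'.
  have sp := pair_smooth hM openT ge' gY'.
  apply: (etrans (tact_add hM I _ sp sp)).
  have e2 (z : R[i]) : z + z = 2 * z by rewrite -mulr2n mulr_natl.
  apply: (etrans (e2 _)); apply: (congr1 (fun z => 2 * z)).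
  symmetry; apply: (etrans _ (form_bracket_metric FC PC (snd_s b) (snd_s b') x gY gY')).
  by congr (_ + _); exact: (C01_bracket_form x gb gb' gY').
Qed.

Lemma C01_courant : courant_algebroid M A.
Proof.
split.
- exact: (dsum_vector_bundle hM bT bTd).
- exact: C01_metric.
- exact: C01_inner_smooth.
- by move=> x c u v; exact: emb01_linear.
- move=> U b oU /(C01_section _ oU)[gY _].
  exact: (proj1 (T01_vsmooth hM _ oU) gY).
- exact: C01_bracket_smooth.
- exact: C01_dorfman.
Qed.

End StandardCourantAlgebroid.

(** * Lie derivatives along fields of type (1,0) *)

Section LieDerivative.
Context (R : realType) (X : topologicalType) (n : nat) (M : charts R X n).
Context (hM : complex_manifold M).
Notation vfield := (X -> 'rV[R[i]]_(n + n)).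
Notation smooth := (smooth M).
Notation vsmooth := (vsmooth M).
Notation tact := (tact M).
Notation vact := (vact M).
Notation Sec U s := (section_on (Defs.smooth M) U s).
Notation Gamma s := (section_on (Defs.smooth M) [set: X] s).
Notation T := (T01 M).
Notation Td := (T01dual M).
Notation bT := (T01_bundle hM).
Notation bTd := (T01dual_bundle hM).
Implicit Types (U : set X) (f g : X -> R[i]) (Y Z : section T) (eta : section Td)
  (x p q : X) (a : chart_idx M).

Section Bracket.
Context (U : set X) (oU : open U) (p : X) (Up : U p) (V W W' : vfield).
Context (sV : vsmooth U V) (sW : vsmooth U W) (sW' : vsmooth U W').

Lemma lie_linearr c :
  Defs.lie M V (fun q => c *: W q + W' q) p = c *: Defs.lie M V W p + Defs.lie M V W' p.
Proof.
apply: (tact_ext hM (p := p)) => f /(smooth_sub (@subsetT _ U)) sf.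
have sWW : vsmooth U (fun q => c *: W q + W' q).
  exact: (vsmooth_linear hM oU (smooth_cst hM c oU) sW sW').
have sWf := vact_smooth hM oU sW sf; have sWf' := vact_smooth hM oU sW' sf.
have scW := smooth_mul hM oU (smooth_cst hM c oU) sWf.
rewrite tact_linear (lie_act hM oU sV sWW sf Up) (lie_act hM oU sV sW sf Up).
rewrite (lie_act hM oU sV sW' sf Up).
rewrite [X in _ - X](_ : _ = c * vact W (vact V f) p + vact W' (vact V f) p); last first.
  exact: tact_linear.
rewrite [X in X - _](_ : _ = c * vact V (vact W f) p + vact V (vact W' f) p); last first.
  apply: (etrans (tact_eq hM oU Up _ (g := fun q => c * vact W f q + vact W' f q) _)).
    by move=> q _; exact: tact_linear.
  by rewrite (tact_add hM Up _ scW sWf') (tact_scale hM oU Up _ c sWf).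
ring.
Qed.

End Bracket.

Lemma lie_0r V p : Defs.lie M V (fun=> 0) p = 0.
Proof.
apply/rowP => k; rewrite [LHS]mxE mx0E; set f := xycoord _ _.
rewrite [X in _ - X](_ : _ = 0); last exact: tact0.
rewrite [X in X - _](_ : _ = 0) ?subr0//.
apply: (etrans (tact_eq hM openT I _ (g := fun=> 0) _)) => [q _|].
  exact: tact0.
exact: tact_cst.
Qed.

(** The part of type (1,0) kills the zbar_k. *)
Lemma tact_pr01 a k p v : chart_dom a p ->
  tact p (emb01 (pr01 v)) (zbcoord a k) = tact p v (zbcoord a k).
Proof.
by move=> ap; rewrite [in RHS](split01 v) tactDl (emb10_zbcoord hM) ?addr0.
Qed.

Lemma triv01E a p (w : T p) k : triv (b := T) a w 0 k = tact p (emb01 w) (zbcoord a k).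
Proof. by rewrite mxE. Qed.

Lemma pr01_section U (W : vfield) : open U -> vsmooth U W ->
  Sec U ((fun q => pr01 (W q)) : section T).
Proof.
move=> oU sW a k; have o := openI oU (dom_open hM a).
apply: (smooth_ext hM o) (vact_smooth hM o (vsmooth_sub _ sW)
  (smooth_sub _ (smooth_zbcoord hM a k))) => [q [_ aq]||].
- by rewrite triv01E tact_pr01.
- by move=> q [].
- by move=> q [].
Qed.

Lemma coord_vf_vsmooth a k : vsmooth (chart_dom a) (coord_vf a k).
Proof.
move=> b l; have o := openI (dom_open hM a) (dom_open hM b).
have s := smooth_dxy hM a k (dom_open hM b) (smooth_xycoord hM b l).
have o' := openI (dom_open hM b) (dom_open hM a).
apply: (smooth_ext hM o) (smooth_sub _ s) => [q [aq bq]|q []//].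
exact: (esym (tact_coord_vf hM k (dom_open hM b) (smooth_xycoord hM b l) bq aq)).
Qed.

Lemma pair_emb01d (eta : 'rV[R[i]]_n) v : pair (emb01d eta) v = pair eta (pr01 v).
Proof.
rewrite /pair big_split_ord /= -big_split; apply: eq_bigr => k _ /=.
rewrite [X in _ = _ * X]pr01E /emb01d row_mxEl row_mxEr mxZE; ring.
Qed.

Let half_split (v w : 'rV[R[i]]_(n + n)) :
  2^-1 *: (v + 'i *: w) = 2^-1 *: v + ((2^-1 * 'i) *: w + 0).
Proof. by rewrite scalerDr scalerA addr0. Qed.

Let pr01_half (v w : 'rV[R[i]]_(n + n)) :
  pr01 (2^-1 *: v + ((2^-1 * 'i) *: w + 0))
  = 2^-1 *: pr01 v + (2^-1 * 'i) *: pr01 w.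
Proof. by rewrite addr0 pr01D !pr01Z. Qed.

Let half_combine (u v w z : R[i]) : 2^-1 * ((u - w) + 'i * (v - z))
  = (2^-1 * u + 2^-1 * 'i * v) - (2^-1 * w + 2^-1 * 'i * z).
Proof. ring. Qed.

Let diff_scale (a b c d f : R[i]) : (a * b + f * c) - (a * b + f * d) = f * (c - d).
Proof. ring. Qed.

(** The two components of the connection nabla_left, for a field V in place of
    the anchor of a section. *)
Definition lieT (V : vfield) Y : section T :=
  fun x => pr01 (Defs.lie M V (fun q => emb01 (Y q)) x).
Definition lieTd (V : vfield) eta : section Td :=
  fun x => pr01d (lie_form M V (fun q => emb01d (eta q)) x).

Section TypeOneZero.
Context (V : vfield) (sV : vsmooth [set: X] V) (V10 : forall q, pr01 (V q) = 0).
Notation pr eta Y := (fun x => pair (eta x) (Y x)).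

(** In a chart, V kills the zbar_k and [V, Y] has the components V[Y[zbar_k]]:
    the derivative acts componentwise, as the Lie derivative along V does
    modulo T^{1,0}. *)
Lemma lieT_triv U a Y x k : open U -> Sec U Y -> U x -> chart_dom a x ->
  triv (b := T) a (lieT V Y x) 0 k = vact V (fun q => triv (b := T) a (Y q) 0 k) x.
Proof.
move=> oU sY Ux ax; have o := openI oU (dom_open hM a).
have sYe := proj1 (T01_vsmooth hM Y oU) sY.
rewrite triv01E (tact_pr01 _ _ ax).
apply: (etrans (lie_act hM o (vsmooth_sub (@subsetT _ _) sV)
  (vsmooth_sub (@subIsetl _ U _) sYe) (smooth_sub (@subIsetr _ U _) (smooth_zbcoord hM a k)) _)) => //.
have -> : vact (fun q => emb01 (Y q)) (vact V (zbcoord a k)) x = 0.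
  apply: (etrans (tact_eq hM (dom_open hM a) ax _ (g := fun=> 0) _)) => [q aq|].
    exact: (pr01_0_zbcoord hM _ (V10 q) aq).
  exact: tact_cst.
rewrite subr0; apply: (tact_eq hM openT I) => q _.
by rewrite triv01E.
Qed.

Lemma lieT_ext x (w w' : T x) : (forall k, triv (b := T) (chart_at M x) w 0 k
  = triv (b := T) (chart_at M x) w' 0 k) -> w = w'.
Proof.
by move=> H; apply: (triv_inj bT (at_dom hM x : tdom (b := T) (chart_at M x) x)); apply/rowP.
Qed.

Lemma lieT_smooth Y : Gamma Y -> Gamma (lieT V Y).
Proof.
move=> gY a k; have o := openI openT (dom_open hM a).
apply: (smooth_ext hM o) (vact_smooth hM o (vsmooth_sub (@subsetT _ _) sV) (gY a k)).
by move=> q [_ aq]; exact: (esym (lieT_triv _ openT gY I aq)).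
Qed.

Let trivE a x (w w' : T x) c k : chart_dom a x -> triv (b := T) a (c *: w + w') 0 k
  = c * triv (b := T) a w 0 k + triv (b := T) a w' 0 k.
Proof. by move=> ax; rewrite (triv_linear bT)// mxDE mxZE. Qed.

Lemma linear_form3 (W : lmodType R[i]) (t : W -> R[i]) (b c : R[i]) (u v w : W) :
  (forall c w w', t (c *: w + w') = c * t w + t w') ->
  t ((b *: u + c *: v) + w) = (b * t u + c * t v) + t w.
Proof.
move=> tl; rewrite -(scale1r (b *: u + _)) tl mul1r tl.
have t0 : t 0 = 0.
  by have := tl (-1) 0 0; rewrite scaler0 addr0 mulN1r addNr.
by rewrite -[c *: v]addr0 tl t0 addr0.
Qed.

Lemma lieT_linear f Y Z x : smooth [set: X] f -> Gamma Y -> Gamma Z ->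
  lieT V (fun q => f q *: Y q + Z q) x
  = (vact V f x *: Y x + f x *: lieT V Y x) + lieT V Z x.
Proof.
move=> sf gY gZ; apply: lieT_ext => k; have ax := at_dom hM x.
have oa := dom_open hM (chart_at M x); move: oa ax k; set a := chart_at M x => oa ax k.
have gfYZ := section_add hM bT openT (section_scale hM bT openT sf gY) gZ.
have sub (h : section T) : Gamma h -> smooth (chart_dom a) (fun q => triv (b := T) a (h q) 0 k).
  by move=> gh; apply: smooth_sub (gh a k) => q.
have e : vact V (fun q => triv (b := T) a (f q *: Y q + Z q) 0 k) x
    = vact V (fun q => f q * triv (b := T) a (Y q) 0 k + triv (b := T) a (Z q) 0 k) x.
  by apply: (tact_eq hM oa ax) => q aq; exact: trivE.
have sfa := smooth_sub (@subsetT _ _) sf : smooth (chart_dom a) f.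
apply: (etrans (lieT_triv k openT gfYZ I ax)); apply: (etrans e).
apply: (etrans (tact_add hM ax _ (smooth_mul hM oa sfa (sub _ gY)) (sub _ gZ))).
symmetry; apply: (etrans (linear_form3 (W := T x) _ _ _ _ _ (fun c w w' =>
  trivE w w' c k ax))).
apply: (f_equal2 +%R); last exact: (lieT_triv k openT gZ I ax).
apply: (etrans _ (esym (tact_mul hM ax _ sfa (sub _ gY)))).
apply: (congr1 (fun z => _ + f x * z)); exact: (lieT_triv k openT gY I ax).
Qed.

Lemma lieT_add Y Z x : Gamma Y -> Gamma Z ->
  lieT V (fun q => Y q + Z q) x = lieT V Y x + lieT V Z x.
Proof.
move=> gY gZ.
have := lieT_linear x (smooth_cst hM (1 : R[i]) openT) gY gZ.
have -> : vact V (fun=> 1) x = 0 by exact: tact_cst.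
rewrite scale0r add0r scale1r => <-.
by congr (lieT V _ x); apply: functional_extensionality_dep => q; rewrite scale1r.
Qed.

Lemma lieT_scale f Y x : smooth [set: X] f -> Gamma Y ->
  lieT V (fun q => f q *: Y q) x = vact V f x *: Y x + f x *: lieT V Y x.
Proof.
move=> sf gY; have g0 := section_0 hM bT openT.
have z : lieT V (fun q => 0 : T q) x = 0.
  have := lieT_add x g0 g0; rewrite (_ : (fun q => _) = (fun q => 0 : T q)).
    by move/eqP; rewrite -subr_eq0 opprD addNKr oppr_eq0 => /eqP.
  by apply: functional_extensionality_dep => q; rewrite addr0.
have := lieT_linear x sf gY g0; rewrite z addr0 => <-.
by congr (lieT V _ x); apply: functional_extensionality_dep => q; rewrite addr0.
Qed.

(** On a coordinate field of the preferred chart the definition of the Lie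
    derivative of a form can be read off. *)
Lemma lieTd_coord eta x k : Gamma eta ->
  let a := chart_at M x in let Z := coord_vf01 a k in
  lieTd V eta x 0 k = vact V (pr eta Z) x - pair (eta x) (lieT V Z x).
Proof.
move=> ge a Z; have oa := dom_open hM a; have ax : chart_dom a x := at_dom hM x.
pose W j := coord_vf a j; have sW j : vsmooth (chart_dom a) (W j) := coord_vf_vsmooth a j.
have sVa := vsmooth_sub (@subsetT _ (chart_dom a)) sV.
pose g j q := pair (eta q) (pr01 (W j q)).
have sg j : smooth (chart_dom a) (g j).
  exact: (pair_smooth hM oa (section_sub (@subsetT _ _) ge) (pr01_section oa (sW j))).
have E j : lie_form M V (fun q => emb01d (eta q)) x 0 j
    = vact V (g j) x - pair (eta x) (pr01 (Defs.lie M V (W j) x)).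
  rewrite mxE; congr (_ - _); last exact: pair_emb01d.
  by apply: (tact_eq hM openT I) => q _; exact: pair_emb01d.
have Zq q : chart_dom a q -> emb01 (Z q)
    = 2^-1 *: W (lshift n k) q + ((2^-1 * 'i) *: W (rshift n k) q + 0).
  by move=> aq; apply: (etrans (emb01_coord_vf01 hM k aq)); exact: half_split.
have Z' q : chart_dom a q -> Z q = 2^-1 *: pr01 (W (lshift n k) q)
    + (2^-1 * 'i) *: pr01 (W (rshift n k) q).
  move=> aq; apply: (etrans (esym (@pr01K R n (Z q)))).
  by apply: (etrans (congr1 (@pr01 R n) (Zq q aq))); exact: pr01_half.
have s0 : vsmooth (chart_dom a) (fun=> 0).
  move=> b l; have o := openI oa (dom_open hM b).
  apply: (smooth_ext hM o) (smooth_cst hM 0 o) => q _; exact: (esym (tact0 _ _ _)).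
have sr : vsmooth (chart_dom a) (fun q => (2^-1 * 'i) *: W (rshift n k) q + 0).
  exact: (vsmooth_linear hM oa (smooth_cst hM _ oa) (sW _) s0).
have L : lieT V Z x = 2^-1 *: pr01 (Defs.lie M V (W (lshift n k)) x)
    + (2^-1 * 'i) *: pr01 (Defs.lie M V (W (rshift n k)) x).
  have e1 := lie_eq hM oa ax (fun q _ => erefl (V q)) Zq.
  have e2 := lie_linearr oa ax sVa (sW (lshift n k)) sr 2^-1.
  have e3 := lie_linearr oa ax sVa (sW (rshift n k)) s0 (2^-1 * 'i).
  have e4 := etrans e3 (congr1 (fun z => _ + z) (lie_0r V x)).
  have e5 := etrans (etrans e1 e2) (congr1 (fun z => _ + z) e4).
  apply: (etrans (congr1 (@pr01 R n) e5)); exact: pr01_half.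
have sc (c : R[i]) j : smooth (chart_dom a) (fun q => c * g j q).
  exact: (smooth_mul hM oa (smooth_cst hM c oa) (sg j)).
have F : vact V (pr eta Z) x
    = 2^-1 * vact V (g (lshift n k)) x + (2^-1 * 'i) * vact V (g (rshift n k)) x.
  apply: (etrans (tact_eq hM oa ax _
    (g := fun q => 2^-1 * g (lshift n k) q + (2^-1 * 'i) * g (rshift n k) q) _)).
    by move=> q aq; rewrite (Z' q aq) pairDr; congr (_ + _); exact: pairZr.
  rewrite (tact_add hM ax _ (sc _ _) (sc _ _)).
  by congr (_ + _); exact: (tact_scale hM oa ax _ _ (sg _)).
rewrite F L pairDr; rewrite [X in _ = _ - (X + _)]pairZr [X in _ = _ - (_ + X)]pairZr.
rewrite /lieTd /pr01d mxZE mxDE mxZE lsubE rsubE (E (lshift n k)) (E (rshift n k)).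
exact: half_combine.
Qed.

(** Both sides are tensorial in Z: for a form eta and the field Z, the terms in
    which a function multiplying Z is differentiated cancel. This reduces the
    claim to coordinate fields. *)
Lemma pair_lieTd eta Z x : Gamma eta -> Gamma Z ->
  pair (lieTd V eta x) (Z x) = vact V (pr eta Z) x - pair (eta x) (lieT V Z x).
Proof.
move=> ge gZ; pose D Z := vact V (pr eta Z) x - pair (eta x) (lieT V Z x).
have TD : tensorial M x D.
  split=> [Z1 Z2 g1 g2|f Z1 sf g1].
    have s1 := pair_smooth hM openT ge g1; have s2 := pair_smooth hM openT ge g2.
    rewrite /D (lieT_add x g1 g2) pairDr.
    have -> : vact V (pr eta (fun q => Z1 q + Z2 q)) x
        = vact V (pr eta Z1) x + vact V (pr eta Z2) x.
      apply: (etrans _ (tact_add hM I _ s1 s2)); apply: (tact_eq hM openT I) => q _.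
      exact: pairDr.
    by rewrite opprD addrACA.
  have s1 := pair_smooth hM openT ge g1.
  rewrite /D (lieT_scale x sf g1) pairDr [X in _ - (X + _)]pairZr [X in _ - (_ + X)]pairZr.
  have -> : vact V (pr eta (fun q => f q *: Z1 q)) x
      = vact V f x * pair (eta x) (Z1 x) + f x * vact V (pr eta Z1) x.
    apply: (etrans _ (tact_mul hM I _ sf s1)); apply: (tact_eq hM openT I) => q _.
    exact: pairZr.
  exact: diff_scale.
pose a := chart_at M x; have ax : tdom (b := T) a x := at_dom hM x.
have [chi [N [cO exp]]] := tensorial_expansion hM bT ax.
apply: (etrans _ (esym (exp D Z TD gZ))); apply: eq_bigr => k _.
rewrite mulrC; congr (_ * _).
  by rewrite mxE (tact_zbcoord_at hM) pr01K.
have oO := cutoff_open cO; have Ox := cutoff_at cO.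
have E q : N q -> coord_vf01 a k q = chi q *: frame (E := T) (j := a) k q.
  by move=> Nq; rewrite (cutoff1 cO)// scale1r.
pose W : section T := fun q => chi q *: frame (E := T) (j := a) k q.
have F1 : vact V (pr eta (coord_vf01 a k)) x = vact V (pr eta W) x.
  by apply: (tact_eq hM oO Ox) => q Nq; rewrite (E q Nq).
have F2 : pair (eta x) (lieT V (coord_vf01 a k) x) = pair (eta x) (lieT V W x).
  have e q : N q -> emb01 (coord_vf01 a k q) = emb01 (W q).
    by move=> Nq; rewrite (E q Nq).
  exact: (congr1 (fun v => pair (eta x) (pr01 v))
    (lie_eq hM oO Ox (fun q _ => erefl (V q)) e)).
apply: (etrans (lieTd_coord x k ge)); exact: (f_equal2 (fun u v => u - v) F1 F2).
Qed.

Lemma lieTd_smooth eta : Gamma eta -> Gamma (lieTd V eta).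
Proof.
move=> ge; apply: (dual_smooth hM) => Z gZ.
have s1 := vact_smooth hM openT sV (pair_smooth hM openT ge gZ).
have s2 := pair_smooth hM openT ge (lieT_smooth gZ).
apply: (smooth_ext hM openT) (smooth_add hM openT s1 (smooth_opp hM openT s2)) => q _.
exact: (esym (pair_lieTd q ge gZ)).
Qed.

End TypeOneZero.

End LieDerivative.

(** * The connection of the holomorphic Courant algebroid on the standard one *)

Section LieDerivativeLinear.
Context (R : realType) (X : topologicalType) (n : nat) (M : charts R X n).
Context (hM : complex_manifold M).
Notation vfield := (X -> 'rV[R[i]]_(n + n)).
Notation smooth := (smooth M).
Notation vsmooth := (vsmooth M).
Notation vact := (vact M).
Notation Gamma s := (section_on (Defs.smooth M) [set: X] s).
Notation T := (T01 M).
Notation Td := (T01dual M).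
Notation bT := (T01_bundle hM).
Notation bTd := (T01dual_bundle hM).
Notation pr eta Y := (fun x => pair (eta x) (Y x)).
Notation lieT := (lieT (M := M)).
Notation lieTd := (lieTd (M := M)).
Implicit Types (f g : X -> R[i]) (Y Z : section T) (eta : section Td) (x p q : X).

Definition type10 (V : vfield) := vsmooth [set: X] V /\ forall q, pr01 (V q) = 0.

Let ringA (a b c d e f : R[i]) :
  (a * b + c * d) - (a * e + c * f) = a * (b - e) + c * (d - f).
Proof. ring. Qed.

(** Since the action is componentwise, it depends on V through its value at x. *)
Lemma lieT_comb (W V V' : vfield) c c' Y x : type10 W -> type10 V -> type10 V' ->
  Gamma Y -> W x = c *: V x + c' *: V' x ->
  lieT W Y x = c *: lieT V Y x + c' *: lieT V' Y x.
Proof.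
move=> [sW W1] [sV V1] [sV' V1'] gY e; apply: (lieT_ext hM) => k.
have ax := at_dom hM x; move: (chart_at M x) ax k => a ax k.
have tl c0 (w w' : T x) : triv (b := T) a (c0 *: w + w') 0 k
    = c0 * triv (b := T) a w 0 k + triv (b := T) a w' 0 k.
  by rewrite (triv_linear bT)// mxDE mxZE.
apply: (etrans (lieT_triv hM sW W1 k openT gY I ax)); rewrite /vact e tact_linear tactZ.
apply: (etrans _ (esym (tl _ _ _))).
apply: (f_equal2 +%R).
  by apply: (congr1 (fun z => c * z)); exact: (esym (lieT_triv hM sV V1 k openT gY I ax)).
apply: (etrans _ (esym (congr1 (fun w : 'rV[R[i]]_n => w 0 k) (triv_Z bT c' _ ax)))).
apply: (etrans _ (esym (mxZE _ _ _ _))).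
by apply: (congr1 (fun z => c' * z)); exact: (esym (lieT_triv hM sV' V1' k openT gY I ax)).
Qed.

Lemma lieTd_comb (W V V' : vfield) c c' eta x : type10 W -> type10 V -> type10 V' ->
  Gamma eta -> W x = c *: V x + c' *: V' x ->
  lieTd W eta x = c *: lieTd V eta x + c' *: lieTd V' eta x.
Proof.
move=> tW tV tV' ge e; apply: (dual_ext hM) => Z gZ.
have P U : type10 U -> _ := fun t => pair_lieTd hM t.1 t.2 x ge gZ.
apply: (etrans (P W tW)); rewrite (lieT_comb tW tV tV' gZ e) /vact e tact_linear tactZ.
apply: (etrans (congr1 (fun z => _ - z) (etrans (pairDr _ _ _)
  (f_equal2 +%R (pairZr _ _ _) (pairZr _ _ _))))).
apply: (etrans (ringA _ _ _ _ _ _)); symmetry.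
apply: (etrans (pairDl _ _ _)); apply: (f_equal2 +%R); apply: (etrans (pairZl _ _ _)).
  by rewrite (P V tV).
by rewrite (P V' tV').
Qed.

Lemma lieTd_add V eta eta' x : type10 V -> Gamma eta -> Gamma eta' ->
  lieTd V (fun q => eta q + eta' q) x = lieTd V eta x + lieTd V eta' x.
Proof.
move=> tV ge ge'; apply: (dual_ext hM) => Z gZ.
have s1 := pair_smooth hM openT ge gZ; have s2 := pair_smooth hM openT ge' gZ.
have g := section_add hM bTd openT ge ge'.
apply: (etrans (pair_lieTd hM tV.1 tV.2 x g gZ)); symmetry.
apply: (etrans (pairDl _ _ _)).
apply: (etrans (f_equal2 +%R (pair_lieTd hM tV.1 tV.2 x ge gZ) (pair_lieTd hM tV.1 tV.2 x ge' gZ))).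
rewrite addrACA -opprD.
apply: (f_equal2 (fun u v => u - v)); last exact: (esym (pairDl _ _ _)).
apply: (etrans (esym (tact_add hM I _ s1 s2))); apply: (tact_eq hM openT I) => q _.
exact: (esym (pairDl _ _ _)).
Qed.

Lemma lieTd_scale V f eta x : type10 V -> smooth [set: X] f -> Gamma eta ->
  lieTd V (fun q => f q *: eta q) x = vact V f x *: eta x + f x *: lieTd V eta x.
Proof.
move=> tV sf ge; apply: (dual_ext hM) => Z gZ.
have s1 := pair_smooth hM openT ge gZ.
have g := section_scale hM bTd openT sf ge.
apply: (etrans (pair_lieTd hM tV.1 tV.2 x g gZ)); symmetry.
apply: (etrans (pairDl _ _ _)); apply: (etrans (f_equal2 +%R (pairZl _ _ _) (pairZl _ _ _))).
rewrite (pair_lieTd hM tV.1 tV.2 x ge gZ).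
have -> : vact V (fun q => pair (f q *: eta q) (Z q)) x
    = vact V f x * pair (eta x) (Z x) + f x * vact V (pr eta Z) x.
  apply: (etrans _ (tact_mul hM I _ sf s1)); apply: (tact_eq hM openT I) => q _.
  exact: pairZl.
apply: (etrans _ (congr1 (fun z => _ - z) (esym (pairZl _ _ _)))).
by rewrite mulrBr addrA.
Qed.

(** Componentwise the claim is the formula for the action of a bracket of fields. *)
Lemma lieT_flat (V V' W : vfield) Y x : type10 V -> type10 V' -> type10 W ->
  W x = Defs.lie M V V' x -> Gamma Y ->
  lieT W Y x = lieT V (lieT V' Y) x - lieT V' (lieT V Y) x.
Proof.
move=> [sV V1] [sV' V1'] [sW W1] e gY; apply: (lieT_ext hM) => k.
have ax := at_dom hM x; have oa := dom_open hM (chart_at M x).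
move: (chart_at M x) ax oa k => a ax oa k.
have gL := lieT_smooth hM sV V1 gY; have gL' := lieT_smooth hM sV' V1' gY.
have sub : [set: X] `&` chart_dom a `<=` chart_dom a by move=> q [].
have sY : smooth (chart_dom a) (fun q => triv (b := T) a (Y q) 0 k).
  by apply: smooth_sub (gY a k) => q.
have tB (w w' : T x) : triv (b := T) a (w - w') 0 k
    = triv (b := T) a w 0 k - triv (b := T) a w' 0 k.
  have := triv_linear bT (j := a) (-1) w' w ax; rewrite scaleN1r addrC => ->.
  by rewrite mxDE scaleN1r addrC mxNE.
apply: (etrans (lieT_triv hM sW W1 k openT gY I ax)); apply: (etrans _ (esym (tB _ _))).
rewrite /vact e.
apply: (etrans (lie_act hM oa (vsmooth_sub (@subsetT _ _) sV)
  (vsmooth_sub (@subsetT _ _) sV') sY ax)).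
apply: (f_equal2 (fun u v => u - v)).
  apply: (etrans _ (esym (lieT_triv hM sV V1 k openT gL' I ax))).
  by apply: (tact_eq hM oa ax) => q aq; exact: (esym (lieT_triv hM sV' V1' k openT gY I aq)).
apply: (etrans _ (esym (lieT_triv hM sV' V1' k openT gL I ax))).
by apply: (tact_eq hM oa ax) => q aq; exact: (esym (lieT_triv hM sV V1 k openT gY I aq)).
Qed.

Let ringB (a b c d e f : R[i]) :
  (a - b - (c - e)) - (d - c - (b - f)) = a - d - (f - e).
Proof. ring. Qed.

Lemma lieTd_flat (V V' W : vfield) eta x : type10 V -> type10 V' -> type10 W ->
  W x = Defs.lie M V V' x -> Gamma eta ->
  lieTd W eta x = lieTd V (lieTd V' eta) x - lieTd V' (lieTd V eta) x.
Proof.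
move=> tV tV' tW e ge; apply: (dual_ext hM) => Z gZ.
have s0 := pair_smooth hM openT ge gZ.
have iter U U' : type10 U -> type10 U' -> pair (lieTd U (lieTd U' eta) x) (Z x)
    = vact U (vact U' (pr eta Z)) x - vact U (pr eta (lieT U' Z)) x
      - (vact U' (pr eta (lieT U Z)) x - pair (eta x) (lieT U' (lieT U Z) x)).
  move=> tU tU'.
  have gL := lieT_smooth hM tU.1 tU.2 gZ; have gL' := lieT_smooth hM tU'.1 tU'.2 gZ.
  have gd := lieTd_smooth hM tU'.1 tU'.2 ge.
  have s1 := vact_smooth hM openT tU'.1 s0; have s2 := pair_smooth hM openT ge gL'.
  apply: (etrans (pair_lieTd hM tU.1 tU.2 x gd gZ)).
  apply: (f_equal2 (fun u v => u - v) _ (pair_lieTd hM tU'.1 tU'.2 x ge gL)).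
  apply: (etrans _ (tact_sub hM openT I _ s1 s2)); apply: (tact_eq hM openT I) => q _.
  exact: (pair_lieTd hM tU'.1 tU'.2 q ge gZ).
apply: (etrans (pair_lieTd hM tW.1 tW.2 x ge gZ)); symmetry.
apply: (etrans (pairDl _ _ _)); apply: (etrans (congr1 (fun z => _ + z) (pairNl _ _))).
apply: (etrans (f_equal2 (fun u v => u - v) (iter _ _ tV tV') (iter _ _ tV' tV))).
apply: (etrans (ringB _ _ _ _ _ _)); symmetry.
apply: (f_equal2 (fun u v => u - v)).
  by rewrite /vact e; exact: (lie_act hM openT tV.1 tV'.1 s0 I).
apply: (etrans (congr1 (pair (eta x)) (lieT_flat tV tV' tW e gZ))).
by apply: (etrans (pairDr _ _ _)); apply: (congr1 (fun z => _ + z)); exact: pairNr.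
Qed.

End LieDerivativeLinear.

Section LeftConnection.
Context (R : realType) (X : topologicalType) (n : nat) (M : charts R X n).
Context (hM : complex_manifold M).
Context (E : hcourant R X n) (dorf : section E -> section E -> section E).
Context (hA : courant_algebroid M (E10 dorf)).
Notation smooth := (smooth M).
Notation Gamma s := (section_on (Defs.smooth M) [set: X] s).
Notation T := (T01 M).
Notation Td := (T01dual M).
Notation C := (C01 M).
Notation V e := (fun q => rho10 (e q : E q)).
Notation left := (@nabla_left R X n M E).
Notation lieT := (lieT (M := M)).
Notation lieTd := (lieTd (M := M)).
Notation ipC := (@cinner _ _ _ C _).
Notation funx := functional_extensionality_dep.
Implicit Types (e : section E) (b : section C) (f : X -> R[i]) (x : X).

Lemma pr01_rho10 x (u : E x) : pr01 (rho10 u) = 0.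
Proof.
rewrite /rho10; apply: (etrans (pr01Z _ _)).
suff -> (v : 'rV[R[i]]_(n + n)) : pr01 (v - 'i *: jstr v) = 0 by rewrite scaler0.
apply/rowP => k; rewrite pr01E mx0E.
rewrite [X in X - _]mxDE [X in _ - _ * X]mxDE (mxNE ('i *: jstr v)) (mxNE ('i *: jstr v)).
rewrite !mxZE /jstr row_mxEl row_mxEr mxNE lsubE rsubE.
move: (v _ _) (v _ _) => z y.
have -> : y - 'i * - z - 'i * (z - 'i * y) = y + 'i * 'i * y by ring.
by rewrite iiN mulN1r subrr.
Qed.

Lemma type10_rho10 e : Gamma e -> type10 M (V e).
Proof. by move=> ge; split; [exact: (anchor_vsmooth hA ge)|move=> q; exact: pr01_rho10]. Qed.

Lemma rho10_dorf e e' x : Gamma e -> Gamma e' ->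
  rho10 (dorf e e' x) = Defs.lie M (V e) (V e') x.
Proof.
move=> ge ge'; apply: (tact_ext hM (p := x)) => f sf.
apply: (etrans (dorf_act hM hA x ge ge' sf)).
exact: (esym (lie_act hM openT (anchor_vsmooth hA ge) (anchor_vsmooth hA ge') sf I)).
Qed.

Let SP b : Gamma b -> Gamma ((fun x => (b x).1) : section T)
  /\ Gamma ((fun x => (b x).2) : section Td).
Proof. exact: (proj1 (C01_section hM b openT)). Qed.

Lemma scale1_sum (W : lmodType R[i]) (u v : W) : 1 *: u + 1 *: v = u + v.
Proof. by rewrite !scale1r. Qed.
Lemma scale_sum0 (W : lmodType R[i]) c (u v : W) : c *: u + 0 *: v = c *: u.
Proof. by rewrite scale0r addr0. Qed.

Let rho10D x (u v : E x) : rho10 (u + v) = 1 *: rho10 u + 1 *: rho10 v.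
Proof. exact: (etrans (anchorD hA u v) (esym (scale1_sum _ _))). Qed.
Let rho10Z x c (u : E x) : rho10 (c *: u) = c *: rho10 u + 0 *: rho10 u.
Proof. exact: (etrans (anchorZ hA c u) (esym (scale_sum0 _ _ _))). Qed.

Let pair_ext x (u v : C x) : u.1 = v.1 -> u.2 = v.2 -> u = v.
Proof. by move: u v => [u1 u2] [v1 v2] /= -> ->. Qed.

Lemma left_anchor0 e b x : Gamma e -> Gamma b -> rho10 (e x) = 0 -> left e b x = 0.
Proof.
move=> ge gb e0; have [gY ge'] := SP gb; have t := type10_rho10 ge.
have z : rho10 (e x) = 0 *: rho10 (e x) + 0 *: rho10 (e x) by rewrite e0 !scaler0 addr0.
apply: pair_ext.
  by apply: (etrans (lieT_comb hM t t t gY z)); rewrite !scale0r addr0.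
by apply: (etrans (lieTd_comb hM t t t ge' z)); rewrite !scale0r addr0.
Qed.

Lemma left_smooth e b : Gamma e -> Gamma b -> Gamma (left e b).
Proof.
move=> ge gb; have [gY ge'] := SP gb; have t := type10_rho10 ge.
apply/(C01_section hM _ openT); split; first exact: (lieT_smooth hM t.1 t.2 gY).
exact: (lieTd_smooth hM t.1 t.2 ge').
Qed.

Lemma left_connection : connection M (@canchor _ _ _ (E10 dorf)) left.
Proof.
split.
- exact: left_smooth.
- move=> e e' b ge ge' gb; apply: funx => x; have [gY gd] := SP gb.
  have t := type10_rho10 ge; have t' := type10_rho10 ge'.
  have t'' := type10_rho10 (add_smooth hM hA ge ge').
  have d := rho10D (e x) (e' x); apply: pair_ext.
    exact: (etrans (lieT_comb hM t'' t t' gY d) (scale1_sum _ _)).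
  exact: (etrans (lieTd_comb hM t'' t t' gd d) (scale1_sum _ _)).
- move=> e b b' ge gb gb'; apply: funx => x.
  have [gY gd] := SP gb; have [gY' gd'] := SP gb'; have t := type10_rho10 ge.
  apply: pair_ext; first exact: (lieT_add hM t.1 t.2 x gY gY').
  exact: (lieTd_add hM x t gd gd').
- move=> f e b sf ge gb; apply: funx => x; have [gY gd] := SP gb.
  have t := type10_rho10 ge; have t' := type10_rho10 (scale_smooth hM hA sf ge).
  have d := rho10Z (f x) (e x); apply: pair_ext.
    exact: (etrans (lieT_comb hM t' t t gY d) (scale_sum0 _ _ _)).
  exact: (etrans (lieTd_comb hM t' t t gd d) (scale_sum0 _ _ _)).
- move=> f e b sf ge gb; apply: funx => x; have [gY gd] := SP gb.
  have t := type10_rho10 ge; apply: pair_ext; first exact: (lieT_scale hM t.1 t.2 x sf gY).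
  exact: (lieTd_scale hM x t sf gd).
Qed.

Let ringC (a b c d : R[i]) : a + d = a - c + b + (c + (d - b)).
Proof. ring. Qed.

Lemma left_metric : @preserves_metric R X n M (E10 dorf) C left.
Proof.
move=> e b b' ge gb gb'; apply: funx => x.
have [gY gd] := SP gb; have [gY' gd'] := SP gb'; have t := type10_rho10 ge.
have s1 := pair_smooth hM openT gd gY'; have s2 := pair_smooth hM openT gd' gY.
apply: (etrans (tact_add hM I _ s1 s2)) => /=.
have e1 := pair_lieTd hM t.1 t.2 x gd gY'; have e2 := pair_lieTd hM t.1 t.2 x gd' gY.
symmetry; apply: (etrans (f_equal2 +%R (congr1 (fun z => z + _) e1)
  (congr1 (fun z => _ + z) e2))).
exact: (esym (ringC _ _ _ _)).
Qed.

Lemma left_exact : @kills_exact R X n M (E10 dorf) C left.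
Proof.
move=> f b sf gb; apply: funx => x; apply: left_anchor0 => //.
  exact: (calD_smooth hM hA sf).
exact: (calD_anchor hM hA x sf).
Qed.

(** The anchor of a Courant algebroid is a morphism of brackets, and the action
    depends on the anchor alone. *)
Lemma left_flat : @flat R X n M E C dorf left.
Proof.
move=> e e' b ge ge' gb; apply: funx => x; have [gY gd] := SP gb.
have t := type10_rho10 ge; have t' := type10_rho10 ge'.
have gee := dorf_smooth hA ge ge'; have t'' := type10_rho10 gee.
have d := rho10_dorf x ge ge'; apply: pair_ext.
  apply: (etrans (congr1 (fun z => _ - z) (lieT_flat hM t t' t'' d gY))).
  exact: subrr.
apply: (etrans (congr1 (fun z => _ - z) (lieTd_flat hM t t' t'' d gd))).
exact: subrr.
Qed.

End LeftConnection.

(** * The connection of the standard Courant algebroid on the holomorphic one *)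

Section RightConnection.
Context (R : realType) (X : topologicalType) (n : nat) (M : charts R X n).
Context (hM : complex_manifold M).
Context (E : hcourant R X n) (hE : holomorphic_courant_algebroid M E).
Context (nab : section (T01 M) -> section E -> section E).
Context (hnab : holomorphic_connection nab).
Context (dorf : section E -> section E -> section E).
Context (hA : courant_algebroid M (E10 dorf)).
Notation smooth := (smooth M).
Notation Gamma s := (section_on (Defs.smooth M) [set: X] s).
Notation Hol U s := (section_on (holomorphic M) U s).
Notation T := (T01 M).
Notation Td := (T01dual M).
Notation C := (C01 M).
Notation V e := (fun q => rho10 (e q : E q)).
Notation right := (nabla_right nab).
Notation ip := (@hinner _ _ _ E _).
Notation funx := functional_extensionality_dep.
Notation bE := (hcourant_bundle hE).
Notation vact := (vact M).
Notation tact := (tact M).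
Implicit Types (e s : section E) (Y : section T) (b : section C) (f : X -> R[i]) (x : X).

Let cn : connection M (@anchor01 R X n M) nab.
Proof. by case: hnab. Qed.

Let bA : vector_bundle (Defs.smooth M) E := courant_bundle hA.

Lemma nab_holomorphic U s Y x : open U -> Gamma s -> Hol U s -> Gamma Y -> U x ->
  nab Y s x = 0.
Proof.
case: hnab => _ _ h oU gs hs gY Ux.
exact: ((proj1 (h U s oU gs) hs) Y gY x Ux).
Qed.

Lemma nab0l s : Gamma s -> nab (fun=> 0) s = fun=> 0.
Proof.
move=> gs; have g0 := section_0 hM (T01_bundle hM) openT.
have := nab_scalel cn (smooth_cst hM (0 : R[i]) openT) g0 gs.
rewrite (_ : (fun x => 0 *: (0 : T x)) = (fun x => 0 : T x)); last first.
  by apply: funx => x; rewrite scale0r.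
by move=> ->; apply: funx => x; rewrite scale0r.
Qed.

Let SP b : Gamma b -> Gamma ((fun x => (b x).1) : section T).
Proof. by move=> gb; exact: (proj1 (proj1 (C01_section hM b openT) gb)). Qed.

Lemma right_connection : connection M (@canchor _ _ _ C) right.
Proof.
split.
- by move=> b s gb gs; exact: (nab_smooth cn (SP gb) gs).
- by move=> b b' s gb gb' gs; exact: (nab_addl cn (SP gb) (SP gb') gs).
- by move=> b s s' gb gs gs'; exact: (nab_addr cn (SP gb) gs gs').
- by move=> f b s sf gb gs; exact: (nab_scalel cn sf (SP gb) gs).
- by move=> f b s sf gb gs; exact: (nab_leibniz cn sf (SP gb) gs).
Qed.

Lemma right_flat : @flat R X n M C E (@cdorf _ _ _ C) right.
Proof.
case: hnab => _ h _ b b' s gb gb' gs.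
exact: (h _ _ _ (SP gb) (SP gb') gs).
Qed.

Lemma right_exact : @kills_exact R X n M C (E10 dorf) right.
Proof.
move=> f s sf gs; apply: (etrans _ (nab0l gs)); rewrite /nabla_right; congr (nab _ s).
by apply: funx => x; rewrite (calD_C01 hM x sf).
Qed.

Let ip_smooth s s' : Gamma s -> Gamma s' -> smooth [set: X] (fun q => ip (s q) (s' q)).
Proof. exact: (inner_smooth hA). Qed.

Let ipDl x (u v w : E x) : ip (u + v) w = ip u w + ip v w.
Proof. exact: (innerDl hA). Qed.
Let ipDr x (u v w : E x) : ip w (u + v) = ip w u + ip w v.
Proof. exact: (innerDr hA). Qed.
Let ipZl x c (u w : E x) : ip (c *: u) w = c * ip u w.
Proof. exact: (innerZl hA). Qed.
Let ipZr x c (u w : E x) : ip w (c *: u) = c * ip w u.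
Proof. exact: (innerZr hA). Qed.
Let ipC x (u w : E x) : ip u w = ip w u.
Proof. exact: (innerC hA). Qed.

Let metric_defect Y s s' x := vact (fun q => emb01 (Y q)) (fun q => ip (s q) (s' q)) x
  - (ip (nab Y s x) (s' x) + ip (s x) (nab Y s' x)).

Let metric_defectC Y s s' x : metric_defect Y s s' x = metric_defect Y s' s x.
Proof.
apply: (f_equal2 (fun u v => u - v)).
  by apply: (tact_eq hM openT I) => q _; exact: ipC.
exact: (etrans (addrC _ _) (f_equal2 +%R (ipC _ _) (ipC _ _))).
Qed.

Let ringD (a b c d e f : R[i]) :
  a + b - (c + d + (e + f)) = a - (c + e) + (b - (d + f)).
Proof. ring. Qed.
Let ringE (a b c d e f : R[i]) :
  a * b + f * c - (a * b + f * d + f * e) = f * (c - (d + e)).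
Proof. ring. Qed.

Let metric_defect_tensorial Y s' x : Gamma Y -> Gamma s' ->
  tensorial M x (fun s => metric_defect Y s s' x).
Proof.
move=> gY gs'; split=> [s1 s2 g1 g2|f s sf gs].
  rewrite /metric_defect (nab_addr cn gY g1 g2) !ipDl.
  apply: (etrans _ (ringD _ _ _ _ _ _)); congr (_ - _).
  apply: (etrans _ (tact_add hM I _ (ip_smooth g1 gs') (ip_smooth g2 gs'))).
  by apply: (tact_eq hM openT I) => q _; exact: ipDl.
rewrite /metric_defect (nab_leibniz cn sf gY gs) !ipDl !ipZl.
apply: (etrans _ (ringE _ _ _ _ _ _)); congr (_ - _).
apply: (etrans _ (tact_mul hM I _ sf (ip_smooth gs gs'))).
by apply: (tact_eq hM openT I) => q _; exact: ipZl.
Qed.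

(** Both sides are determined by their values on holomorphic sections, whose
    inner products are holomorphic. *)
Lemma nab_metric Y s s' x : Gamma Y -> Gamma s -> Gamma s' ->
  vact (fun q => emb01 (Y q)) (fun q => ip (s q) (s' q)) x
  = ip (nab Y s x) (s' x) + ip (s x) (nab Y s' x).
Proof.
move=> gY gs gs'; apply/eqP; rewrite -subr_eq0; apply/eqP.
apply: (tensorial_holomorphic hM bE (metric_defect_tensorial x gY gs') _ gs) => e N oN Nx ge he.
rewrite metric_defectC.
apply: (tensorial_holomorphic hM bE (metric_defect_tensorial x gY ge) _ gs')
  => e' N' oN' Nx' ge' he'.
rewrite /metric_defect (nab_holomorphic oN ge he gY Nx) (nab_holomorphic oN' ge' he' gY Nx').
have -> : ip (0 : E x) (e x) = 0 by exact: (inner0l hA).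
have -> : ip (e' x) (0 : E x) = 0 by rewrite ipC; exact: (inner0l hA).
rewrite addr0 subr0; have oI := openI oN' oN.
apply: (emb01_holomorphic hM (U := N' `&` N)); first by split.
apply: (hcourant_inner_holomorphic hE oI) => j k.
  by apply: holomorphic_sub (he' j k) => q [[]].
by apply: holomorphic_sub (he j k) => q [[]].
Qed.

Lemma right_metric : @preserves_metric R X n M C (E10 dorf) right.
Proof.
move=> b s s' gb gs gs'; apply: funx => x; exact: (nab_metric x (SP gb) gs gs').
Qed.

(** A holomorphic function has complex linear differential. *)
Lemma tact_jstr (a : chart_idx M) x (v : 'rV[R[i]]_(n + n)) k : chart_dom a x ->
  tact x (jstr v) (zcoord a k) = 'i * tact x v (zcoord a k).
Proof.
move=> ax; apply/eqP; rewrite -subr_eq0 -tactZ -tactB; apply/eqP.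
rewrite [X in tact x X _](_ : _ = emb01 (pr01 (jstr v - 'i *: v))).
  exact: (emb01_zcoord hM).
rewrite [LHS]split01 (_ : pr10 _ = 0); first by rewrite /emb10 scaler0 oppr0 row_mx0 scaler0 addr0.
apply/rowP => l; rewrite pr10E mx0E [X in X + _]mxDE [X in _ + _ * X]mxDE.
rewrite (mxNE ('i *: v)) (mxNE ('i *: v)) !mxZE /jstr row_mxEl row_mxEr mxNE lsubE rsubE.
move: (v _ _) (v _ _) => y z.
have -> : - z - 'i * y + 'i * (y - 'i * z) = - z - 'i * 'i * z by ring.
by rewrite iiN mulN1r opprK addNr.
Qed.

Lemma tact_rho10 (a : chart_idx M) x (u : E x) k : chart_dom a x ->
  tact x (rho10 u) (zcoord a k) = tact x (cplx (hrho u)) (zcoord a k).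
Proof.
move=> ax; rewrite /rho10 tactZ tactB tactZ (tact_jstr _ _ ax) mulrA iiN mulN1r opprK.
by rewrite mulrDr -mulrDl halfD mul1r.
Qed.

Let rhoD x (u v : E x) : rho10 (u + v) = rho10 u + rho10 v.
Proof. exact: (anchorD hA u v). Qed.
Let rhoZ x c (u : E x) : rho10 (c *: u) = c *: rho10 u.
Proof. exact: (anchorZ hA c u). Qed.

Let ringF (a b c d f : R[i]) :
  a * b + f * c - (a * b + f * d) = f * (c - d).
Proof. ring. Qed.

(** Both sides are tensorial in s up to the same term Y[f] V_s[z_k]. If s is
    holomorphic near x, the left-hand side vanishes because nabla_Y s does, and
    the right-hand side because V_s[z_k] is holomorphic. *)
Lemma rho10_nab (a : chart_idx M) Y s x k : Gamma Y -> Gamma s -> chart_dom a x ->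
  tact x (rho10 (nab Y s x)) (zcoord a k)
  = vact (fun q => emb01 (Y q)) (vact (V s) (zcoord a k)) x.
Proof.
move=> gY gs ax; have oa := dom_open hM a.
have sub := @subsetT X (chart_dom a).
have sV e : Gamma e -> smooth (chart_dom a) (vact (V e) (zcoord a k)).
  move=> ge; apply: (vact_smooth hM oa) (smooth_zcoord hM a k).
  exact: (vsmooth_sub sub (anchor_vsmooth hA ge)).
pose D e := tact x (rho10 (nab Y e x)) (zcoord a k)
  - vact (fun q => emb01 (Y q)) (vact (V e) (zcoord a k)) x.
apply/eqP; rewrite -subr_eq0; apply/eqP; rewrite -/(D s).
have TD : tensorial M x D.
  split=> [s1 s2 g1 g2|f s1 sf g1].
    have e1 : tact x (rho10 (nab Y (fun q => s1 q + s2 q) x)) (zcoord a k)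
        = tact x (rho10 (nab Y s1 x)) (zcoord a k) + tact x (rho10 (nab Y s2 x)) (zcoord a k).
      by rewrite (nab_addr cn gY g1 g2) rhoD tactDl.
    have e2 : vact (fun q => emb01 (Y q)) (vact (fun q => rho10 (s1 q + s2 q)) (zcoord a k)) x
        = vact (fun q => emb01 (Y q)) (vact (V s1) (zcoord a k)) x
          + vact (fun q => emb01 (Y q)) (vact (V s2) (zcoord a k)) x.
      apply: (etrans _ (tact_add hM ax _ (sV _ g1) (sV _ g2))).
      apply: (tact_eq hM oa ax) => q _.
      apply: (etrans (congr1 (fun v => tact q v (zcoord a k)) (rhoD (s1 q) (s2 q)))).
      exact: tactDl.
    by apply: (etrans (f_equal2 (fun u v => u - v) e1 e2)); rewrite opprD addrACA.
  have e1 : tact x (rho10 (nab Y (fun q => f q *: s1 q) x)) (zcoord a k)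
      = vact (fun q => emb01 (Y q)) f x * tact x (rho10 (s1 x)) (zcoord a k)
        + f x * tact x (rho10 (nab Y s1 x)) (zcoord a k).
    have e0 := congr1 (fun h : section E => h x) (nab_leibniz cn sf gY g1).
    apply: (etrans (congr1 (fun u => tact x (rho10 u) (zcoord a k)) e0)).
    apply: (etrans (congr1 (fun v => tact x v (zcoord a k)) (rhoD _ _))).
    apply: (etrans (tactDl _ _ _ _ _)).
    apply: (f_equal2 +%R); apply: (etrans (congr1 (fun v => tact x v (zcoord a k)) (rhoZ _ _)));
      exact: tactZ.
  have e2 : vact (fun q => emb01 (Y q)) (vact (fun q => rho10 (f q *: s1 q)) (zcoord a k)) x
      = vact (fun q => emb01 (Y q)) f x * vact (V s1) (zcoord a k) x
        + f x * vact (fun q => emb01 (Y q)) (vact (V s1) (zcoord a k)) x.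
    apply: (etrans _ (tact_mul hM ax _ (smooth_sub sub sf) (sV _ g1))).
    apply: (tact_eq hM oa ax) => q _.
    apply: (etrans (congr1 (fun v => tact q v (zcoord a k)) (rhoZ (f q) (s1 q)))).
    exact: tactZ.
  apply: (etrans (f_equal2 (fun u v => u - v) e1 e2)); exact: ringF.
apply: (tensorial_holomorphic hM bE TD _ gs) => e N oN Nx ge he.
rewrite /D (nab_holomorphic oN ge he gY Nx).
have -> : rho10 (0 : E x) = 0 by exact: (anchor0 hA x).
rewrite tact0 sub0r.
have h := hcourant_rho_holomorphic hE oN he a k.
have oI := openI oN oa.
have h' : holomorphic M (N `&` chart_dom a) (vact (V e) (zcoord a k)).
  by apply: (holomorphic_ext hM oI _ h) => q [_ aq]; exact: (esym (tact_rho10 _ _ aq)).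
have -> : vact (fun q => emb01 (Y q)) (vact (V e) (zcoord a k)) x = 0.
  exact: (emb01_holomorphic hM (U := N `&` chart_dom a) _ _ h').
by rewrite oppr0.
Qed.

(** [V_s, Y] splits along T^{0,1} and T^{1,0}, the second part being given by
    the Dolbeault derivative of s. *)
Lemma lie_rho10 Y s x : Gamma Y -> Gamma s ->
  Defs.lie M (V s) (fun q => emb01 (Y q)) x
  = emb01 (lieT (M := M) (V s) Y x) - rho10 (nab Y s x).
Proof.
move=> gY gs; set w := Defs.lie _ _ _ _.
(* The claim is that this sum has no part of type (1,0). *)
suff e : w + rho10 (nab Y s x) = emb01 (pr01 (w + rho10 (nab Y s x))).
  rewrite pr01D pr01_rho10 addr0 in e.
  by apply: (canRL (addrK _)); exact: e.
apply: (type01P hM (p := x)) => k; have ax := at_dom hM x; have oa := dom_open hM (chart_at M x).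
move: (chart_at M x) ax oa => a ax oa.
have sub := @subsetT X (chart_dom a).
have gYe := proj1 (T01_vsmooth hM Y openT) gY.
rewrite tactDl (rho10_nab k gY gs ax) /w.
apply: (etrans (congr1 (fun z => z + _) (lie_act hM oa
  (vsmooth_sub sub (anchor_vsmooth hA gs)) (vsmooth_sub sub gYe) (smooth_zcoord hM a k) ax))).
rewrite subrK.
apply: (etrans (tact_eq hM oa ax _ (g := fun=> 0) _)) => [q aq|].
  exact: (emb01_zcoord hM).
exact: tact_cst.
Qed.

End RightConnection.

(** * The tensors of a pair of connections *)

Section SkewMap.
Context (R : realType) (X : topologicalType) (n : nat) (M : charts R X n).
Context (hM : complex_manifold M).
Context (A B : courant R X n) (hA : courant_algebroid M A) (hB : courant_algebroid M B).
Context (nab : section B -> section A -> section A).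
Context (cn : connection M (@canchor _ _ _ B) nab) (pm : preserves_metric M nab).
Notation Gamma s := (section_on (Defs.smooth M) [set: X] s).
Notation funx := functional_extensionality_dep.
Implicit Types (a b : section A) (g : section B) (x : X).

(** The right-hand side is tensorial in g, so the representing vector exists and
    the value chosen by skew_map has the defining property. *)
Lemma skew_mapP a b g x : Gamma a -> Gamma b -> Gamma g ->
  cinner (g x) (skew_map M nab a b x)
  = 2^-1 * (cinner (nab g a x) (b x) - cinner (a x) (nab g b x)).
Proof.
move=> ga gb gg; pose D g : R[i] :=
  2^-1 * (cinner (nab g a x) (b x) - cinner (a x) (nab g b x)).
have TD : tensorial M x D.
  split=> [g1 g2 h1 h2|f g1 sf h1].
    rewrite /D (nab_addl cn h1 h2 ga) (nab_addl cn h1 h2 gb).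
    by rewrite (innerDl hA) (innerDr hA) opprD addrACA mulrDr.
  rewrite /D (nab_scalel cn sf h1 ga) (nab_scalel cn sf h1 gb).
  by rewrite (innerZl hA) (innerZr hA) -mulrBr mulrCA.
have [u uP] := riesz hM hB TD.
exact: (xgetPex 0 (ex_intro (fun u : B x => forall g, Gamma g -> cinner (g x) u = D g) u uP)).
Qed.

Definition polar_map a b : section B := fun x => skew_map M nab a b x
  + 2^-1 *: calD M (@cinner _ _ _ B) (@canchor _ _ _ B) (fun q => cinner (a q) (b q)) x.

Let half_polar (u v : R[i]) : 2^-1 * (u - v) + 2^-1 * (u + v) = u.
Proof.
by rewrite -mulrDr addrACA addNr addr0 mulrDr -mulrDl halfD mul1r.
Qed.

(** Adding the symmetric part given by the derivative of the inner product to
    the skew part recovers the whole form <nabla a, b>. *)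
Lemma polar_mapP a b g x : Gamma a -> Gamma b -> Gamma g ->
  cinner (g x) (polar_map a b x) = cinner (nab g a x) (b x).
Proof.
move=> ga gb gg; have s := inner_smooth hA ga gb.
rewrite /polar_map (innerDr hB) (innerZr hB) (skew_mapP x ga gb gg) (innerC hB).
rewrite (calD_inner hM hB _ s).
have := congr1 (fun h => h x) (pm gg ga gb); rewrite /= /vact => ->.
exact: half_polar.
Qed.

Lemma polar_map_smooth a b : Gamma a -> Gamma b -> Gamma (polar_map a b).
Proof.
move=> ga gb; apply: (section_of_inner hM hB) => g gg.
have s := inner_smooth hA (nab_smooth cn gg ga) gb.
apply: (smooth_ext hM openT) s => x _; exact: (esym (polar_mapP x ga gb gg)).
Qed.

End SkewMap.

Section Reduction.
Context (R : realType) (X : topologicalType) (n : nat) (M : charts R X n).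
Context (hM : complex_manifold M).
Context (A B : courant R X n) (hA : courant_algebroid M A) (hB : courant_algebroid M B).
Context (right : section A -> section B -> section B).
Context (left : section B -> section A -> section A).
Context (cr : connection M (@canchor _ _ _ A) right) (mr : preserves_metric M right).
Context (cl : connection M (@canchor _ _ _ B) left) (ml : preserves_metric M left).
Notation Gamma s := (section_on (Defs.smooth M) [set: X] s).

(** Paired with a section g, the right-hand side of the bracket condition is
    - <left_(right_g al) a1, a2>: the skew maps disappear. *)
Lemma bracket_compat_pairing :
  (forall (a1 a2 g : section A) (al : section B) x,
    Gamma a1 -> Gamma a2 -> Gamma al -> Gamma g ->
    cinner (g x) (left al (cdorf a1 a2) x - cdorf (left al a1) a2 x
      - cdorf a1 (left al a2) x - left (right a2 al) a1 x + left (right a1 al) a2 x)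
    = - cinner (left (right g al) a1 x) (a2 x)) ->
  bracket_compat M right left.
Proof.
move=> H a1 a2 al g1 g2 gal /= x; apply: (inner_ext_section hM hA) => g gg.
rewrite (H _ _ _ _ x g1 g2 gal gg) -opprD (innerNr hA).
have go := polar_map_smooth hM hA hB cl ml g1 g2.
have grg := nab_smooth cr gg gal.
apply: (congr1 -%R); symmetry.
apply: (etrans (polar_mapP hM hB hA cr mr x gal go gg)).
exact: (polar_mapP hM hA hB cl ml x g1 g2 grg).
Qed.

End Reduction.

Section CyclicConditions.
Context (R : realType) (X : topologicalType) (n : nat) (M : charts R X n).
Context (hM : complex_manifold M).
Context (E : hcourant R X n) (hE : holomorphic_courant_algebroid M E).
Context (nab : section (T01 M) -> section E -> section E).
Context (hnab : holomorphic_connection nab).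
Context (dorf : section E -> section E -> section E).
Context (hA : courant_algebroid M (E10 dorf)).
Notation smooth := (smooth M).
Notation Gamma s := (section_on (Defs.smooth M) [set: X] s).
Notation C := (C01 M).
Notation right := (nabla_right nab).
Notation left := (@nabla_left R X n M E).
Notation funx := functional_extensionality_dep.

Let hC : courant_algebroid M C := C01_courant hM.
Let cl := left_connection hM hA.
Let ml := left_metric hM hA.
Let cr := right_connection hM hnab.
Let mr := right_metric hM hE hnab hA.

(** <D f, Omega> = 0 for all f, since D f acts trivially. *)
Lemma rho10_skew_left (a b : section C) x : Gamma a -> Gamma b ->
  rho10 (@skew_map R X n M C (E10 dorf) left a b x) = 0.
Proof.
move=> ga gb; apply: (tact_ext hM (p := x)) => f sf; rewrite tact0.
apply: (etrans (esym (calD_inner hM hA (@skew_map R X n M C (E10 dorf) left a b x) sf))).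
have gD := calD_smooth hM hA sf.
apply: (etrans (skew_mapP hM hC hA cl x ga gb gD)).
rewrite (left_exact hM hA sf ga) (left_exact hM hA sf gb).
rewrite (_ : cinner _ _ = 0); last exact: (inner0l hC).
rewrite sub0r (innerC hC) (_ : cinner _ _ = 0); last exact: (inner0l hC).
by rewrite oppr0 mulr0.
Qed.

Lemma left_cyclic : @cyclic_compat R X n M C (E10 dorf) left.
Proof.
have H (a b c : section C) x : Gamma a -> Gamma b -> Gamma c ->
    left (@skew_map R X n M C (E10 dorf) left a b) c x = 0.
  move=> ga gb gc; have g0 := section_0 hM (courant_bundle hA) openT.
  have r0 y : rho10 (0 : E y) = 0 by exact: (anchor0 hA y).
  apply: (etrans _ (left_anchor0 hM hA g0 gc (r0 x))).
  have e : (fun q => rho10 (@skew_map R X n M C (E10 dorf) left a b q))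
      = (fun q => rho10 (0 : E q)).
    by apply: funx => q; rewrite r0 rho10_skew_left.
  exact: (congr1 (fun v => (lieT (M := M) v (fun q => (c q).1) x,
    lieTd (M := M) v (fun q => (c q).2) x)) e).
move=> a b c ga gb gc Omega x.
exact: (etrans (f_equal2 +%R (etrans (f_equal2 +%R (H a b c x ga gb gc) (H b c a x gb gc ga))
  (addr0 _)) (H c a b x gc ga gb)) (addr0 _)).
Qed.

(** A section (0, eta) acts trivially, so its product with the skew map is zero. *)
Lemma skew_right_fst (s t : section E) x : Gamma s -> Gamma t ->
  (@skew_map R X n M (E10 dorf) C right s t x).1 = 0.
Proof.
move=> gs gt; set u := skew_map _ _ _ _ _.
have P (eta : section (T01dual M)) : Gamma eta -> pair (eta x) u.1 = 0.
  move=> ge; have g0 := section_0 hM (T01_bundle hM) openT.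
  pose g : section C := fun q => (0, eta q).
  have gg : Gamma g := proj2 (C01_section hM g openT) (conj g0 ge).
  have := skew_mapP hM hA hC cr x gs gt gg.
  rewrite /nabla_right (nab0l hM hnab gs) (nab0l hM hnab gt).
  rewrite [X in _ * (X - _)](_ : _ = 0); last exact: (inner0l hA).
  rewrite sub0r (innerC hA) [X in _ * (- X)](_ : _ = 0); last exact: (inner0l hA).
  rewrite oppr0 mulr0 => h; apply: (etrans _ h).
  rewrite /= -[X in _ = _ + pair _ X](scale0r (0 : 'rV[R[i]]_n)).
  by rewrite [X in _ = _ + X](pairZr (m := n)) mul0r addr0.
apply/rowP => k; rewrite mx0E.
have [eta [ge e]] := exists_section hM (T01dual_bundle hM) (delta_mx 0 k : T01dual M x).
have := P eta ge; rewrite e => h; apply: (etrans _ h).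
rewrite /pair (bigD1 k)//= mxE !eqxx mul1r big1 ?addr0// => l lk.
by rewrite mxE eqxx /= (negbTE lk) mul0r.
Qed.

Lemma right_cyclic : @cyclic_compat R X n M (E10 dorf) C right.
Proof.
have H (s t v : section E) x : Gamma s -> Gamma t -> Gamma v ->
    right (@skew_map R X n M (E10 dorf) C right s t) v x = 0.
  move=> gs gt gv; rewrite -[RHS](congr1 (fun h : section E => h x) (nab0l hM hnab gv)).
  congr (nab _ v x); apply: funx => q; exact: skew_right_fst.
move=> s t v gs gt gv Omega x.
exact: (etrans (f_equal2 +%R (etrans (f_equal2 +%R (H s t v x gs gt gv) (H t v s x gt gv gs))
  (addr0 _)) (H v s t x gv gs gt)) (addr0 _)).
Qed.

Lemma curvature_compatible : @curvature_compat R X n M C (E10 dorf) right left.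
Proof.
move=> a a' s s' ga ga' gs gs' x.
rewrite (right_flat hM hnab ga ga' gs) (left_flat hM hA gs gs' ga).
by rewrite (innerC hA) -[LHS]/(_ + _) [X in X + _](_ : _ = 0) ?add0r;
  [exact: (inner0l hC)|rewrite (innerC hA); exact: (inner0l hA)].
Qed.

End CyclicConditions.

(** * The first bracket condition *)

Section VectorFieldCalculus.
Context (R : realType) (X : topologicalType) (n : nat) (M : charts R X n).
Context (hM : complex_manifold M).
Notation funx := functional_extensionality_dep.

Lemma field_calculus_TX :
  field_calculus (Defs.smooth M [set: X])
    (fun W : X -> 'rV[R[i]]_(n + n) => vsmooth M [set: X] W)
    (fun x (w : 'rV[R[i]]_(n + n)) f => tact M x w f) (lie M).
Proof.
have s0 : vsmooth M [set: X] (fun=> 0).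
  move=> b l; have o := openI openT (dom_open hM b).
  apply: (smooth_ext hM o) (smooth_cst hM 0 o) => q _; exact: (esym (tact0 _ _ _)).
split.
- by move=> Y f sY sf; exact: (vact_smooth hM openT sY sf).
- by move=> c; exact: (smooth_cst hM _ openT).
- by move=> x u c; exact: tact_cst.
- move=> Y Z sY sZ; rewrite (_ : (fun x => _) = fun x => (1 : R[i]) *: Y x + Z x).
    exact: (vsmooth_linear hM openT (smooth_cst hM 1 openT) sY sZ).
  by apply: funx => x; rewrite scale1r.
- move=> f Y sf sY; rewrite (_ : (fun x => _) = fun x => f x *: Y x + 0).
    exact: (vsmooth_linear hM openT sf sY s0).
  by apply: funx => x; rewrite addr0.
- by move=> Y Z sY sZ; exact: (lie_smooth hM openT sY sZ).
- by move=> x u v f; exact: tactDl.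
- by move=> x c u f; exact: tactZ.
- by move=> x u f g sf sg; exact: (tact_add hM I _ sf sg).
- by move=> x u f g sf sg; exact: (tact_sub hM openT I _ sf sg).
- by move=> x u f g sf sg; exact: (tact_mul hM I _ sf sg).
- by move=> x u v; exact: (tact_ext hM).
- by move=> Y Z f x sY sZ sf; exact: (lie_act hM openT sY sZ sf).
Qed.

End VectorFieldCalculus.

Section BracketCompatibility.
Context (R : realType) (X : topologicalType) (n : nat) (M : charts R X n).
Context (hM : complex_manifold M).
Context (E : hcourant R X n) (hE : holomorphic_courant_algebroid M E).
Context (nab : section (T01 M) -> section E -> section E).
Context (hnab : holomorphic_connection nab).
Context (dorf : section E -> section E -> section E).
Context (hA : courant_algebroid M (E10 dorf)).
Notation smooth := (smooth M).
Notation Gamma s := (section_on (Defs.smooth M) [set: X] s).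
Notation C := (C01 M).
Notation T := (T01 M).
Notation right := (nabla_right nab).
Notation left := (@nabla_left R X n M E).
Notation funx := functional_extensionality_dep.
Notation FC := (field_calculus_T01 hM).
Notation PC := (form_calculus_T01 hM).
Notation FV := (field_calculus_TX hM).
Notation act Y f := (vact M (fun q => emb01 (Y q)) f).

Section OneSection.
Context (al : section E) (gal : Gamma al).
Notation V := (fun q => rho10 (al q)).
Notation V' Y := (fun q => rho10 (nab Y al q)).
Notation lam Y := (lieT (M := M) V Y).
Notation lamP Y Z := (lieT (M := M) (V' Y) Z).
Implicit Types (Y Z U : section T).

Let cn : connection M (@anchor01 R X n M) nab.
Proof. by case: hnab. Qed.
Let tV : type10 M V := type10_rho10 hA gal.
Let tV' Y (gY : Gamma Y) : type10 M (V' Y) := type10_rho10 hA (nab_smooth cn gY gal).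
Let sE Y (gY : Gamma Y) : vsmooth M [set: X] (fun q => emb01 (Y q)) :=
  proj1 (T01_vsmooth hM Y openT) gY.
Let lamG Y (gY : Gamma Y) : Gamma (lam Y) := lieT_smooth hM tV.1 tV.2 gY.

Let lieV Y : Gamma Y -> lie M V (fun q => emb01 (Y q))
  = fun q => (-1) *: V' Y q + emb01 (lam Y q).
Proof.
move=> gY; apply: funx => q; rewrite (lie_rho10 hM hE hnab hA q gY gal).
by rewrite scaleN1r addrC.
Qed.

Let pr01_combine (a b c d : 'rV[R[i]]_(n + n)) :
  pr01 (((-1) *: a + b) + ((-1) *: - c + d))
  = pr01 b + pr01 d - pr01 a + pr01 c.
Proof.
rewrite !scaleN1r opprK !pr01D pr01N.
by rewrite [- _ + _]addrC [X in _ + X]addrC addrACA addrA.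
Qed.

(** The Jacobi identity for [V, [Y, Z]], projected to T^{0,1}. *)
Lemma lieT_lie01 Y Z x : Gamma Y -> Gamma Z ->
  lam (lie01 (M := M) Y Z) x = lie01 (M := M) (lam Y) Z x + lie01 (M := M) Y (lam Z) x
    - lamP Y Z x + lamP Z Y x.
Proof.
move=> gY gZ; have sY := sE gY; have sZ := sE gZ.
have slY := sE (lamG gY); have slZ := sE (lamG gZ).
have sPY := (tV' gY).1; have sPZ := (tV' gZ).1.
have eL : (fun q => emb01 (lie01 (M := M) Y Z q))
    = lie M (fun q => emb01 (Y q)) (fun q => emb01 (Z q)).
  by apply: funx => q; exact: (emb01_lie01 hM).
have J := br_jacobi FV x tV.1 sY sZ.
have J1 := etrans (congr1 (fun W => lie M W (fun q => emb01 (Z q)) x) (lieV gY))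
  (br_linear_l FV (-1) x sPY slY sZ).
have J2 := etrans (congr1 (fun W => lie M (fun q => emb01 (Y q)) W x) (lieV gZ))
  (br_linear_r FV (-1) x sY sPZ slZ).
have J3 := etrans J2 (congr1 (fun w => (-1) *: w + _)
  (lie_antisym M (fun q => emb01 (Y q)) (V' Z) x)).
have K := etrans J (f_equal2 +%R J1 J3).
apply: (etrans (congr1 (fun W => pr01 (lie M V W x)) eL)).
apply: (etrans (congr1 (@pr01 R n) K)); exact: pr01_combine.
Qed.

Lemma commutator_act Y f x : Gamma Y -> smooth [set: X] f ->
  vact M V (act Y f) x - act Y (vact M V f) x = act (lam Y) f x - vact M (V' Y) f x.
Proof.
move=> gY sf; apply: (etrans (esym (lie_act hM openT tV.1 (sE gY) sf I))).
rewrite (lie_rho10 hM hE hnab hA x gY gal); exact: tactB.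
Qed.

Notation dact := (fun (U : X -> 'rV[R[i]]_n) (h : X -> R[i]) (q : X) =>
  Defs.tact M q (emb01 (U q)) h).
Notation ev eta := (fun (U : X -> 'rV[R[i]]_n) (q : X) => pair (eta q) (U q)).
Notation fst_s b := (fun x => (b x).1).
Notation snd_s b := (fun x => (b x).2).
Notation D := (vact M V).
Notation DP Y := (vact M (V' Y)).

Let pair5 (u v w s t z : 'rV[R[i]]_n) :
  pair (u - v - w - s + t) z = pair u z - pair v z - pair w z - pair s z + pair t z.
Proof. by rewrite !pairDl !pairNl. Qed.

Let pair4 (e a b c d : 'rV[R[i]]_n) :
  pair e (a + b - c + d) = pair e a + pair e b - pair e c + pair e d.
Proof. by rewrite !pairDr pairNr. Qed.

Let cancel5 (a b c d e : 'rV[R[i]]_n) : a = b + c - d + e -> a - b - c - e + d = 0.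
Proof. by move=> ->; apply/rowP => k; rewrite !mxE; ring. Qed.

(** The component along T^{0,1} vanishes by lieT_lie01. The component along the
    dual, paired with a field Z, is form_bracket_transport: V transports the
    bracket of T^{0,1} up to the terms with nabla. *)
Lemma bracket_defect (a1 a2 g : section C) x : Gamma a1 -> Gamma a2 -> Gamma g ->
  cinner (g x) (left al (cdorf a1 a2) x - cdorf (left al a1) a2 x
      - cdorf a1 (left al a2) x - left (right a2 al) a1 x + left (right a1 al) a2 x)
    = - cinner (left (right g al) a1 x) (a2 x).
Proof.
move=> g1 g2 gg.
have [gY1 ge1] := proj1 (C01_section hM a1 openT) g1.
have [gY2 ge2] := proj1 (C01_section hM a2 openT) g2.
have [gZ _] := proj1 (C01_section hM g openT) gg.
have gl1 := left_smooth hM hA gal g1; have gl2 := left_smooth hM hA gal g2.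
have [gLY1 gLe1] := proj1 (C01_section hM _ openT) gl1.
have [gLY2 gLe2] := proj1 (C01_section hM _ openT) gl2.
have g12 := C01_bracket_smooth hM g1 g2.
have [gY12 ge12] := proj1 (C01_section hM _ openT) g12.
set w := (w in cinner (g x) w).
have w1 : w.1 = 0 by exact: (cancel5 (lieT_lie01 x gY1 gY2)).
have brG := lie01_smooth hM.
have add f h : smooth [set: X] f -> smooth [set: X] h -> smooth [set: X] (fun x => f x + h x).
  exact: (smooth_add hM openT).
have sub f h : smooth [set: X] f -> smooth [set: X] h -> smooth [set: X] (fun x => f x - h x).
  by move=> sf sg; exact: (smooth_add hM openT sf (smooth_opp hM openT sg)).
have act_additive (Y : section T) : Gamma Y ->
    additive_action (smooth [set: X]) (fun f q => Defs.tact M q (emb01 (Y q)) f).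
  move=> _; split=> f h q sf sg; first exact: (tact_add hM I _ sf sg).
  exact: (tact_sub hM openT I _ sf sg).
have D_additive : additive_action (smooth [set: X]) D.
  split=> f h q sf sg; first exact: (tact_add hM I _ sf sg).
  exact: (tact_sub hM openT I _ sf sg).
have D_smooth f : smooth [set: X] f -> smooth [set: X] (D f).
  by move=> sf; exact: (vact_smooth hM openT tV.1 sf).
have F1 := form_like_pairing FC PC ge1; have F2 := form_like_pairing FC PC ge2.
have tr (eta : section (T01dual M)) : transports (fun Y : section T => Gamma Y) (lie01 (M := M))
    (fun Y => lam Y) (fun Y Z => lamP Y Z) (ev eta).
  move=> Y Z q gY gZ'; apply: (etrans (congr1 (pair (eta q)) (lieT_lie01 q gY gZ'))).
  exact: pair4.
have K := form_bracket_transport add sub (act01_smooth hM) brG act_additive D_additive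
  D_smooth (@lamG) (@commutator_act) x gY1 gY2 gZ F1 F2 (tr _) (tr _).
have P eta Z : Gamma eta -> Gamma Z -> pair (lieTd (M := M) V eta x) (Z x)
    = lie_derivation D (fun Y => lam Y) (ev eta) Z x.
  by move=> ge gZ'; exact: (pair_lieTd hM tV.1 tV.2 x ge gZ').
have fb U : Gamma U -> ev (snd_s (cdorf a1 a2)) U
    = form_bracket dact (lie01 (M := M)) (fst_s a1) (ev (snd_s a1)) (fst_s a2) (ev (snd_s a2)) U.
  by move=> gU; apply: funx => q; exact: (C01_bracket_form hM q g1 g2 gU).
have eU := etrans (P _ _ ge12 gZ) (f_equal2 (fun u v => u - v)
  (congr1 (fun h => D h x) (fb _ gZ)) (congr1 (fun h => h x) (fb _ (lamG gZ)))).
have ld (b : section C) : Gamma (snd_s b : section (T01dual M)) ->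
    forall U : section T, Gamma U -> ev (snd_s (left al b)) U
    = lie_derivation D (fun Y => lam Y) (ev (snd_s b)) U.
  by move=> gb U gU; apply: funx => q; exact: (pair_lieTd hM tV.1 tV.2 q gb gU).
have eV := etrans (C01_bracket_form hM x gl1 g2 gZ)
  (form_bracket_eq dact brG x gLY1 gY2 gZ (ld _ ge1) (fun W _ => erefl (ev (snd_s a2) W))).
have eW := etrans (C01_bracket_form hM x g1 gl2 gZ)
  (form_bracket_eq dact brG x gY1 gLY2 gZ (fun W _ => erefl (ev (snd_s a1) W)) (ld _ ge2)).
have eS := pair_lieTd hM (tV' gY2).1 (tV' gY2).2 x ge1 gZ.
have eT := pair_lieTd hM (tV' gY1).1 (tV' gY1).2 x ge2 gZ.
have w2 : pair w.2 (g x).1 = - (pair (lieTd (M := M) (V' (fst_s g)) (snd_s a1) x) (a2 x).1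
    + pair (a2 x).2 (lamP (fst_s g) (fst_s a1) x)).
  apply: (etrans (pair5 _ _ _ _ _ _)).
  apply: (etrans (f_equal2 +%R (f_equal2 (fun u v => u - v) (f_equal2 (fun u v => u - v)
    (f_equal2 (fun u v => u - v) eU eV) eW) eS) eT)).
  apply: (etrans K); apply: (congr1 (fun z => - (z + _))).
  exact: (esym (pair_lieTd hM (tV' gZ).1 (tV' gZ).2 x ge1 gY2)).
have p0 (e : 'rV[R[i]]_n) : pair e 0 = 0.
  by rewrite -(scale0r (0 : 'rV[R[i]]_n)) (pairZr (m := n)) mul0r.
have e1 := etrans (congr1 (pair (g x).2) w1) (p0 _).
exact: (etrans (f_equal2 +%R e1 w2) (add0r _)).
Qed.

End OneSection.

Theorem bracket_compat_right_left : @bracket_compat R X n M C (E10 dorf) right left.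
Proof.
apply: (bracket_compat_pairing hM (C01_courant hM) hA (right_connection hM hnab)
  (right_metric hM hE hnab hA) (left_connection hM hA) (left_metric hM hA)).
by move=> a1 a2 g al x g1 g2 gal gg; exact: bracket_defect.
Qed.

End BracketCompatibility.

(** * The second bracket condition *)

Section SecondBracketCompatibility.
Context (R : realType) (X : topologicalType) (n : nat) (M : charts R X n).
Context (hM : complex_manifold M).
Context (E : hcourant R X n) (hE : holomorphic_courant_algebroid M E).
Context (nab : section (T01 M) -> section E -> section E).
Context (hnab : holomorphic_connection nab).
Context (dorf : section E -> section E -> section E).
Context (hA : courant_algebroid M (E10 dorf)) (hres : restricts_to_hdorf M dorf).
Notation smooth := (smooth M).
Notation Gamma s := (section_on (Defs.smooth M) [set: X] s).
Notation Hol U s := (section_on (holomorphic M) U s).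
Notation C := (C01 M).
Notation T := (T01 M).
Notation right := (nabla_right nab).
Notation left := (@nabla_left R X n M E).
Notation funx := functional_extensionality_dep.
Notation act Y f := (vact M (fun q => emb01 (Y q)) f).
Notation V s := (fun q => rho10 (s q : E q)).
Notation ip := (@hinner _ _ _ E _).
Notation cD h := (calD M (@hinner _ _ _ E) (@rho10 _ _ _ E) h).

Let cn : connection M (@anchor01 R X n M) nab.
Proof. by case: hnab. Qed.

Let ipDr x (u v w : E x) : ip w (u + v) = ip w u + ip w v.
Proof. exact: (innerDr hA). Qed.
Let ipNr x (u w : E x) : ip w (- u) = - ip w u.
Proof. exact: (innerNr hA). Qed.
Let ipZr x c (u w : E x) : ip w (c *: u) = c * ip w u.
Proof. exact: (innerZr hA). Qed.
Let ipC x (u w : E x) : ip u w = ip w u.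
Proof. exact: (innerC hA). Qed.
Let ip0r x (w : E x) : ip w 0 = 0.
Proof. by rewrite ipC; exact: (inner0l hA). Qed.
Let ip_smooth s t : Gamma s -> Gamma t -> smooth [set: X] (fun q => ip (s q) (t q)).
Proof. exact: (inner_smooth hA). Qed.

Lemma dorf_holomorphic U (s t : section E) : open U -> Gamma s -> Gamma t ->
  Hol U s -> Hol U t -> Hol U (dorf s t).
Proof.
move=> oU gs gt hs ht j k; have oUj := openI oU (tdom_open (hcourant_bundle hE) j).
have h : Hol U (hdorf U s t) by exact: (hcourant_dorf_holomorphic hE).
apply: (holomorphic_ext hM oUj _ (h j k)) => q [Uq _].
exact: (congr1 (fun w : E q => triv j w 0 k) (esym (hres oU gs gt hs ht Uq))).
Qed.

Let inner5 x (g a b c d e : E x) :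
  ip g (a - b - c - d + e) = ip g a - ip g b - ip g c - ip g d + ip g e.
Proof. by rewrite !ipDr !ipNr. Qed.

Section Fixed.
Context (Y : section T) (gY : Gamma Y) (g : section E) (gg : Gamma g) (x : X).
Notation L s := (lieT (M := M) (V s) Y).
Implicit Types (s t : section E) (f h : X -> R[i]).

Let LG s : Gamma s -> Gamma (L s).
Proof. by move=> gs; have t := type10_rho10 hA gs; exact: (lieT_smooth hM t.1 t.2 gY). Qed.
Let NG s : Gamma s -> Gamma (nab Y s).
Proof. by move=> gs; exact: (nab_smooth cn gY gs). Qed.

(** The two sides of the second bracket condition, paired with g: the failure of
    nabla_Y to be a derivation of the bracket, corrected by terms with L. *)
Let defect s t : R[i] :=
  ip (g x) (nab Y (dorf s t) x) - ip (g x) (dorf (nab Y s) t x)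
  - ip (g x) (dorf s (nab Y t) x) - ip (g x) (nab (L t) s x) + ip (g x) (nab (L s) t x)
  + ip (nab (L g) s x) (t x).

Let commutator s f : Gamma s -> smooth [set: X] f ->
  vact M (V s) (act Y f) x - act Y (vact M (V s) f) x
  = act (L s) f x - vact M (V (nab Y s)) f x.
Proof. by move=> gs sf; exact: (commutator_act hM hE hnab hA gs x gY sf). Qed.

Let scale_ring (yv vy v' ly vf yf f tau nt d nd d2 d3 n4 n5 q : R[i]) :
  vy - yv = ly - v' ->
  (yv * tau + vf * nt + (yf * d + f * nd)) - (v' * tau + f * d2)
    - (vy * tau + yf * d + (vf * nt + f * d3)) - f * n4 + (ly * tau + f * n5) + f * q
  = f * (nd - d2 - d3 - n4 + n5 + q).
Proof.
move=> c; have -> : ly = vy - yv + v' by rewrite c subrK.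
ring.
Qed.

Let add_ring (a b c d e f a' b' c' d' e' f' : R[i]) :
  (a + a') - (b + b') - (c + c') - (d + d') + (e + e') + (f + f')
  = (a - b - c - d + e + f) + (a' - b' - c' - d' + e' + f').
Proof. ring. Qed.

Let six_terms (a b c d e f a' b' c' d' e' f' : R[i]) : a = a' -> b = b' -> c = c' ->
  d = d' -> e = e' -> f = f' ->
  a - b - c - d + e + f = a' - b' - c' - d' + e' + f'.
Proof. by move=> -> -> -> -> -> ->. Qed.

Let L_add s t : Gamma s -> Gamma t -> L (fun q => s q + t q) = fun q => L s q + L t q.
Proof.
move=> gs gt; apply: funx => q; have ts := type10_rho10 hA gs; have tt' := type10_rho10 hA gt.
have tst := type10_rho10 hA (add_smooth hM hA gs gt).
have d : rho10 (s q + t q) = 1 *: rho10 (s q) + 1 *: rho10 (t q).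
  exact: (etrans (anchorD hA (s q) (t q)) (esym (scale1_sum _ _))).
exact: (etrans (lieT_comb hM tst ts tt' gY d) (scale1_sum _ _)).
Qed.

Let L_scale f s : smooth [set: X] f -> Gamma s ->
  L (fun q => f q *: s q) = fun q => f q *: L s q.
Proof.
move=> sf gs; apply: funx => q; have ts := type10_rho10 hA gs.
have tst := type10_rho10 hA (scale_smooth hM hA sf gs).
have d : rho10 (f q *: s q) = f q *: rho10 (s q) + 0 *: rho10 (s q).
  exact: (etrans (anchorZ hA (f q) (s q)) (esym (scale_sum0 _ _ _))).
exact: (etrans (lieT_comb hM tst ts ts gY d) (scale_sum0 _ _ _)).
Qed.

Let at_x (F G : section E) : F = G -> ip (g x) (F x) = ip (g x) (G x).
Proof. by move=> ->. Qed.

(** When t is multiplied by f, the terms in which f is differentiated add up to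
    ([V_s, Y] - L_s Y + V_(nabla_Y s))[f] = 0. *)
Lemma defect_tensorial s : Gamma s -> tensorial M x (defect s).
Proof.
move=> gs; split=> [t t' gt gt'|f t sf gt].
  have gst := dorf_smooth hA gs gt; have gst' := dorf_smooth hA gs gt'.
  have e1 : ip (g x) (nab Y (dorf s (fun q => t q + t' q)) x)
      = ip (g x) (nab Y (dorf s t) x) + ip (g x) (nab Y (dorf s t') x).
    apply: (etrans (congr1 (fun w => ip (g x) (nab Y w x)) (dorfDr hA gs gt gt'))).
    exact: (etrans (at_x (nab_addr cn gY gst gst')) (ipDr _ _ _)).
  have e2 : ip (g x) (dorf (nab Y s) (fun q => t q + t' q) x)
      = ip (g x) (dorf (nab Y s) t x) + ip (g x) (dorf (nab Y s) t' x).
    exact: (etrans (at_x (dorfDr hA (NG gs) gt gt')) (ipDr _ _ _)).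
  have e3 : ip (g x) (dorf s (nab Y (fun q => t q + t' q)) x)
      = ip (g x) (dorf s (nab Y t) x) + ip (g x) (dorf s (nab Y t') x).
    apply: (etrans (congr1 (fun w => ip (g x) (dorf s w x)) (nab_addr cn gY gt gt'))).
    exact: (etrans (at_x (dorfDr hA gs (NG gt) (NG gt'))) (ipDr _ _ _)).
  have e4 : ip (g x) (nab (L (fun q => t q + t' q)) s x)
      = ip (g x) (nab (L t) s x) + ip (g x) (nab (L t') s x).
    apply: (etrans (congr1 (fun w => ip (g x) (nab w s x)) (L_add gt gt'))).
    exact: (etrans (at_x (nab_addl cn (LG gt) (LG gt') gs)) (ipDr _ _ _)).
  have e5 : ip (g x) (nab (L s) (fun q => t q + t' q) x)
      = ip (g x) (nab (L s) t x) + ip (g x) (nab (L s) t' x).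
    exact: (etrans (at_x (nab_addr cn (LG gs) gt gt')) (ipDr _ _ _)).
  have e6 := ipDr (t x) (t' x) (nab (L g) s x).
  exact: (etrans (six_terms e1 e2 e3 e4 e5 e6) (add_ring _ _ _ _ _ _ _ _ _ _ _ _)).
have gst := dorf_smooth hA gs gt.
have sVf := act_smooth hM hA gs sf; have sYf := act01_smooth hM gY sf.
have gft := scale_smooth hM hA sf gt.
have e1 : ip (g x) (nab Y (dorf s (fun q => f q *: t q)) x)
    = act Y (vact M (V s) f) x * ip (g x) (t x) + vact M (V s) f x * ip (g x) (nab Y t x)
      + (act Y f x * ip (g x) (dorf s t x) + f x * ip (g x) (nab Y (dorf s t) x)).
  apply: (etrans (congr1 (fun w => ip (g x) (nab Y w x)) (dorfZr hA sf gs gt))).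
  apply: (etrans (at_x (nab_addr cn gY (scale_smooth hM hA sVf gt) (scale_smooth hM hA sf gst)))).
  apply: (etrans (ipDr _ _ _)); apply: (f_equal2 +%R).
    apply: (etrans (at_x (nab_leibniz cn sVf gY gt))).
    exact: (etrans (ipDr _ _ _) (f_equal2 +%R (ipZr _ _ _) (ipZr _ _ _))).
  apply: (etrans (at_x (nab_leibniz cn sf gY gst))).
  exact: (etrans (ipDr _ _ _) (f_equal2 +%R (ipZr _ _ _) (ipZr _ _ _))).
have e2 : ip (g x) (dorf (nab Y s) (fun q => f q *: t q) x)
    = vact M (V (nab Y s)) f x * ip (g x) (t x) + f x * ip (g x) (dorf (nab Y s) t x).
  apply: (etrans (at_x (dorfZr hA sf (NG gs) gt))).
  exact: (etrans (ipDr _ _ _) (f_equal2 +%R (ipZr _ _ _) (ipZr _ _ _))).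
have e3 : ip (g x) (dorf s (nab Y (fun q => f q *: t q)) x)
    = vact M (V s) (act Y f) x * ip (g x) (t x) + act Y f x * ip (g x) (dorf s t x)
      + (vact M (V s) f x * ip (g x) (nab Y t x) + f x * ip (g x) (dorf s (nab Y t) x)).
  apply: (etrans (congr1 (fun w => ip (g x) (dorf s w x)) (nab_leibniz cn sf gY gt))).
  apply: (etrans (at_x (dorfDr hA gs (scale_smooth hM hA sYf gt) (scale_smooth hM hA sf (NG gt))))).
  apply: (etrans (ipDr _ _ _)); apply: (f_equal2 +%R).
    apply: (etrans (at_x (dorfZr hA sYf gs gt))).
    exact: (etrans (ipDr _ _ _) (f_equal2 +%R (ipZr _ _ _) (ipZr _ _ _))).
  apply: (etrans (at_x (dorfZr hA sf gs (NG gt)))).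
  exact: (etrans (ipDr _ _ _) (f_equal2 +%R (ipZr _ _ _) (ipZr _ _ _))).
have e4 : ip (g x) (nab (L (fun q => f q *: t q)) s x) = f x * ip (g x) (nab (L t) s x).
  apply: (etrans (congr1 (fun w => ip (g x) (nab w s x)) (L_scale sf gt))).
  exact: (etrans (at_x (nab_scalel cn sf (LG gt) gs)) (ipZr _ _ _)).
have e5 : ip (g x) (nab (L s) (fun q => f q *: t q) x)
    = act (L s) f x * ip (g x) (t x) + f x * ip (g x) (nab (L s) t x).
  apply: (etrans (at_x (nab_leibniz cn sf (LG gs) gt))).
  exact: (etrans (ipDr _ _ _) (f_equal2 +%R (ipZr _ _ _) (ipZr _ _ _))).
have e6 := ipZr (f x) (t x) (nab (L g) s x).
apply: (etrans (six_terms e1 e2 e3 e4 e5 e6)).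
exact: (scale_ring _ _ _ _ _ _ _ _ _ _ _ _ (commutator gs sf)).
Qed.

Let inner_calD h q (w : E q) : smooth [set: X] h -> ip w (cD h q) = Defs.tact M q (rho10 w) h.
Proof. by move=> sh; rewrite ipC; exact: (calD_inner hM hA w sh). Qed.

Let cancel_ring (a b c d : R[i]) : a - b = c - d -> b - d - a + c = 0.
Proof. by move=> e; rewrite -[c](subrK d) -e; ring. Qed.

Let sym_ring (a b c d e f a' b' c' f' : R[i]) :
  a + a' - (b + c') - (c + b') + (f + f') = 0 ->
  (a - b - c - d + e + f) + (a' - b' - c' - e + d + f') = 0.
Proof. by move=> <-; ring. Qed.

(** The symmetric part of the bracket is a derivative, so that the symmetric
    part of the defect is an identity between derivatives of <s, t>. *)
Lemma defect_anti s t : Gamma s -> Gamma t -> defect s t + defect t s = 0.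
Proof.
move=> gs gt; pose h q := ip (s q) (t q).
have sh : smooth [set: X] h := ip_smooth gs gt.
have gst := dorf_smooth hA gs gt; have gts := dorf_smooth hA gt gs.
have gDh : Gamma (cD h) := calD_smooth hM hA sh.
have sym u v q : Gamma u -> Gamma v ->
    ip (g q) (dorf u v q) + ip (g q) (dorf v u q)
    = Defs.tact M q (rho10 (g q)) (fun z => ip (u z) (v z)).
  move=> gu gv; apply: (etrans (esym (ipDr _ _ _))).
  apply: (etrans (congr1 (ip (g q)) (dorf_sym hM hA q gu gv))).
  exact: (inner_calD (g q) (ip_smooth gu gv)).
apply: sym_ring.
have ea : ip (g x) (nab Y (dorf s t) x) + ip (g x) (nab Y (dorf t s) x)
    = act Y (vact M (V g) h) x - vact M (V (nab Y g)) h x.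
  apply: (etrans (esym (ipDr _ _ _))).
  apply: (etrans (esym (at_x (nab_addr cn gY gst gts)))).
  have e0 : (fun q => dorf s t q + dorf t s q) = cD h.
    by apply: funx => q; exact: (dorf_sym hM hA q gs gt).
  apply: (etrans (congr1 (fun w => ip (g x) (nab Y w x)) e0)).
  have e1 := nab_metric hM hE hnab hA x gY gg gDh.
  have e2 : vact M (fun q => emb01 (Y q)) (fun q => ip (g q) (cD h q)) x
      = act Y (vact M (V g) h) x.
    by apply: (tact_eq hM openT I) => q _; exact: (inner_calD (g q) sh).
  have e3 := inner_calD (nab Y g x) sh.
  apply: (addrI (ip (nab Y g x) (cD h x))); apply: (etrans (esym e1)).
  by apply: (etrans e2); apply: (etrans (esym (addrNK (vact M (V (nab Y g)) h x) _)));
    apply: (etrans (addrC _ _)); apply: (congr1 (fun z => z + _)); exact: (esym e3).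
have eb := sym _ _ x (NG gs) gt.
have ec := etrans (addrC _ _) (sym _ _ x (NG gt) gs).
have ef := esym (nab_metric hM hE hnab hA x (LG gg) gs gt).
have ef' : ip (nab (L g) s x) (t x) + ip (nab (L g) t x) (s x) = act (L g) h x.
  exact: (etrans (congr1 (fun z => _ + z) (ipC _ _)) ef).
apply: (etrans (f_equal2 +%R (f_equal2 (fun u v => u - v) (f_equal2 (fun u v => u - v) ea eb) ec) ef')).
have s1 := ip_smooth (NG gs) gt; have s2 := ip_smooth (NG gt) gs.
have e : Defs.tact M x (rho10 (g x)) (fun z => ip (nab Y s z) (t z))
    + Defs.tact M x (rho10 (g x)) (fun z => ip (nab Y t z) (s z))
    = vact M (V g) (act Y h) x.
  apply: (etrans (esym (tact_add hM I _ s1 s2))); apply: (tact_eq hM openT I) => q _.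
  apply: (etrans (congr1 (fun z => _ + z) (ipC _ _))).
  exact: (esym (nab_metric hM hE hnab hA q gY gs gt)).
have c := commutator gg sh.
apply: (etrans (congr1 (fun z => z + _) (etrans (esym (addrA _ _ _))
  (congr1 (fun z => _ + z) (etrans (esym (opprD _ _)) (congr1 -%R e)))))).
exact: (cancel_ring c).
Qed.

Let hol_defect N s t : open N -> N x -> Gamma s -> Gamma t -> Hol N s -> Hol N t ->
  defect s t = 0.
Proof.
move=> oN Nx gs gt hs ht.
have z U u : Gamma u -> Gamma U -> Hol N u -> nab U u x = 0.
  by move=> gu gU hu; exact: (nab_holomorphic hnab oN gu hu gU Nx).
have gst := dorf_smooth hA gs gt; have hst := dorf_holomorphic oN gs gt hs ht.
have z1 q : N q -> nab Y s q = 0 by move=> Nq; exact: (nab_holomorphic hnab oN gs hs gY Nq).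
have z2 q : N q -> nab Y t q = 0 by move=> Nq; exact: (nab_holomorphic hnab oN gt ht gY Nq).
have zero (w : E x) : w = 0 -> ip (g x) w = 0 by move=> ->; exact: ip0r.
have e1 := zero _ (z _ _ gst gY hst).
have e2 := zero _ (dorf_local_zero hM hA oN Nx (NG gs) gt z1).1.
have e3 := zero _ (dorf_local_zero hM hA oN Nx (NG gt) gs z2).2.
have e4 := zero _ (z _ _ gs (LG gt) hs).
have e5 := zero _ (z _ _ gt (LG gs) ht).
have e6 : ip (nab (L g) s x) (t x) = 0.
  by rewrite ipC; apply: (etrans (congr1 (ip (t x)) (z _ _ gs (LG gg) hs))); exact: ip0r.
apply: (etrans (six_terms e1 e2 e3 e4 e5 e6)); by rewrite !subr0 !addr0.
Qed.

(** The defect is tensorial in t, hence in s by antisymmetry, so it suffices to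
    treat holomorphic sections; the bracket of these is holomorphic and nabla_Y
    kills all the terms. *)
Lemma defect0 s t : Gamma s -> Gamma t -> defect s t = 0.
Proof.
have bE := hcourant_bundle hE.
move=> gs gt; apply: (tensorial_holomorphic hM bE (defect_tensorial gs) _ gt)
  => t' N oN Nx gt' ht'.
have anti : defect s t' = - defect t' s.
  by apply/eqP; rewrite -subr_eq0 opprK; apply/eqP; exact: defect_anti.
rewrite anti (tensorial_holomorphic hM bE (defect_tensorial gt') _ gs) ?oppr0//.
move=> s' N' oN' Nx' gs' hs'; have oI := openI oN oN'.
apply: (hol_defect oI (conj Nx Nx') gt' gs') => j k.
  by apply: holomorphic_sub (ht' j k) => q [[]].
by apply: holomorphic_sub (hs' j k) => q [[]].
Qed.

End Fixed.

Theorem bracket_compat_left_right : @bracket_compat R X n M (E10 dorf) C left right.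
Proof.
apply: (bracket_compat_pairing hM hA (C01_courant hM) (left_connection hM hA)
  (left_metric hM hA) (right_connection hM hnab) (right_metric hM hE hnab hA)).
move=> s t g b x gs gt gb gg.
have [gY _] := proj1 (C01_section hM b openT) gb.
have := defect0 gY gg x gs gt.
move/eqP; rewrite addr_eq0 => /eqP e; apply: (etrans _ e).
exact: inner5.
Qed.

End SecondBracketCompatibility.

(** * The matched pair *)

Theorem proposition4p17 (R : realType) (X : topologicalType) (n : nat)
    (M : charts R X n) (hM : complex_manifold M)
    (E : hcourant R X n) (hE : holomorphic_courant_algebroid M E)
    (nabla : section (T01 M) -> section E -> section E)
    (hnabla : holomorphic_connection nabla)
    (dorf : section E -> section E -> section E)
    (hdorf : courant_algebroid M (E10 dorf))
    (hres : restricts_to_hdorf M dorf) :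
  @matched_pair R X n M (C01 M) (E10 dorf)
    (nabla_right nabla) (@nabla_left R X n M E) /\
  @flat R X n M (C01 M) E (@cdorf R X n (C01 M)) (nabla_right nabla) /\
  @flat R X n M E (C01 M) dorf (@nabla_left R X n M E).
Proof.
split; last by split; [exact: right_flat|exact: left_flat].
split.
- exact: C01_courant.
- exact: hdorf.
- exact: right_connection.
- exact: (left_connection hM hdorf).
- exact: (right_metric hM hE hnabla hdorf).
- exact: (left_metric hM hdorf).
- exact: (right_exact hM hnabla).
- exact: (left_exact hM hdorf).
- exact: (bracket_compat_right_left hM hE hnabla hdorf).
- exact: (bracket_compat_left_right hM hE hnabla hdorf hres).
- exact: (curvature_compatible hM hnabla hdorf).
- exact: (left_cyclic hM hdorf).
- exact: (right_cyclic hM hnabla hdorf).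
Qed.
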